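(* For each $r$ let $a_r=(a_1^{(r)},\dots,a_I^{(r)})^\top$ and $b_r=(b_1^{(r)},\dots,b_J^{(r)})^\top$ be vectors whose coordinates are natural numbers and such that $n_r:=|a_r|=|b_r|$. Suppose that the law of the random matrix $W_r=(W_{ij}^{(r)})_{(i,j)\in R}$, $R=\{1,\dots,I\}\times\{1,\dots,J\}$, is given by $$P(W_r=k)=\frac{\prod_{i=1}^I a_i^{(r)}!\ \prod_{j=1}^J b_j^{(r)}!}{n_r!\ \prod_{(i,j)\in R}k_{ij}!}$$ for $k=(k_{ij})_{(i,j)\in R}$ such that $k_{ij}\in\{0,1,\dots\}$, $\sum_{j=1}^Jk_{ij}=a_i^{(r)}$ and $\sum_{i=1}^Ik_{ij}=b_j^{(r)}$ for all $(i,j)\in R$. Assume that as $r\to\infty$, $$n_r\to\infty,\qquad a_r/n_r\to\alpha=(\alpha_1,\dots,\alpha_I)\in T_I,\qquad b_r/n_r\to\beta=(\beta_1,\dots,\beta_J)\in T_J .$$ Then $$\frac1{\sqrt{n_r}}\Big(W_r-\frac1{n_r}a_rb_r^\top\Big)\xrightarrow{d}N(0,\Sigma),$$ where $\Sigma=(\Sigma_{i,j}^{k,l})$ and $\Sigma_{i,j}^{k,l}=\alpha_i(\delta_{ik}-\alpha_k)\,\beta_j(\delta_{jl}-\beta_l)$.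
   Context: For $x=(x_1,\dots,x_d)^\top\in\mathbb R^d$, $|x|=\sum_{i=1}^dx_i$. $T_d=\{x\in(0,1)^d:|x|=1\}$. $\delta$ is the Kronecker delta. $\Sigma_{i,j}^{k,l}$ is the entry of the $IJ\times IJ$ covariance matrix $\Sigma$ with row index $(i,j)$ and column index $(k,l)$, i.e. the limiting covariance of the $(i,j)$ and $(k,l)$ entries of the matrix. *)

(* Defs.v *)
From HB Require Import structures.
From mathcomp Require Import all_boot all_order all_algebra.
From mathcomp Require Import all_classical all_reals all_analysis.

Set Implicit Arguments.
Unset Strict Implicit.
Unset Printing Implicit Defensive.

Import Order.TTheory GRing.Theory Num.Theory.
Import numFieldNormedType.Exports.

Local Open Scope classical_set_scope.
Local Open Scope ring_scope.

Definition natmx {R : realType} {m n : nat} (k : 'M[nat]_(m, n)) : 'M[R]_(m, n) :=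
  map_mx (fun c : nat => c%:R) k.

Definition open_simplex {R : realType} (d : nat) : set 'cV[R]_d :=
  [set x | (forall i, 0 < x i 0 < 1) /\ \sum_i x i 0 = 1].

Definition has_margins {I J : nat} (a : 'cV[nat]_I) (b : 'cV[nat]_J)
    (k : 'M[nat]_(I, J)) : bool :=
  [forall i, (\sum_(j < J) k i j)%N == a i ord0] &&
  [forall j, (\sum_(i < I) k i j)%N == b j ord0].

Definition table_pmf {R : realType} {I J : nat} (a : 'cV[nat]_I) (b : 'cV[nat]_J)
    (k : 'M[nat]_(I, J)) : R :=
  if has_margins a b k then
    ((\prod_(i < I) (a i ord0)`! * \prod_(j < J) (b j ord0)`!)%N)%:R /
    (((\sum_(i < I) a i ord0)`! * \prod_(i < I) \prod_(j < J) (k i j)`!)%N)%:R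
  else 0.

(* For a random element of a countable type, measurability of the fibers is
   measurability with respect to the discrete sigma-algebra. *)
Definition has_pmf {R : realType} {d : measure_display} {T : measurableType d}
    {K : countType} (P : probability T R) (X : T -> K) (p : K -> R) : Prop :=
  forall k, measurable (X @^-1` [set k]) /\ P (X @^-1` [set k]) = (p k)%:E.

Definition borelType (S : ptopologicalType) := g_sigma_algebraType (@open S).

(* The terms X r may live on different probability spaces. *)
Definition cvg_in_distribution {R : realType} {S : ptopologicalType}
    {d : nat -> measure_display} {T : forall r, measurableType (d r)}
    (P : forall r, probability (T r) R) (X : forall r, T r -> S)
    (mu : probability (borelType S) R) : Prop :=
  forall f : S -> R, continuous f -> (exists M : R, forall x, `|f x| <= M) ->
    (\int[P r]_w (f (X r w))%:E)%E @[r --> \oo] --> (\int[mu]_x (f x)%:E)%E.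

(* normal_prob m 0 is the uniform law on [0, 1], so the degenerate case is
   treated separately. *)
Definition normal1 {R : realType} (m s : R) (B : set R) : \bar R :=
  if s == 0 then \d_m B else normal_prob m s B.

(* The possibly degenerate normal law N(M, S) on m x n matrices, with S i j k l
   the covariance of the entries (i, j) and (k, l): every linear functional
   is univariate normal, with the mean and the variance prescribed by M and S. *)
Definition is_normal {R : realType} {m n : nat}
    (mu : probability (borelType 'M[R]_(m, n)) R) (M : 'M[R]_(m, n))
    (S : 'I_m -> 'I_n -> 'I_m -> 'I_n -> R) : Prop :=
  (forall i j k l, S i j k l = S k l i j) /\
  forall t : 'M[R]_(m, n), exists2 s : R,
    s ^+ 2 = \sum_i \sum_j \sum_k \sum_l t i j * S i j k l * t k l &
    forall B : set R, measurable B ->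
      mu [set x : 'M[R]_(m, n) | B (\sum_i \sum_j t i j * x i j)] =
      normal1 (\sum_i \sum_j t i j * M i j) s B.

(* Main.v *)
Require Import Defs.
From HB Require Import structures.
From mathcomp Require Import all_boot all_order all_algebra.
From mathcomp Require Import all_classical all_reals all_analysis.
From mathcomp Require Import ring lra zify.
From mathcomp Require Import measurable_realfun.

Set Implicit Arguments.
Unset Strict Implicit.
Unset Printing Implicit Defensive.

Import Order.TTheory GRing.Theory Num.Theory.
Import numFieldNormedType.Exports.

Local Open Scope classical_set_scope.
Local Open Scope ring_scope.

(** The theorem is proved by induction on the numbers of rows and columns, by conditioning
    on the first column of the table.

    Given its first column c, the rest of the table has the same kind of law, with row sums
    a - c (table_pmf_split), while the first column itself is that of the table with two
    columns in which all the others are lumped together. Conversely, the standardised table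
    is an explicit function of the standardised first column and of the standardised rest,
    whose coefficients converge (cvg_glued). If the limit theorem holds for I by 2 and for
    I by J tables, it follows for I by (1 + J) tables, the limit being the same function of
    two independent normal matrices (table_clt_step). Its linear functionals are sums of
    independent normal variables (normal_law_add), and that their variances are those given
    by the covariance of the theorem is the law of total variance (cov_form_split).

    For the induction the margins are arbitrary convergent sequences and test functions may
    depend on r. They converge continuously, that is along every sequence of tables whose
    standardised values converge (test_functions). The conditional expectation of a test
    function given the first column is then again a test function of this kind, by the
    theorem for the remaining columns.

    By transposition (table_clt_tr) everything reduces to two rows and two columns, where
    the corner entry has a hypergeometric law and determines the other entries. The local
    limit theorem for it (hypergeometric_llt) is an expansion of nine factorials by the
    formula of Stirling, whose constant comes from the product of Wallis, that is from the
    Beta integrals B(m + 1, m + 1) converging to the Gaussian integral after rescaling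
    (cvg_wallis). The local theorem gives the convergence of expectations by the argument of
    Scheffe: the probabilities define step densities that converge pointwise to the normal
    density without loss of mass (lattice_local_limit, pratt_cvg). *)

(** * Affine changes of variable *)

(** The Lebesgue measure is characterised by its values on the intervals ]a, b], so it
    suffices to compare it with `|c| times its image under the affine map on these. *)
Lemma lebesgue_affine (R : realType) (c d : R) (A : set R) : c != 0 -> measurable A ->
  (lebesgue_measure ((fun x => (c * x + d)%R) @^-1` A) = (`|c|^-1)%:E * lebesgue_measure A)%E.
Proof.
move=> c0 mA.
have mF : measurable_fun setT (fun x : measurableTypeR R => (c * x + d)%R : measurableTypeR R).
  by apply: measurable_funD => //; apply: measurable_funM.
pose nu := mscale (NngNum (normr_ge0 c)) (pushforward lebesgue_measure
  (fun x : measurableTypeR R => (c * x + d)%R : measurableTypeR R)).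
have E : lebesgue_measure A = nu mF A.
  apply: lebesgue_measure_unique => // _ [[a b] _ <-] /=.
  rewrite /nu /mscale/= /pushforward.
  have [cp|cn|] := ltgtP 0 c; last by move=> c00; rewrite -c00 eqxx in c0.
    rewrite (_ : _ @^-1` _ = `](a - d) / c, (b - d) / c]%classic); last first.
      apply/seteqP; split => x /=; rewrite !in_itv/= ltr_pdivrMr// ler_pdivlMr//;
      by rewrite ltrBlDr lerBrDr (mulrC x).
    rewrite !lebesgue_measure_itv/= !lte_fin ltr_pM2r ?invr_gt0// ltrD2r.
    case: ifP => ab; last by rewrite mule0.
    rewrite -!EFinD -EFinM gtr0_norm//; congr (_%:E); field; lra.
  (* A negative slope moves the open end of the interval to the other side, which does
     not change its length. *)
  rewrite (_ : _ @^-1` _ = `[(b - d) / c, (a - d) / c[%classic); last first.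
    apply/seteqP; split => x /=; rewrite !in_itv/= ltr_ndivlMr// ler_ndivrMr//;
    by rewrite ltrBlDr lerBrDr (mulrC x) andbC.
  rewrite !lebesgue_measure_itv/= !lte_fin ltr_nM2r ?invr_lt0// ltrD2r.
  case: ifP => ab; last by rewrite mule0.
  rewrite -!EFinD -EFinM ltr0_norm//; congr (_%:E); field; lra.
rewrite E /nu /mscale/= muleA -EFinM mulVf ?mul1e ?normr_eq0//.
Qed.

Lemma ge0_integral_affine (R : realType) (c d : R) (G : R -> \bar R) : c != 0 ->
  measurable_fun setT G -> (forall x, 0 <= G x)%E ->
  (\int[lebesgue_measure]_x G (c * x + d)%R = (`|c|^-1)%:E * \int[lebesgue_measure]_x G x)%E.
Proof.
move=> c0 mG G0.
have mF : measurable_fun setT (fun x : measurableTypeR R => (c * x + d)%R : measurableTypeR R).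
  by apply: measurable_funD => //; apply: measurable_funM.
have := @ge0_integral_pushforward _ _ (measurableTypeR R) (measurableTypeR R) R _ mF
  lebesgue_measure setT G measurableT mG (fun x _ => G0 x).
rewrite preimage_setT /= => <-.
have c1 : 0 <= `|c|^-1 by rewrite invr_ge0.
transitivity (\int[mscale (NngNum c1) lebesgue_measure]_x G x)%E; last first.
  by rewrite ge0_integral_mscale.
apply: eq_measure_integral => A mA _.
exact: lebesgue_affine.
Qed.

(** * Convergence in the formula of Stirling *)

Lemma ln_sqrt (R : realType) (x : R) : 0 < x -> ln (Num.sqrt x) = ln x / 2.
Proof.
move=> x0; have : ln (Num.sqrt x ^+ 2) = ln x by rewrite sqr_sqrtr// ltW.
by rewrite lnXn ?sqrtr_gt0// => <-; rewrite mulr2n; field.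
Qed.

(** The mean value theorem: the remainder has derivative u^2 / (1 + u), which is at most
    2 u^2 when `|u| <= 1/2. *)
Lemma ln1D_quad (R : realType) (u : R) : `|u| <= 1/2 ->
  `|ln (1 + u) - (u - u ^+ 2 / 2)| <= 2 * `|u| ^+ 3.
Proof.
pose f := fun x : R => ln (1 + x) - (x - x ^+ 2 / 2).
pose df := fun x : R => (1 + x)^-1 - (1 - x).
move=> hu.
have fd (x : R) : - 1 < x -> is_derive x 1 f (df x).
  move=> x1; rewrite /f /df.
  have h1 : 0 < 1 + x by lra.
  have h2 : is_derive x 1 (fun x => ln (1 + x)) ((1 + x)^-1).
    have := @is_derive1_comp R (@ln R) (fun x => 1 + x) x (1+x)^-1 1 (is_derive1_ln h1).
    rewrite mulr1; apply.
    have H : is_derive x 1 (cst 1 + @id R) (0 + 1) by apply: is_deriveD.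
    by rewrite -[X in is_derive _ _ _ X]add0r; exact: H.
  have h3 : is_derive x 1 (fun x : R => x - x ^+ 2 / 2) (1 - x).
    by apply: is_derive_eq; rewrite ?scaler0 ?addr0 ?add0r /GRing.scale/=; field.
  exact: is_deriveB.
have dfE x : -1 < x -> df x = x^+2 / (1 + x).
  by move=> x1; rewrite /df; field; lra.
have key (a b : R) : -1 < a -> a <= b -> exists2 c, c \in `[a, b] & f b - f a = df c * (b - a).
  move=> a1 ab; apply: MVT_segment => //.
    by move=> x; rewrite in_itv/= => /andP[xa _]; apply: fd; lra.
  apply: derivable_within_continuous => x; rewrite in_itv/= => /andP[xa _].
  by have [] := fd x _; first lra.
have f0 : f 0 = 0 by rewrite /f addr0 ln1; lra.
rewrite -/(f u).
have fin c : -1/2 <= c -> `|c| <= `|u| -> `|f u| = `|df c| * `|u| -> `|f u| <= 2 * `|u|^+3.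
  move=> c1 cu ->; rewrite dfE ?normrM ?normrX; last lra.
  rewrite exprSr mulrA ler_wpM2r//.
  have -> : `|(1+c)^-1| = (1 + c)^-1 by rewrite ger0_norm// invr_ge0; lra.
  rewrite mulrC; apply: ler_pM; rewrite ?invr_ge0 ?exprn_ge0//; first lra.
    by rewrite invf_ple ?posrE; lra.
  by rewrite -expr2 lerXn2r ?nnegrE.
have [u0|u0] := leP 0 u.
  have [||c] := key 0 u; [lra|lra|].
  rewrite f0 !subr0 in_itv/= => /andP[c0 cu] E.
  apply: (fin c); [lra| |by rewrite E normrM].
  by rewrite !ger0_norm//; lra.
have hu2 : - u <= 1 / 2 by rewrite -(ltr0_norm u0).
have [||c] := key u 0; [lra|lra|].
rewrite f0 !sub0r in_itv/= => /andP[c0 cu] E.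
apply: (fin c); [lra| |].
  by rewrite ler0_norm// ltr0_norm//; lra.
by rewrite -normrN E normrM normrN.
Qed.

(** The logarithm of m! / (m^m exp(-m) sqrt m). *)
Definition ln_stirling (R : realType) (m : nat) : R :=
  ln (m`!)%:R - (m%:R * ln m%:R - m%:R + ln m%:R / 2).

(** The increments are of order 1 / m^2. The telescoping bound is what makes
    ln_stirling R m - 8 / m increase and ln_stirling R m + 8 / m decrease. *)
Lemma ln_stirling_step (R : realType) (m : nat) : (2 <= m)%N ->
  `|ln_stirling R m.+1 - ln_stirling R m| <= 8 / m%:R - 8 / m.+1%:R.
Proof.
move=> m2; have m0 : 0 < m%:R :> R by rewrite ltr0n; lia.
have m2' : 2 <= m%:R :> R by rewrite ler_nat.
have S : m.+1%:R = m%:R + 1 :> R by rewrite -natr1.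
have lnS : ln (m.+1%:R) = ln (m%:R) + ln (1 + m%:R^-1) :> R.
  have h : 0 < 1 + m%:R^-1 :> R by rewrite addr_gt0// invr_gt0.
  rewrite -lnM ?posrE//.
  by congr ln; rewrite S mulrDr mulr1 divff// gt_eqF.
have lnF : ln (m.+1`!)%:R = ln (m.+1%:R) + ln (m`!)%:R :> R.
  by rewrite factS natrM lnM ?posrE ?ltr0n ?fact_gt0.
have := @ln1D_quad R m%:R^-1.
have u0 : 0 < m%:R^-1 :> R by rewrite invr_gt0.
have u2 : m%:R^-1 <= 1/2 :> R by rewrite invf_ple ?posrE//; lra.
rewrite gtr0_norm// => /(_ u2) H.
have -> : ln_stirling R m.+1 - ln_stirling R m = 1 - (m%:R + 1/2) * ln (1 + m%:R^-1).
  by rewrite /ln_stirling lnF lnS S; field.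
move: H; set L := ln _; set x := m%:R in m0 m2' S u0 u2 *.
rewrite S => H.
have -> : 1 - (x + 1/2) * L = - (x + 1/2) * (L - (x^-1 - x^-1 ^+ 2 / 2)) + 1/4 * x^-1 ^+2.
  by field; lra.
apply: (le_trans (ler_normD _ _)); rewrite normrM normrN (gtr0_norm (_ : 0 < x + 1/2)); last lra.
rewrite (@ger0_norm _ (1/4 * _)); last by rewrite mulr_ge0// sqr_ge0.
apply: (@le_trans _ _ ((x + 1/2) * (2 * x^-1 ^+ 3) + 1/4 * x^-1 ^+ 2)).
  by rewrite lerD2r ler_wpM2l//; lra.
rewrite -subr_ge0.
have -> : 8 / x - 8 / (x + 1) - ((x + 1 / 2) * (2 * x^-1 ^+ 3) + 1 / 4 * x^-1 ^+ 2)
  = (8 * x ^+ 2 - (2 * x + 1 + x / 4) * (x + 1)) / (x ^+ 3 * (x + 1)).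
  by field; rewrite !gt_eqF//; lra.
apply: divr_ge0; last by rewrite mulr_ge0 ?exprn_ge0//; lra.
nra.
Qed.

Lemma cvg_ln_stirling (R : realType) : cvgn (@ln_stirling R).
Proof.
pose v (m : nat) := ln_stirling R m.+2 - 8 / m.+2%:R.
pose w (m : nat) := ln_stirling R m.+2 + 8 / m.+2%:R.
have vi : {homo v : m n / (m <= n)%N >-> m <= n}.
  apply/nondecreasing_seqP => m; rewrite /v.
  have := @ln_stirling_step R m.+2 isT; rewrite ler_norml.
  by move: (8 / _) (8 / _) => x y /andP[? ?]; lra.
have wi : {homo w : m n / (m <= n)%N >-> n <= m}.
  apply/nonincreasing_seqP => m; rewrite /w.
  have := @ln_stirling_step R m.+2 isT; rewrite ler_norml.
  by move: (8 / _) (8 / _) => x y /andP[? ?]; lra.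
have : cvgn v.
  apply: nondecreasing_is_cvgn => //; exists (w 0%N) => _ [m _ <-].
  apply: (@le_trans _ _ (w m)); last exact: wi.
  by rewrite lerD2l ge0_cp.
move=> cv; apply/cvg_ex; exists (limn v); rewrite -(cvg_shiftn 2).
have -> : [sequence ln_stirling R (n + 2)]_n = fun n => v n + 8 * (n + 2)%:R^-1.
  by apply/funext => n /=; rewrite /v addn2 subrK.
rewrite -[limn v]addr0; apply: cvgD => //.
rewrite -(mulr0 8); apply: cvgMl_tmp.
rewrite (@cvg_shiftn 2 _ (fun n : nat => n%:R^-1 : R)).
rewrite -cvg_shiftS.
exact: cvg_harmonic.
Qed.

(** * The product of Wallis as a Gaussian integral *)

Lemma cvg_of_dist_le (R : realType) (u v w : nat -> R) (l : R) :
  (\forall n \near \oo, `|u n - v n| <= w n) ->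
  w n @[n --> \oo] --> 0 -> v n @[n --> \oo] --> l -> u n @[n --> \oo] --> l.
Proof.
move=> uv w0 vl.
rewrite (_ : u = fun n => (u n - v n) + v n); last by apply/funext => n; rewrite subrK.
rewrite -[l]add0r; apply: cvgD => //.
apply: norm_cvg0.
apply: (@squeeze_cvgr _ _ _ _ (fun=> 0) w) => //; last exact: cvg_cst.
by apply: filterS uv => n ->; rewrite normr_ge0.
Unshelve. all: by end_near. Qed.

Lemma cvg_invn (R : realType) : (n%:R^-1 : R) @[n --> \oo] --> 0.
Proof. by rewrite -(@cvg_shiftS R (fun n : nat => n%:R^-1)); exact: cvg_harmonic. Qed.

(** From n * ln (1 - z / n) --> - z, by the expansion of the logarithm. *)
Lemma cvg_one_minus_expn (R : realType) (z : R) :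
  ((1 - z / n%:R) ^+ n) @[n --> \oo] --> expR (- z).
Proof.
pose u (n : nat) : R := - z * n%:R^-1.
have u0 : u n @[n --> \oo] --> 0.
  by rewrite -(mulr0 (- z)); apply: cvgMl_tmp; exact: cvg_invn.
have un12 : \forall n \near \oo, `|u n| <= 1/2.
  by apply: (cvgr0_norm_le _ u0); lra.
have lim : (n%:R * ln (1 + u n)) @[n --> \oo] --> - z.
  apply: (@cvg_of_dist_le R _ (fun n => - z + z * u n / 2 ) (fun n => 2 * `|z| * `|u n| * `|u n|)).
  - near=> n.
    have n0 : 0 < n%:R :> R by rewrite ltr0n; near: n; exact: nbhs_infty_gt.
    have un : `|u n| <= 1/2.
      by near: n; exact: un12.
    have nu : n%:R * u n = - z by rewrite /u mulrCA divff ?mulr1 ?gt_eqF.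
    have := ln1D_quad un; set L := ln _ => H.
    have -> : n%:R * L - (- z + z * u n / 2) = n%:R * (L - (u n - u n ^+ 2 / 2)).
      have -> : n%:R * (L - (u n - u n ^+ 2 / 2)) =
        n%:R * L - n%:R * u n + (n%:R * u n) * u n / 2 by field.
      by rewrite nu; field.
    rewrite normrM (gtr0_norm n0).
    apply: (le_trans (ler_wpM2l (ltW n0) H)).
    have <- : n%:R * `|u n| = `|z| by rewrite -[X in X * _](gtr0_norm n0) -normrM nu normrN.
    by rewrite le_eqVlt; apply/orP; left; apply/eqP; ring.
  - rewrite -(mulr0 0); apply: cvgM; last by rewrite -(normr0 R); exact: cvg_norm.
    rewrite -(mulr0 (2 * `|z|)); apply: cvgMl_tmp; rewrite -(normr0 R); exact: cvg_norm.
  - rewrite -[X in _ --> X]addr0; apply: cvgD; first exact: cvg_cst.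
    rewrite -(mul0r 2^-1); apply: cvgMr_tmp; rewrite -(mulr0 z); exact: cvgMl_tmp.
have elim := cvg_comp _ _ lim (@continuous_expR R (- z)).
apply: (cvg_trans _ elim); apply: near_eq_cvg; near=> n => /=.
have un : `|u n| <= 1/2.
  by near: n; exact: un12.
rewrite mulrC expRM_natr lnK; last by rewrite posrE; move: un; rewrite ler_norml => /andP[? ?]; lra.
by rewrite /u mulNr.
Unshelve. all: by end_near. Qed.

(** The integrand 4^m x^m (1 - x)^m of a Beta integral on [0, 1], in the variable
    y = 2 sqrt m (x - 1/2). It is (1 - y^2 / m)^m for `|y| <= sqrt m and 0 elsewhere, so
    that it tends to exp(-y^2) and stays below it. *)
Definition wallis_fun (R : realType) (m : nat) (y : R) : R :=
  4 ^+ m * ((@XMonemX R m m) \_ `[0,1]) ((2 * Num.sqrt m%:R)^-1 * y + 1/2).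

Lemma wallis_inner (R : realType) (m : nat) (y : R) : (0 < m)%N ->
  `|y| <= Num.sqrt m%:R -> wallis_fun m y = (1 - y ^+ 2 / m%:R) ^+ m.
Proof.
move=> m0.
have s0 : 0 < Num.sqrt m%:R :> R by rewrite sqrtr_gt0 ltr0n.
have sq : Num.sqrt m%:R ^+ 2 = m%:R :> R by rewrite sqr_sqrtr.
rewrite /wallis_fun; set s := Num.sqrt _ in s0 sq *; rewrite ler_norml => /andP[y0 y1].
have E : s * ((2 * s)^-1 * y + 1/2) = (y + s)/2 by field; lra.
rewrite patchE ifT; last first.
  rewrite inE/= in_itv/= -(pmulr_rge0 _ s0) -[X in _ && X](ler_pM2l s0) E.
  by apply/andP; split; lra.
rewrite /XMonemX /unstable.onem -!exprMn -sq; congr (_ ^+ m).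
by field; lra.
Qed.

Lemma wallis_outer (R : realType) (m : nat) (y : R) : (0 < m)%N ->
  Num.sqrt m%:R < `|y| -> wallis_fun m y = 0.
Proof.
move=> m0 ys.
have s0 : 0 < Num.sqrt m%:R :> R by rewrite sqrtr_gt0 ltr0n.
rewrite /wallis_fun patchE ifF ?mulr0//.
apply/negP; rewrite inE/= in_itv/=; set s := Num.sqrt _ in s0 ys *.
have E : s * ((2 * s)^-1 * y + 1/2) = (y + s)/2 by field; lra.
move=> /andP[]; rewrite -(pmulr_rge0 _ s0) -[X in _ -> is_true X -> _](ler_pM2l s0) E => h1 h2.
by move: ys; rewrite ltNge => /negP; apply; rewrite ler_norml; apply/andP; split; lra.
Qed.

Lemma wallis_ge0 (R : realType) (m : nat) (y : R) : 0 <= wallis_fun m y.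
Proof.
rewrite /wallis_fun mulr_ge0 ?exprn_ge0//.
by rewrite patchE; case: ifPn => //; rewrite inE; exact: XMonemX_ge0.
Qed.

(** The inequality 1 + u <= exp u at u = - y^2 / m, raised to the power m. *)
Lemma wallis_le_gauss (R : realType) (m : nat) (y : R) : (0 < m)%N ->
  wallis_fun m y <= gauss_fun y.
Proof.
move=> m0; have [ys|ys] := leP `|y| (Num.sqrt m%:R); last first.
  by rewrite wallis_outer// gauss_fun_ge0.
have m0' : 0 < m%:R :> R by rewrite ltr0n.
rewrite wallis_inner// /gauss_fun.
have -> : - y ^+ 2 = (- (y ^+ 2 / m%:R)) * m%:R by rewrite mulNr divfK// gt_eqF.
rewrite expRM_natr lerXn2r ?nnegrE ?expR_ge0 ?expR_ge1Dx//.
rewrite subr_ge0 ler_pdivrMr// mul1r -(sqr_sqrtr (ltW m0')).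
by rewrite -(real_normK (num_real y)) lerXn2r ?nnegrE ?sqrtr_ge0.
Qed.

Lemma measurable_wallis (R : realType) (m : nat) : measurable_fun setT (@wallis_fun R m).
Proof.
have mX : measurable_fun setT ((@XMonemX R m m) \_ `[0,1]).
  by apply/measurable_restrict => //; rewrite setTI; exact: measurable_XMonemX.
rewrite /wallis_fun; apply: measurable_funM => //.
apply: measurableT_comp => //.
by apply: measurable_funD => //; apply: measurable_funM.
Qed.

(** After the affine change of variable this is the Beta integral
    B(m + 1, m + 1) = m!^2 / (2 m + 1)!. *)
Lemma integral_wallis (R : realType) (m : nat) : (0 < m)%N ->
  (\int[lebesgue_measure]_y (wallis_fun m y)%:E =
   (2 * Num.sqrt m%:R * 4 ^+ m * ((m`! * m`!)%:R / (m + m).+1`!%:R) : R)%:E)%E.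
Proof.
move=> m0; rewrite /wallis_fun; set c := (_ * _)^-1.
have s0 : 0 < Num.sqrt m%:R :> R by rewrite sqrtr_gt0 ltr0n.
have c0 : 0 < c by rewrite invr_gt0 mulr_gt0.
pose G (x : R) : \bar R := (4 ^+ m * ((@XMonemX R m m) \_ `[0,1]) x)%:E.
have mX : measurable_fun setT ((@XMonemX R m m) \_ `[0,1]).
  by apply/measurable_restrict => //; rewrite setTI; exact: measurable_XMonemX.
have X0 x : 0 <= ((@XMonemX R m m) \_ `[0,1]) x.
  by rewrite patchE; case: ifPn => //; rewrite inE; exact: XMonemX_ge0.
have := @ge0_integral_affine R c (1/2) G.
rewrite gt_eqF// => -> //.
- rewrite /G; under eq_integral do rewrite EFinM.
  rewrite ge0_integralZl//=; do ?[exact/measurable_EFinP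
    | by move=> x _; rewrite lee_fin | by rewrite lee_fin exprn_ge0].
  have := @EFin_beta_fun R m.+1 m.+1 => /= <-.
  rewrite beta_fun_fact -!EFinM; congr (_%:E).
  rewrite gtr0_norm// /c invrK; ring.
- by apply/measurable_EFinP; apply: measurable_funM.
- by move=> x; rewrite /G lee_fin mulr_ge0// exprn_ge0.
Qed.

(** Dominated convergence of wallis_fun to the Gaussian function, whose integral over the
    line is sqrt pi. *)
Lemma cvg_wallis (R : realType) :
  (2 * Num.sqrt m%:R * 4 ^+ m * ((m`! * m`!)%:R / (m + m).+1`!%:R) : R) @[m --> \oo] -->
  Num.sqrt (pi : R).
Proof.
rewrite -cvg_shiftS /=.
have L : (\int[@lebesgue_measure R]_y (wallis_fun m.+1 y)%:E)%E @[m --> \oo] --> (Num.sqrt pi)%:E.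
  rewrite -integralT_gauss; apply: (@dominated_cvg _ _ R (@lebesgue_measure R) setT measurableT
    (fun m y => (wallis_fun m.+1 y)%:E) _ (fun y => (gauss_fun y)%:E)) => //.
  - by move=> m; apply/measurable_EFinP; exact: measurable_wallis.
  - move=> y _; apply: cvg_EFin; first exact: nearW.
    rewrite [X in X @ _](_ : _ = fun m => wallis_fun m.+1 y)//.
    rewrite (@cvg_shiftS R (fun m => wallis_fun m y)).
    apply: cvg_trans (@cvg_one_minus_expn R (y ^+ 2)).
    apply: near_eq_cvg; near=> m; rewrite wallis_inner//.
      by near: m; exact: nbhs_infty_gt.
    rewrite -(sqrtr_sqr y) ler_sqrt; last exact: ler0n.
    by near: m; exact: nbhs_infty_ger.
  - exact: integrableT_gauss.
  - move=> m y _ /=; rewrite lee_fin ger0_norm ?wallis_ge0//.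
    exact: wallis_le_gauss.
move/fine_cvg : L; apply: cvg_trans; apply: near_eq_cvg; apply: nearW => m /=.
by rewrite integral_wallis.
Unshelve. all: by end_near. Qed.

(** * The constant in the formula of Stirling *)

(** The powers of m and the exponentials cancel between the factorials, so that only the
    correction factors remain: this isolates the constant of the formula of Stirling. *)
Lemma ln_wallis (R : realType) (m : nat) : (0 < m)%N ->
  ln (2 * Num.sqrt m%:R * 4 ^+ m * ((m`! * m`!)%:R / (m + m).+1`!%:R) : R) =
  ln_stirling R m + ln_stirling R m - ln_stirling R (m + m) - ln 2 / 2 - ln (1 + (m + m)%:R^-1).
Proof.
move=> m0.
have m0' : 0 < m%:R :> R by rewrite ltr0n.
have s0 : 0 < Num.sqrt m%:R :> R by rewrite sqrtr_gt0.
have f0 k : 0 < k`!%:R :> R by rewrite ltr0n fact_gt0.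
have lnsq := ln_sqrt m0'.
have ln4 : ln (4 ^+ m) = m%:R * (2 * ln 2) :> R.
  have -> : 4 = 2 ^+ 2 :> R by rewrite expr2 -natrM.
  by rewrite -exprM lnXn// -[LHS]mulr_natr natrM; ring.
have ln2m : ln (m + m)%:R = ln 2 + ln m%:R :> R.
  by rewrite addnn -mul2n natrM lnM ?posrE.
have lnS : ln (m + m).+1%:R = ln (m + m)%:R + ln (1 + (m + m)%:R^-1) :> R.
  have mm : 0 < (m + m)%:R :> R by rewrite ltr0n; lia.
  have h : 0 < 1 + (m + m)%:R^-1 :> R by rewrite addr_gt0// invr_gt0.
  rewrite -lnM ?posrE//.
  by congr ln; rewrite mulrDr mulr1 divff ?gt_eqF// natr1.
have h1 : 0 < 4 ^+ m :> R by rewrite exprn_gt0.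
have h2 : 0 < (m`! * m`!)%:R :> R by rewrite natrM mulr_gt0.
have h3 : 0 < 2 * Num.sqrt m%:R :> R by rewrite mulr_gt0.
rewrite lnM ?posrE ?divr_gt0 ?(mulr_gt0 h3)// (lnM h3 h1) lnM ?posrE//.
rewrite ln_div ?posrE// natrM lnM ?posrE// factS natrM lnM ?posrE// lnS lnsq ln4.
rewrite /ln_stirling ln2m natrD; move: (ln (1 + _)) => x.
by field.
Qed.

(** Along m and 2 m the correction tends to the same limit k, and the product of Wallis
    forces ln (sqrt pi) = k - ln 2 / 2. *)
Lemma stirling (R : realType) : ln_stirling R m @[m --> \oo] --> ln (2 * pi) / 2.
Proof.
have /cvg_ex[k kl] := @cvg_ln_stirling R.
suff -> : ln (2 * pi) / 2 = k by [].
have pi0 : 0 < pi :> R := pi_gt0 R.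
rewrite lnM ?posrE// mulrDl.
have lnsq := ln_sqrt pi0.
apply/esym/eqP; rewrite addrC -subr_eq; apply/eqP.
rewrite -lnsq.
have c1 : ln (2 * Num.sqrt m%:R * 4 ^+ m * ((m`! * m`!)%:R / (m + m).+1`!%:R) : R) @[m --> \oo]
    --> ln (Num.sqrt (pi : R)).
  apply: (cvg_comp _ _ (@cvg_wallis R)); apply: continuous_ln; by rewrite sqrtr_gt0.
have c2 : (ln_stirling R m + ln_stirling R m - ln_stirling R (m + m) - ln 2 / 2
    - ln (1 + (m + m)%:R^-1)) @[m --> \oo] --> k + k - k - ln 2 / 2 - ln (1 + 0).
  have mm : (m + m)%N @[m --> \oo] --> \oo.
    by move=> A [N _ NA]; exists N => // m /= Nm; apply: NA => /=; lia.
  apply: cvgB; last first.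
    apply: (@cvg_comp _ _ _ (fun m => 1 + (m + m)%:R^-1) (@ln R)).
      apply: cvgD; first exact: cvg_cst.
      exact: (cvg_comp _ _ mm (@cvg_invn R)).
    by apply: continuous_ln; rewrite addr0.
  apply: cvgB; last exact: cvg_cst.
  apply: cvgB; first exact: cvgD.
  exact: (cvg_comp _ _ mm kl).
have c3 : ln (2 * Num.sqrt m%:R * 4 ^+ m * ((m`! * m`!)%:R / (m + m).+1`!%:R) : R) @[m --> \oo]
    --> k + k - k - ln 2 / 2 - ln (1 + 0).
  apply: cvg_trans c2; apply: near_eq_cvg; near=> m; rewrite ln_wallis//.
  by near: m; exact: nbhs_infty_gt.
have := cvg_unique _ c1 c3; rewrite addr0 ln1 subr0 addrK => ->//.
Unshelve. all: by end_near. Qed.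

(** * Sequences of ratios and of standardised deviations *)

Lemma cvg_near_eq (R : realType) (f g : nat -> R) (l : R) :
  f r @[r --> \oo] --> l -> (\forall r \near \oo, f r = g r) ->
  g r @[r --> \oo] --> l.
Proof. by move=> fl fg; apply: cvg_trans fl; exact: near_eq_cvg. Qed.

(** The usual limit rules for sequences, in a form in which they nest as terms. *)
Section real_sequences.
Variables (R : realType) (u v : nat -> R) (a b : R).
Hypotheses (ua : u r @[r --> \oo] --> a) (vb : v r @[r --> \oo] --> b).

Lemma cvgsD : (u r + v r) @[r --> \oo] --> a + b.
Proof. exact: cvgD. Qed.

Lemma cvgsB : (u r - v r) @[r --> \oo] --> a - b.
Proof. exact: cvgB. Qed.

Lemma cvgsM : (u r * v r) @[r --> \oo] --> a * b.
Proof. exact: cvgM. Qed.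

Lemma cvgsMl (c : R) : (c * u r) @[r --> \oo] --> c * a.
Proof. exact: cvgMl_tmp. Qed.

Lemma cvgsMr (c : R) : (u r * c) @[r --> \oo] --> a * c.
Proof. exact: cvgMr_tmp. Qed.

Lemma cvgsV : a != 0 -> (u r)^-1 @[r --> \oo] --> a^-1.
Proof. by move=> a0; exact: cvgV. Qed.

End real_sequences.

Lemma cvgs_cst (R : realType) (c : R) : (fun=> c) r @[r --> \oo] --> c.
Proof. exact: cvg_cst. Qed.

Lemma cvg_invn_comp (R : realType) (n : nat -> nat) : n r @[r --> \oo] --> \oo ->
  ((n r)%:R^-1 : R) @[r --> \oo] --> 0.
Proof. by move=> nn; exact: (cvg_comp _ _ nn (@cvg_invn R)). Qed.

Lemma cvg_invsqrt (R : realType) (n : nat -> nat) : n r @[r --> \oo] --> \oo ->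
  ((Num.sqrt (n r)%:R)^-1 : R) @[r --> \oo] --> 0.
Proof.
move=> nn; rewrite [X in X @ _](_ : _ = fun r => Num.sqrt ((n r)%:R^-1)); last first.
  by apply/funext => r; rewrite sqrtrV ?ler0n.
have := cvg_comp _ _ (@cvg_invn_comp R n nn) (@sqrt_continuous R 0).
by rewrite sqrtr0.
Qed.

Lemma near_natr_gt0 (R : realType) (n : nat -> nat) : n r @[r --> \oo] --> \oo ->
  \forall r \near \oo, 0 < (n r)%:R :> R.
Proof.
move=> nn; near=> r; rewrite ltr0n; near: r.
exact: (nn [set m | (0 < m)%N] (nbhs_infty_gt 0)).
Unshelve. all: by end_near. Qed.

Lemma cvgr_near_gt0 (R : realType) (u : nat -> R) (c : R) : 0 < c ->
  u r @[r --> \oo] --> c -> \forall r \near \oo, 0 < u r.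
Proof. by move=> c0 uc; exact: (cvgr_gt c uc). Qed.

(** For u = (k - e) / e tending to 0, k ln (k / e) - (k - e) is equivalent to e u^2 / 2,
    that is to (k - e)^2 / (2 e), where e grows like c n and k - e like z sqrt n. *)
Lemma cvg_kl_term (R : realType) (k e : nat -> R) (n : nat -> nat) (c z : R) :
  n r @[r --> \oo] --> \oo -> 0 < c ->
  (e r / (n r)%:R) @[r --> \oo] --> c ->
  ((k r - e r) / Num.sqrt (n r)%:R) @[r --> \oo] --> z ->
  (k r * ln (k r / e r) - (k r - e r)) @[r --> \oo] --> z ^+ 2 / (2 * c).
Proof.
move=> nn c0 ec kz.
pose w r := (k r - e r) / Num.sqrt (n r)%:R.
pose g r := e r / (n r)%:R.
pose u r := w r / g r * (Num.sqrt (n r)%:R)^-1.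
have gi : (g r)^-1 @[r --> \oo] --> c^-1 by apply: cvgV => //; rewrite gt_eqF.
have u0 : u r @[r --> \oo] --> 0.
  rewrite -(mulr0 (z * c^-1)); apply: cvgM; last exact: cvg_invsqrt.
  exact: cvgM.
have un12 : \forall r \near \oo, `|u r| <= 1/2.
  by apply: (cvgr0_norm_le _ u0); lra.
have n0 := @near_natr_gt0 R n nn.
have g0 := cvgr_near_gt0 c0 ec.
apply: (@cvg_of_dist_le R (fun r => k r * ln (k r / e r) - (k r - e r))
  (fun r => w r ^+ 2 * (2 * g r)^-1) (fun r => 4 * (w r ^+ 2 * (g r)^-1) * `|u r|)
  (z ^+ 2 / (2 * c))).
- near=> r.
  have n1 : 0 < (n r)%:R :> R by near: r.
  have g1 : 0 < g r by near: r.
  have u1 : `|u r| <= 1/2 by near: r.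
  have s0 : 0 < Num.sqrt (n r)%:R :> R by rewrite sqrtr_gt0.
  have sq : Num.sqrt (n r)%:R ^+ 2 = (n r)%:R :> R by rewrite sqr_sqrtr// ltW.
  have e0 : 0 < e r by rewrite -(divfK (lt0r_neq0 n1) (e r)) mulr_gt0.
  have E : u r = (k r - e r) / e r.
    rewrite /u /w /g; set t := Num.sqrt _ in s0 sq *; rewrite -sq.
    by field; rewrite !gt_eqF.
  have E2 : w r ^+ 2 / g r = e r * u r ^+ 2.
    rewrite E /w /g; set t := Num.sqrt _ in s0 sq *; rewrite -sq.
    by field; rewrite !gt_eqF.
  have k1 : k r = e r * (1 + u r) by rewrite E; field; rewrite gt_eqF.
  have -> : w r ^+ 2 * (2 * g r)^-1 = e r * u r ^+ 2 / 2.
    by rewrite -E2; field; rewrite gt_eqF.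
  rewrite E2.
  have -> : k r / e r = 1 + u r by rewrite k1 mulrAC divff ?mul1r ?gt_eqF.
  have -> : k r - e r = e r * u r by rewrite E; field; rewrite gt_eqF.
  rewrite k1; have := ln1D_quad u1; move: (ln _) => L.
  set v := u r in u1 *; move=> H.
  have -> : e r * (1 + v) * L - e r * v - e r * v ^+ 2 / 2 =
    e r * ((1 + v) * (L - (v - v ^+ 2 / 2)) - v ^+ 3 / 2) by field.
  have -> : 4 * (e r * v ^+ 2) * `|v| = e r * (4 * (v ^+ 2 * `|v|)) by ring.
  rewrite normrM (gtr0_norm e0) ler_pM2l//.
  apply: (le_trans (ler_normB _ _)); rewrite (normrM (1 + v)) (normrM (v ^+ 3)) normrX.
  apply: (@le_trans _ _ (3/2 * (2 * `|v| ^+ 3) + `|v| ^+ 3 / 2)).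
    apply: lerD; last by rewrite (@ger0_norm _ 2^-1).
    apply: ler_pM => //; apply: (le_trans (ler_normD _ _)); rewrite normr1; lra.
  have -> : v ^+ 2 * `|v| = `|v| ^+ 3 by rewrite -(real_normK (num_real v)); ring.
  have : 0 <= `|v| ^+ 3 by rewrite exprn_ge0.
  lra.
- rewrite -(mulr0 (4 * (z ^+ 2 * c^-1))); apply: cvgM; last by rewrite -(normr0 R); exact: cvg_norm.
  apply: cvgMl_tmp; apply: cvgM => //; rewrite expr2.
  rewrite [X in X @ _](_ : _ = fun r => w r * w r); first exact: cvgM.
  by apply/funext => r; rewrite expr2.
- apply: cvgM.
    rewrite expr2 [X in X @ _](_ : _ = fun r => w r * w r); first exact: cvgM.
    by apply/funext => r; rewrite expr2.
  apply: cvgV; first by rewrite mulf_neq0// gt_eqF.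
  exact: cvgMl_tmp.
Unshelve. all: by end_near. Qed.

Lemma cvg_nat_ratio (R : realType) (k n : nat -> nat) (c : R) :
  n r @[r --> \oo] --> \oo -> 0 < c ->
  ((k r)%:R / (n r)%:R) @[r --> \oo] --> c -> k r @[r --> \oo] --> \oo.
Proof.
move=> nn c0 kc; apply/cvgnyPge => A.
have c2 : \forall r \near \oo, c / 2 < (k r)%:R / (n r)%:R.
  by apply: (cvgr_gt c kc); rewrite ltr_pdivrMr//; lra.
have n0 := @near_natr_gt0 R n nn.
have nA : \forall r \near \oo, A%:R / (c / 2) <= (n r)%:R.
  have := @nbhs_infty_ger R (A%:R / (c / 2)); exact: nn.
near=> r; rewrite -(ler_nat R).
have n1 : 0 < (n r)%:R :> R by near: r.
have c3 : c / 2 < (k r)%:R / (n r)%:R by near: r.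
have nA1 : A%:R / (c / 2) <= (n r)%:R by near: r.
move: c3; rewrite ltr_pdivlMr// => c3.
move: nA1; rewrite ler_pdivrMr ?divr_gt0// => nA1.
by rewrite (le_trans nA1)// mulrC ltW.
Unshelve. all: by end_near. Qed.

(** A deviation of order sqrt n is negligible with respect to n. *)
Lemma cvg_cell_ratio (R : realType) (n k a b : nat -> nat) (al be y : R) :
  n r @[r --> \oo] --> \oo ->
  ((a r)%:R / (n r)%:R) @[r --> \oo] --> al -> ((b r)%:R / (n r)%:R) @[r --> \oo] --> be ->
  ((k r)%:R - (a r)%:R * (b r)%:R / (n r)%:R) / Num.sqrt (n r)%:R @[r --> \oo] --> y ->
  (k r)%:R / (n r)%:R @[r --> \oo] --> al * be.
Proof.
move=> nn ca cb H; have n0 := @near_natr_gt0 R n nn.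
have := cvgsD (cvgsM H (@cvg_invsqrt R n nn)) (cvgsM ca cb).
rewrite mulr0 add0r => H1; apply: (cvg_near_eq H1); near=> r.
have n1 : 0 < (n r)%:R :> R by near: r.
have s0 : 0 < Num.sqrt (n r)%:R :> R by rewrite sqrtr_gt0.
have sq : Num.sqrt (n r)%:R ^+ 2 = (n r)%:R :> R by rewrite sqr_sqrtr// ltW.
set t := Num.sqrt _ in s0 sq *; rewrite -sq.
by field; rewrite gt_eqF.
Unshelve. all: by end_near. Qed.

Lemma cvg_compl_ratio (R : realType) (n a1 a2 : nat -> nat) (al1 al2 : R) :
  al1 + al2 = 1 -> n r @[r --> \oo] --> \oo ->
  (\forall r \near \oo, n r = (a1 r + a2 r)%N) ->
  ((a1 r)%:R / (n r)%:R) @[r --> \oo] --> al1 -> ((a2 r)%:R / (n r)%:R) @[r --> \oo] --> al2.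
Proof.
move=> alE nn nE ca1; have n0 := @near_natr_gt0 R n nn.
have -> : al2 = 1 - al1 by rewrite -alE addrC addKr.
apply: (cvg_near_eq (cvgsB (@cvgs_cst R 1) ca1)); near=> r => /=.
have n1 : 0 < (n r)%:R :> R by near: r.
have nr : n r = (a1 r + a2 r)%N by near: r.
apply: (mulIf (lt0r_neq0 n1)); rewrite mulrBl mul1r !divfK ?gt_eqF//.
by rewrite nr natrD addrC addKr.
Unshelve. all: by end_near. Qed.

(** * Local limit theorem for the hypergeometric law *)

Lemma ln_factE (R : realType) (m : nat) :
  ln (m`!)%:R = ln_stirling R m + (m%:R * ln m%:R - m%:R + ln m%:R / 2).
Proof. by rewrite /ln_stirling subrK. Qed.

(** The contribution of a cell with entry k and margins a and b to the relative entropy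
    of the table with respect to the product of its margins. The linear corrections add up
    to zero over a table; each one makes the contribution of its cell quadratic in the
    deviation. *)
Definition kl_term (R : realType) (k a b n : nat) : R :=
  k%:R * ln (k%:R / (a%:R * b%:R / n%:R)) - (k%:R - a%:R * b%:R / n%:R).

(** The formula of Stirling for all nine factorials: the square roots give the
    halved logarithms, the powers the relative entropy, and the exponentials cancel. *)
Lemma ln_hypergeometric (R : realType) (k11 k12 k21 k22 : nat) :
  (0 < k11)%N -> (0 < k12)%N -> (0 < k21)%N -> (0 < k22)%N ->
  let a1 := (k11 + k12)%N in let a2 := (k21 + k22)%N in
  let b1 := (k11 + k21)%N in let b2 := (k12 + k22)%N in
  let n := (a1 + a2)%N in
  ln (Num.sqrt n%:R * ((a1`! * a2`! * (b1`! * b2`!))%:R /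
     (n`! * (k11`! * k12`! * (k21`! * k22`!)))%:R)) =
  (ln_stirling R a1 + ln_stirling R a2 + ln_stirling R b1 + ln_stirling R b2
     - ln_stirling R n
     - ln_stirling R k11 - ln_stirling R k12 - ln_stirling R k21 - ln_stirling R k22)
  + (ln (a1%:R / n%:R) + ln (a2%:R / n%:R) + ln (b1%:R / n%:R) + ln (b2%:R / n%:R)
     - ln (k11%:R / n%:R) - ln (k12%:R / n%:R) - ln (k21%:R / n%:R) - ln (k22%:R / n%:R)) / 2
  - (kl_term R k11 a1 b1 n + kl_term R k12 a1 b2 n + kl_term R k21 a2 b1 n + kl_term R k22 a2 b2 n).
Proof.
move=> h11 h12 h21 h22 a1 a2 b1 b2 n.
have lt0 (m : nat) : (0 < m)%N -> 0 < m%:R :> R by rewrite ltr0n.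
have Hk11 := lt0 _ h11; have Hk12 := lt0 _ h12; have Hk21 := lt0 _ h21; have Hk22 := lt0 _ h22.
have Ha1 : 0 < a1%:R :> R by apply: lt0; rewrite /a1; lia.
have Ha2 : 0 < a2%:R :> R by apply: lt0; rewrite /a2; lia.
have Hb1 : 0 < b1%:R :> R by apply: lt0; rewrite /b1; lia.
have Hb2 : 0 < b2%:R :> R by apply: lt0; rewrite /b2; lia.
have Hn : 0 < n%:R :> R by apply: lt0; rewrite /n; lia.
have f0 (m : nat) : 0 < m`!%:R :> R by rewrite ltr0n fact_gt0.
have lnsq := ln_sqrt Hn.
have lnd (x y : R) : 0 < x -> 0 < y -> ln (x / y) = ln x - ln y.
  by move=> x0 y0; rewrite ln_div ?posrE.
have lnm (x y : R) : 0 < x -> 0 < y -> ln (x * y) = ln x + ln y.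
  by move=> x0 y0; rewrite lnM ?posrE.
have Hs : 0 < Num.sqrt n%:R :> R by rewrite sqrtr_gt0.
rewrite /kl_term.
rewrite !lnd ?divr_gt0 ?mulr_gt0//.
rewrite !natrM lnm ?divr_gt0 ?mulr_gt0// lnsq lnd ?mulr_gt0// !lnm ?mulr_gt0//.
rewrite !ln_factE.
have En : n%:R = k11%:R + k12%:R + k21%:R + k22%:R :> R by rewrite /n /a1 /a2 !natrD addrA.
have Ea1 : a1%:R = k11%:R + k12%:R :> R by rewrite /a1 natrD.
have Ea2 : a2%:R = k21%:R + k22%:R :> R by rewrite /a2 natrD.
have Eb1 : b1%:R = k11%:R + k21%:R :> R by rewrite /b1 natrD.
have Eb2 : b2%:R = k12%:R + k22%:R :> R by rewrite /b2 natrD.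
move: Hn Ha1 Ha2 Hb1 Hb2 Hk11 Hk12 Hk21 Hk22.
move: (ln_stirling R a1) (ln_stirling R a2) (ln_stirling R b1) (ln_stirling R b2)
  (ln_stirling R n) => l1 l2 l3 l4 l5.
move: (ln_stirling R k11) (ln_stirling R k12) (ln_stirling R k21) (ln_stirling R k22)
  => l6 l7 l8 l9.
move: (ln a1%:R) (ln a2%:R) (ln b1%:R) (ln b2%:R) (ln n%:R) => m1 m2 m3 m4 m5.
move: (ln k11%:R) (ln k12%:R) (ln k21%:R) (ln k22%:R) => m6 m7 m8 m9.
rewrite En Ea1 Ea2 Eb1 Eb2.
move: (k11%:R) (k12%:R) (k21%:R) (k22%:R) => p q s t Hn *.
by field; rewrite gt_eqF.
Qed.

(** In ln_hypergeometric the nine corrections leave - ln (2 pi) / 2, the proportions leave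
    - ln (al1 al2 be1 be2) / 2, and the entropies of the four cells tend to
    y^2 / (2 al_i be_j), with sum y^2 / (2 al1 al2 be1 be2). The limit is the logarithm of
    the normal density. *)
Lemma hypergeometric_llt (R : realType) (k11 k12 k21 k22 : nat -> nat)
    (al1 al2 be1 be2 y : R) :
  let a1 r := (k11 r + k12 r)%N in let a2 r := (k21 r + k22 r)%N in
  let b1 r := (k11 r + k21 r)%N in let b2 r := (k12 r + k22 r)%N in
  let n r := (a1 r + a2 r)%N in
  0 < al1 -> 0 < al2 -> 0 < be1 -> 0 < be2 -> al1 + al2 = 1 -> be1 + be2 = 1 ->
  n r @[r --> \oo] --> \oo ->
  ((a1 r)%:R / (n r)%:R) @[r --> \oo] --> al1 ->
  ((b1 r)%:R / (n r)%:R) @[r --> \oo] --> be1 ->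
  (((k11 r)%:R - (a1 r)%:R * (b1 r)%:R / (n r)%:R) / Num.sqrt (n r)%:R) @[r --> \oo] --> y ->
  Num.sqrt (n r)%:R * (((a1 r)`! * (a2 r)`! * ((b1 r)`! * (b2 r)`!))%:R /
     ((n r)`! * ((k11 r)`! * (k12 r)`! * ((k21 r)`! * (k22 r)`!)))%:R) @[r --> \oo] -->
  normal_pdf 0 (Num.sqrt (al1 * al2 * (be1 * be2))) y.
Proof.
move=> a1 a2 b1 b2 n al10 al20 be10 be20 alE beE nn ca1 cb1 cy.
have n0 := @near_natr_gt0 R n nn.
have nR r : (n r)%:R = (a1 r)%:R + (a2 r)%:R :> R by rewrite /n natrD.
have nR' r : (n r)%:R = (b1 r)%:R + (b2 r)%:R :> R by rewrite -natrD /n /a1 /a2 /b1 /b2 addnACA.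
have ca2 : ((a2 r)%:R / (n r)%:R) @[r --> \oo] --> al2.
  by apply: (cvg_compl_ratio alE nn _ ca1); apply: nearW.
have cb2 : ((b2 r)%:R / (n r)%:R) @[r --> \oo] --> be2.
  apply: (cvg_compl_ratio beE nn _ cb1); apply: nearW => r.
  by rewrite /n /a1 /a2 /b1 /b2 addnACA.
have cell (k a b : nat -> nat) (al be z : R) : 0 < al -> 0 < be ->
    ((a r)%:R / (n r)%:R) @[r --> \oo] --> al ->
    ((b r)%:R / (n r)%:R) @[r --> \oo] --> be ->
    (((k r)%:R - (a r)%:R * (b r)%:R / (n r)%:R) / Num.sqrt (n r)%:R) @[r --> \oo] --> z ->
    [/\ ((k r)%:R / (n r)%:R) @[r --> \oo] --> al * be,
        k r @[r --> \oo] --> \oo &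
        kl_term R (k r) (a r) (b r) (n r) @[r --> \oo] --> z ^+ 2 / (2 * (al * be))].
  move=> al0 be0 ca cb cz.
  have ce : ((a r)%:R * (b r)%:R / (n r)%:R / (n r)%:R) @[r --> \oo] --> al * be.
    apply: (cvg_near_eq (cvgsM ca cb)); near=> r => /=; have n1 : 0 < (n r)%:R :> R by near: r.
    by field; rewrite gt_eqF.
  have ck := cvg_cell_ratio nn ca cb cz.
  split => //.
    apply: (@cvg_nat_ratio R k n (al * be)) => //; exact: mulr_gt0.
  exact: (@cvg_kl_term R (fun r => (k r)%:R) (fun r => (a r)%:R * (b r)%:R / (n r)%:R)
    n (al * be) z nn (mulr_gt0 al0 be0) ce cz).
(* The margins leave one degree of freedom: the deviations of the four cells from
   their means agree up to sign. *)
have other (k a b : nat -> nat) (eps : R) :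
    (\forall r \near \oo, (k r)%:R - (a r)%:R * (b r)%:R / (n r)%:R =
       eps * ((k11 r)%:R - (a1 r)%:R * (b1 r)%:R / (n r)%:R)) ->
    (((k r)%:R - (a r)%:R * (b r)%:R / (n r)%:R) / Num.sqrt (n r)%:R) @[r --> \oo] --> eps * y.
  move=> H; have H' := cvgsMl (c := eps) cy; apply: (cvg_near_eq H').
  by apply: filterS H => r ->; rewrite mulrA.
have [r11 o11 l11] := cell k11 a1 b1 al1 be1 y al10 be10 ca1 cb1 cy.
have [r12 o12 l12] : [/\ ((k12 r)%:R / (n r)%:R) @[r --> \oo] --> al1 * be2,
        k12 r @[r --> \oo] --> \oo &
        kl_term R (k12 r) (a1 r) (b2 r) (n r) @[r --> \oo] --> (- 1 * y) ^+ 2 / (2 * (al1 * be2))].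
  apply: cell => //; apply: other => //; near=> r; have n1 : 0 < (n r)%:R :> R by near: r.
  have -> : (k12 r)%:R = (a1 r)%:R - (k11 r)%:R :> R by rewrite /a1 natrD addrAC subrr add0r.
  have -> : (b2 r)%:R = (n r)%:R - (b1 r)%:R :> R by rewrite nR' addrAC subrr add0r.
  by field; rewrite gt_eqF.
have [r21 o21 l21] : [/\ ((k21 r)%:R / (n r)%:R) @[r --> \oo] --> al2 * be1,
        k21 r @[r --> \oo] --> \oo &
        kl_term R (k21 r) (a2 r) (b1 r) (n r) @[r --> \oo] --> (- 1 * y) ^+ 2 / (2 * (al2 * be1))].
  apply: cell => //; apply: other => //; near=> r; have n1 : 0 < (n r)%:R :> R by near: r.
  have -> : (k21 r)%:R = (b1 r)%:R - (k11 r)%:R :> R by rewrite /b1 natrD addrAC subrr add0r.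
  have -> : (a2 r)%:R = (n r)%:R - (a1 r)%:R :> R by rewrite nR addrAC subrr add0r.
  by field; rewrite gt_eqF.
have [r22 o22 l22] : [/\ ((k22 r)%:R / (n r)%:R) @[r --> \oo] --> al2 * be2,
        k22 r @[r --> \oo] --> \oo &
        kl_term R (k22 r) (a2 r) (b2 r) (n r) @[r --> \oo] --> (1 * y) ^+ 2 / (2 * (al2 * be2))].
  apply: cell => //; apply: other => //; near=> r; have n1 : 0 < (n r)%:R :> R by near: r.
  have -> : (k22 r)%:R = (n r)%:R - (a1 r)%:R - (b1 r)%:R + (k11 r)%:R :> R.
    rewrite nR /a1 /a2 /b1 !natrD; ring.
  have -> : (b2 r)%:R = (n r)%:R - (b1 r)%:R :> R by rewrite nR' addrAC subrr add0r.
  have -> : (a2 r)%:R = (n r)%:R - (a1 r)%:R :> R by rewrite nR addrAC subrr add0r.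
  by field; rewrite gt_eqF.
have oa1 : a1 r @[r --> \oo] --> \oo by apply: (cvg_nat_ratio nn al10 ca1).
have oa2 : a2 r @[r --> \oo] --> \oo by apply: (cvg_nat_ratio nn al20 ca2).
have ob1 : b1 r @[r --> \oo] --> \oo by apply: (cvg_nat_ratio nn be10 cb1).
have ob2 : b2 r @[r --> \oo] --> \oo by apply: (cvg_nat_ratio nn be20 cb2).
have st (m : nat -> nat) : m r @[r --> \oo] --> \oo -> ln_stirling R (m r) @[r --> \oo] --> ln (2 * pi) / 2.
  by move=> mo; exact: (cvg_comp _ _ mo (@stirling R)).
have lg (m : nat -> nat) (c : R) : 0 < c -> ((m r)%:R / (n r)%:R) @[r --> \oo] --> c ->
    ln ((m r)%:R / (n r)%:R) @[r --> \oo] --> ln c.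
  by move=> c0 mc; apply: (cvg_comp _ _ mc); exact: continuous_ln.
pose S : R := ln (2 * pi) / 2.
have lim : ln (Num.sqrt (n r)%:R * (((a1 r)`! * (a2 r)`! * ((b1 r)`! * (b2 r)`!))%:R /
     ((n r)`! * ((k11 r)`! * (k12 r)`! * ((k21 r)`! * (k22 r)`!)))%:R)) @[r --> \oo] -->
  (S + S + S + S - S - S - S - S - S)
  + (ln al1 + ln al2 + ln be1 + ln be2 - ln (al1 * be1) - ln (al1 * be2)
     - ln (al2 * be1) - ln (al2 * be2)) / 2
  - (y ^+ 2 / (2 * (al1 * be1)) + (- 1 * y) ^+ 2 / (2 * (al1 * be2))
     + (- 1 * y) ^+ 2 / (2 * (al2 * be1)) + (1 * y) ^+ 2 / (2 * (al2 * be2))).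
  have := cvgsB (cvgsD
    (cvgsB (cvgsB (cvgsB (cvgsB (cvgsB (cvgsD (cvgsD (cvgsD (st _ oa1) (st _ oa2)) (st _ ob1)) (st _ ob2))
      (st _ nn)) (st _ o11)) (st _ o12)) (st _ o21)) (st _ o22))
    (cvgsMr (c := 2^-1) (cvgsB (cvgsB (cvgsB (cvgsB (cvgsD (cvgsD (cvgsD
       (lg _ _ al10 ca1) (lg _ _ al20 ca2)) (lg _ _ be10 cb1)) (lg _ _ be20 cb2))
       (lg _ _ (mulr_gt0 al10 be10) r11)) (lg _ _ (mulr_gt0 al10 be20) r12))
       (lg _ _ (mulr_gt0 al20 be10) r21)) (lg _ _ (mulr_gt0 al20 be20) r22))))
    (cvgsD (cvgsD (cvgsD l11 l12) l21) l22).
  move=> H; apply: (cvg_near_eq H).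
  have pos (m : nat -> nat) : m r @[r --> \oo] --> \oo -> \forall r \near \oo, (0 < m r)%N.
    by move=> mo; exact: (mo [set m | (0 < m)%N] (nbhs_infty_gt 0)).
  have p11 := pos _ o11; have p12 := pos _ o12; have p21 := pos _ o21; have p22 := pos _ o22.
  near=> r; have k110 : (0 < k11 r)%N by near: r.
  have k120 : (0 < k12 r)%N by near: r.
  have k210 : (0 < k21 r)%N by near: r.
  have k220 : (0 < k22 r)%N by near: r.
  by have -> := ln_hypergeometric R k110 k120 k210 k220.
have := cvg_comp _ _ lim (@continuous_expR R _).
set V := al1 * al2 * (be1 * be2).
have V0 : 0 < V by rewrite !mulr_gt0.
rewrite (_ : expR _ = normal_pdf 0 (Num.sqrt V) y).
  move=> H; apply: (cvg_near_eq H); near=> r => /=.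
  have n1 : 0 < (n r)%:R :> R by near: r.
  by rewrite lnK// posrE mulr_gt0 ?sqrtr_gt0// divr_gt0// ltr0n !muln_gt0 !fact_gt0.
have pi0 : 0 < pi :> R := pi_gt0 R.
rewrite normal_pdfE ?gt_eqF ?sqrtr_gt0// /normal_peak /normal_fun sqr_sqrtr ?ltW//.
have -> : (Num.sqrt (V * pi *+ 2))^-1 = expR (- ln (V * pi *+ 2) / 2).
  have W0 : 0 < V * pi *+ 2 by rewrite pmulrn_lgt0// mulr_gt0.
  rewrite mulNr expRN; congr (_^-1).
  by rewrite -ln_sqrt// lnK// posrE sqrtr_gt0.
rewrite -expRD; congr expR.
have -> : y ^+ 2 / (2 * (al1 * be1)) + (- 1 * y) ^+ 2 / (2 * (al1 * be2))
     + (- 1 * y) ^+ 2 / (2 * (al2 * be1)) + (1 * y) ^+ 2 / (2 * (al2 * be2)) = y ^+ 2 / (2 * V).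
  (* The inverses of the four products al_i * be_j add up to 1 / V. *)
  transitivity (y ^+ 2 * ((al1 + al2) * (be1 + be2)) / (2 * V)).
    by rewrite /V; field; rewrite !gt_eqF.
  by rewrite alE beE !mulr1.
rewrite -[V * pi *+ 2]mulr_natl -[V *+ 2]mulr_natl /S (lnM (x := 2)) ?posrE ?mulr_gt0//.
rewrite !lnM ?posrE ?mulr_gt0//.
rewrite subr0 !mulNr; move: (y ^+ 2 / _) => q.
by field.
Unshelve. all: by end_near. Qed.

(** * Passing to the limit under the integral *)

Section convergence_of_integrals.
Context d (T : measurableType d) (R : realType) (mu : {measure set T -> \bar R}).

Lemma integrable_of_le (f g : T -> R) : measurable_fun setT f ->
  (forall x, 0 <= f x <= g x) -> mu.-integrable setT (EFin \o g) ->
  mu.-integrable setT (EFin \o f).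
Proof.
move=> mf fg; apply: le_integrable => //; first exact/measurable_EFinP.
move=> x _ /=; have /andP[f0 fg'] := fg x.
by rewrite lee_fin !ger0_norm// (le_trans f0).
Qed.

Lemma dominated_cvgR (u : nat -> T -> R) (f g : T -> R) :
  (forall n, measurable_fun setT (u n)) ->
  (forall x, u n x @[n --> \oo] --> f x) ->
  mu.-integrable setT (EFin \o g) -> (forall n x, `|u n x| <= g x) ->
  (\int[mu]_x u n x) @[n --> \oo] --> \int[mu]_x f x.
Proof.
move=> mu_ uf ig ug; rewrite /Rintegral.
have mf : measurable_fun setT f.
  by apply: (@measurable_fun_cvg _ _ _ _ u) => // x _; exact: uf.
apply: fine_cvg.
have intf : mu.-integrable setT (EFin \o f).
  apply: (le_integrable measurableT _ _ ig); first exact/measurable_EFinP.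
  move=> x _ /=; rewrite lee_fin.
  have g0 : 0 <= g x by apply: le_trans (ug 0%N x).
  rewrite (ger0_norm g0).
  have : `|u n x| @[n --> \oo] --> `|f x| by apply: cvg_norm; exact: uf.
  move/cvg_lim => <- //; apply: limr_le.
    by apply/cvg_ex; exists `|f x|; apply: cvg_norm; exact: uf.
  by apply: nearW => n; exact: ug.
rewrite fineK; last by apply: integrable_fin_num.
apply: (@dominated_cvg _ _ R mu setT measurableT (fun n x => (u n x)%:E) _ (fun x => (g x)%:E)) => //.
- by move=> n; exact/measurable_EFinP.
- by move=> x _; apply: cvg_EFin; [exact: nearW|exact: uf].
- by move=> n x _ /=; rewrite lee_fin.
Qed.

(** The lemma of Pratt. Dominated convergence applies to min(u_n, f), dominated by f, and
    to min(g_n - u_n, h - f), dominated by h - f; they bound the integral of u_n from below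
    and, since the integral of g_n converges to that of h, from above. *)
Lemma pratt_cvg (u g : nat -> T -> R) (f h : T -> R) :
  (forall n, measurable_fun setT (u n)) -> (forall n, measurable_fun setT (g n)) ->
  (forall n x, 0 <= u n x <= g n x) ->
  (forall x, u n x @[n --> \oo] --> f x) ->
  (forall x, g n x @[n --> \oo] --> h x) ->
  (forall n, mu.-integrable setT (EFin \o g n)) ->
  mu.-integrable setT (EFin \o h) ->
  (\int[mu]_x g n x) @[n --> \oo] --> \int[mu]_x h x ->
  (\int[mu]_x u n x) @[n --> \oo] --> \int[mu]_x f x.
Proof.
move=> mun mg ug uf gh ig ih gint.
have mf : measurable_fun setT f.
  by apply: (@measurable_fun_cvg _ _ _ _ u) => // x _; exact: uf.
have mh : measurable_fun setT h by apply: (@measurable_fun_cvg _ _ _ _ g) => // x _; exact: gh.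
have f0 x : 0 <= f x.
  have H := uf x; rewrite -(cvg_lim _ H)//; apply: limr_ge; first by apply/cvg_ex; exists (f x).
  by apply: nearW => n; have /andP[] := ug n x.
have fh x : f x <= h x.
  apply: (ler_cvg_to (uf x) (gh x)).
  by apply: nearW => n; have /andP[] := ug n x.
have iu n : mu.-integrable setT (EFin \o u n) by apply: (integrable_of_le _ _ (ig n)).
have if_ : mu.-integrable setT (EFin \o f).
  by apply: (integrable_of_le _ _ ih) => // x; rewrite f0 fh.
(* Truncated at its limit w, the sequence v is dominated by w itself. *)
have part (v : nat -> T -> R) (w : T -> R) : (forall n, measurable_fun setT (v n)) ->
    measurable_fun setT w -> (forall n x, 0 <= v n x) -> (forall x, 0 <= w x) ->
    (forall x, v n x @[n --> \oo] --> w x) -> mu.-integrable setT (EFin \o w) ->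
    (\int[mu]_x (Num.min (v n x) (w x))) @[n --> \oo] --> \int[mu]_x w x.
  move=> mv mw v0 w0 vw iw; apply: (@dominated_cvgR _ _ w) => //.
  - by move=> n; apply: measurable_minr.
  - move=> x; apply: (@cvg_of_dist_le R _ (fun=> w x) (fun n => `|v n x - w x|)).
    + by apply: nearW => n; case: (leP (v n x) (w x)) => _ //; rewrite subrr normr0.
    + rewrite -(normr0 R) -[X in `|X|](subrr (w x)); apply: cvg_norm.
      by apply: cvgsB; [exact: vw|exact: cvg_cst].
    + exact: cvg_cst.
  - move=> n x; rewrite ger0_norm ?ge_min ?lexx ?orbT//.
    by rewrite le_min v0 w0.
have pu := part u f mun mf (fun n x => proj1 (andP (ug n x))) f0 uf if_.
have pv := part (fun n x => g n x - u n x) (fun x => h x - f x).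
have imin (v w : T -> R) : measurable_fun setT v -> measurable_fun setT w ->
    (forall x, 0 <= v x) -> (forall x, 0 <= w x) -> mu.-integrable setT (EFin \o v) ->
    mu.-integrable setT (EFin \o (fun x => Num.min (v x) (w x))).
  move=> mv mw v0 w0; apply: integrable_of_le; first exact: measurable_minr.
  by move=> x; rewrite le_min v0 w0 ge_min lexx.
have ivn n : mu.-integrable setT (EFin \o (fun x => g n x - u n x)).
  by have := @integrableB _ _ R mu setT measurableT _ _ (ig n) (iu n).
have lo n : \int[mu]_x (Num.min (u n x) (f x)) <= \int[mu]_x u n x.
  apply: le_Rintegral => //; last by move=> x _; rewrite ge_min lexx.
  by apply: imin => // x; have /andP[] := ug n x.
have v0 n x : 0 <= g n x - u n x by rewrite subr_ge0; have /andP[] := ug n x.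
have w0 x : 0 <= h x - f x by rewrite subr_ge0.
have hi n : \int[mu]_x u n x <=
    \int[mu]_x g n x - \int[mu]_x (Num.min (g n x - u n x) (h x - f x)).
  rewrite lerBrDr -lerBrDl -RintegralB//.
  apply: le_Rintegral => //; last by move=> x _; rewrite ge_min lexx.
  by apply: imin => //; apply: measurable_funB.
apply: (@squeeze_cvgr _ _ _ _ (fun n => \int[mu]_x (Num.min (u n x) (f x)))
   (fun n => \int[mu]_x g n x - \int[mu]_x (Num.min (g n x - u n x) (h x - f x)))).
- by apply: nearW => n; rewrite lo hi.
- exact: pu.
- have -> : \int[mu]_x f x = \int[mu]_x h x - \int[mu]_x (h x - f x).
    by rewrite RintegralB// opprB addrC subrK.
  apply: cvgsB => //; apply: pv => //.
  + by move=> n; apply: measurable_funB.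
  + exact: measurable_funB.
  + by move=> x; apply: cvgsB.
  + by have := @integrableB _ _ R mu setT measurableT _ _ ih if_.
Qed.

End convergence_of_integrals.

(** * From local limits to limits of expectations on a lattice *)

Section lattice.
Variable R : realType.
Implicit Types (s c y : R) (p : nat -> R).

Definition cell s c (k : nat) : set R := `[(k%:R - c) / s, (k.+1%:R - c) / s[%classic.

(** The step density that spreads the mass p k uniformly over the cell of k, an interval
    of length 1 / s that starts at the standardised position of k. *)
Definition lattice_step s c (N : nat) p y : R :=
  \sum_(k < N.+1) s * p k * \1_(cell s c k) y.

Lemma measurable_lattice_step s c N p : measurable_fun setT (lattice_step s c N p).
Proof.
apply: measurable_sum => k; apply: measurable_funM => //.
by apply: measurable_indic; exact: measurable_itv.
Qed.

Lemma lattice_step_ge0 s c N p y : 0 < s -> (forall k, 0 <= p k) -> 0 <= lattice_step s c N p y.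
Proof.
by move=> s0 p0; apply: sumr_ge0 => k _; rewrite mulr_ge0 ?indicE// mulr_ge0// ltW.
Qed.

Lemma integral_lattice_step s c N p : 0 < s -> (forall k, 0 <= p k) ->
  (\int[lebesgue_measure]_y (lattice_step s c N p y)%:E = (\sum_(k < N.+1) p k)%:E)%E.
Proof.
move=> s0 p0; rewrite /lattice_step.
under eq_integral do rewrite -sumEFin.
rewrite ge0_integral_sum//; last 2 first.
- move=> k; apply/measurable_EFinP; apply: measurable_funM => //.
  by apply: measurable_indic; exact: measurable_itv.
- by move=> k y _; rewrite lee_fin mulr_ge0 ?indicE// mulr_ge0// ltW.
rewrite -sumEFin; apply: eq_bigr => k _.
under eq_integral do rewrite EFinM.
have mi : measurable_fun setT (fun y => (\1_(cell s c k) y)%:E : \bar R).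
  by apply/measurable_EFinP; apply: measurable_indic; exact: measurable_itv.
have sp : (0 <= (s * p k)%:E)%E by rewrite lee_fin mulr_ge0// ltW.
rewrite ge0_integralZl//=.
rewrite integral_indic; [rewrite setIT /cell|by []|exact: measurable_itv].
rewrite /= lebesgue_measure_itv/= lte_fin.
rewrite ltr_pM2r ?invr_gt0// ltrD2r ltr_nat ltnS leqnn -EFinD -EFinM; congr (_%:E).
by rewrite -natr1; field; rewrite gt_eqF.
Qed.

Lemma integrable_lattice_step s c N p : 0 < s -> (forall k, 0 <= p k) ->
  lebesgue_measure.-integrable setT (EFin \o lattice_step s c N p).
Proof.
move=> s0 p0; apply/integrableP; split.
  by apply/measurable_EFinP; exact: measurable_lattice_step.
under eq_integral do rewrite /= ger0_norm ?lattice_step_ge0//.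
by rewrite integral_lattice_step// ltry.
Qed.

Lemma Rintegral_lattice_step s c N p : 0 < s -> (forall k, 0 <= p k) ->
  \int[lebesgue_measure]_y lattice_step s c N p y = \sum_(k < N.+1) p k.
Proof. by move=> s0 p0; rewrite /Rintegral integral_lattice_step. Qed.

Lemma mem_cell s c y k : 0 < s -> 0 <= s * y + c ->
  (y \in cell s c k) = (k == Num.truncn (s * y + c)).
Proof.
move=> s0 yc; rewrite eq_sym truncn_eq//.
have -> : (y \in cell s c k) = ((k%:R - c) / s <= y < (k.+1%:R - c) / s).
  apply/idP/idP => [/set_mem|h]; first by rewrite /cell/= in_itv.
  by apply/mem_set; rewrite /cell/= in_itv.
by rewrite ler_pdivrMr// ltr_pdivlMr// lerBlDr ltrBrDr (mulrC y).
Qed.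

Lemma lattice_stepE s c N p y : 0 < s -> 0 <= s * y + c ->
  (Num.truncn (s * y + c) <= N)%N ->
  lattice_step s c N p y = s * p (Num.truncn (s * y + c)).
Proof.
move=> s0 yc kN; rewrite /lattice_step.
have kN' : (Num.truncn (s * y + c) < N.+1)%N by [].
rewrite (bigD1 (Ordinal kN'))//= indicE mem_cell// eqxx mulr1 big1 ?addr0// => i ik.
rewrite indicE mem_cell// (_ : (_ == _) = false) ?mulr0//.
by apply/negbTE; apply: contra ik => /eqP E; apply/eqP/val_inj.
Qed.

(** The argument of Scheffe. The step densities of the laws p r converge pointwise to phi
    and have mass 1 in the limit, hence so do, by the lemma of Pratt, the integrals of the
    smaller densities of p r k * G r k. The hypotheses on p and G are needed along
    sequences only, because the densities at a point y are evaluated at one lattice point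
    for each r. *)
Lemma lattice_local_limit (s c : nat -> R) (N : nat -> nat) (p G : nat -> nat -> R)
    (phi f : R -> R) :
  (forall r, 0 < s r) -> (s r)^-1 @[r --> \oo] --> 0 ->
  (forall r k, 0 <= p r k) -> (forall r k, 0 <= p r k * G r k <= p r k) ->
  (\forall r \near \oo, \sum_(k < (N r).+1) p r k = 1) ->
  (forall y, \forall r \near \oo, 0 <= s r * y + c r) ->
  lebesgue_measure.-integrable setT (EFin \o phi) ->
  \int[lebesgue_measure]_y phi y = 1 ->
  (forall (k : nat -> nat) y, ((k r)%:R - c r) / s r @[r --> \oo] --> y ->
    (\forall r \near \oo, (k r <= N r)%N) /\
    s r * p r (k r) @[r --> \oo] --> phi y) ->
  (forall (k : nat -> nat) y, ((k r)%:R - c r) / s r @[r --> \oo] --> y ->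
    G r (k r) @[r --> \oo] --> f y) ->
  \sum_(k < (N r).+1) p r k * G r k @[r --> \oo] --> \int[lebesgue_measure]_y (phi y * f y).
Proof.
move=> s0 si p0 pG0 p1 nonneg iphi phi1 llt Gf.
(* The lattice point whose cell contains y; its standardised position is within
   1 / s r of y. *)
pose k y r := Num.truncn (s r * y + c r).
have kc y : ((k y r)%:R - c r) / s r @[r --> \oo] --> y.
  apply: (@cvg_of_dist_le R _ (fun=> y) (fun r => (s r)^-1)) => //; last exact: cvg_cst.
  near=> r; have yc : 0 <= s r * y + c r by near: r; exact: nonneg.
  have /andP[] := truncn_itv yc; rewrite -/(k y r) -natr1.
  set K := (k y r)%:R => h1 h2.
  have -> : (K - c r) / s r - y = (K - (s r * y + c r)) / s r.
    by field; rewrite gt_eqF.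
  rewrite normrM (gtr0_norm (_ : 0 < (s r)^-1)) ?invr_gt0//.
  apply: ler_piMl; first by rewrite invr_ge0 ltW.
  by rewrite ler_norml; apply/andP; split; lra.
have stepE (q : nat -> nat -> R) y : \forall r \near \oo,
    s r * q r (k y r) = lattice_step (s r) (c r) (N r) (q r) y.
  have [kN _] := llt _ _ (kc y); near=> r.
  rewrite lattice_stepE//; first by near: r; exact: nonneg.
  by near: r.
have eint (q : nat -> nat -> R) r : (forall k, 0 <= q r k) ->
    \int[lebesgue_measure]_y lattice_step (s r) (c r) (N r) (q r) y = \sum_(k < (N r).+1) q r k.
  by move=> q0; rewrite Rintegral_lattice_step.
pose pG r j := p r j * G r j.
have pG00 r j : 0 <= pG r j by rewrite /pG; have /andP[] := pG0 r j.
rewrite [X in X @ _](_ : _ = fun r =>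
    \int[lebesgue_measure]_y lattice_step (s r) (c r) (N r) (pG r) y); last first.
  by apply/funext => r; rewrite eint.
apply: (@pratt_cvg _ _ R lebesgue_measure _ (fun r => lattice_step (s r) (c r) (N r) (p r)) _ phi).
- by move=> r; exact: measurable_lattice_step.
- by move=> r; exact: measurable_lattice_step.
- move=> r y; rewrite lattice_step_ge0//=; apply: ler_sum => j _.
  apply: ler_wpM2r; first by rewrite indicE.
  by apply: ler_wpM2l; [exact: ltW|have /andP[] := pG0 r j].
- move=> y; have [_ sp] := llt _ _ (kc y).
  apply: (cvg_near_eq (cvgsM sp (Gf _ _ (kc y)))).
  by apply: filterS (stepE pG y) => r <-; rewrite /pG mulrA.
- move=> y; have [_ sp] := llt _ _ (kc y).
  exact: (cvg_near_eq sp (stepE p y)).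
- by move=> r; exact: integrable_lattice_step.
- exact: iphi.
- rewrite phi1; apply: (cvg_near_eq (@cvgs_cst R 1)).
  by apply: filterS p1 => r /= <-; rewrite eint.
Unshelve. all: by end_near. Qed.

End lattice.

(** * Central limit theorem for the hypergeometric law *)

(** The entries x, a1 - x, b1 - x and a2 - (b1 - x) are genuine differences, not truncated
    ones: x is the corner of a table with row sums a1, a2 and first column sum b1. *)
Definition hyp_valid (a1 a2 b1 x : nat) := [&& (x <= a1)%N, (x <= b1)%N & (b1 - x <= a2)%N].

Definition hyp_pmf (R : realType) (a1 a2 b1 b2 x : nat) : R :=
  if hyp_valid a1 a2 b1 x then
    (a1`! * a2`! * (b1`! * b2`!))%:R /
    ((a1 + a2)`! * (x`! * (a1 - x)`! * ((b1 - x)`! * (a2 - (b1 - x))`!)))%:R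
  else 0.

Lemma hyp_pmf_ge0 (R : realType) a1 a2 b1 b2 x : 0 <= hyp_pmf R a1 a2 b1 b2 x.
Proof. by rewrite /hyp_pmf; case: ifP => // _; rewrite divr_ge0. Qed.

(** In this form the total mass 1 is the convolution identity of Vandermonde. *)
Lemma hyp_pmf_bin (R : realType) a1 a2 b1 b2 x : (a1 + a2 = b1 + b2)%N -> (x <= b1)%N ->
  hyp_pmf R a1 a2 b1 b2 x = ('C(a1, x) * 'C(a2, b1 - x))%:R / 'C(a1 + a2, b1)%:R.
Proof.
move=> ab xb; rewrite /hyp_pmf /hyp_valid xb /=.
have [xa|xa] := leqP x a1; last by rewrite bin_small// mul0n mul0r.
have [xa2|xa2] := leqP (b1 - x)%N a2; last by rewrite (bin_small xa2)// muln0 mul0r.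
have f0 m : m`!%:R != 0 :> R by rewrite pnatr_eq0 -lt0n fact_gt0.
have E (n m : nat) : (m <= n)%N -> 'C(n, m)%:R = n`!%:R / (m`!%:R * (n - m)`!%:R) :> R.
  by move=> mn; rewrite -(bin_fact mn) !natrM mulfK// mulf_neq0.
have b2E : b2 = (a1 + a2 - b1)%N by rewrite ab addKn.
have bn : (b1 <= a1 + a2)%N by rewrite ab leq_addr.
rewrite !natrM !E// -b2E.
by field; rewrite !f0.
Qed.

Lemma sum_hyp_pmf (R : realType) a1 a2 b1 b2 N : (a1 + a2 = b1 + b2)%N -> (a1 + a2 <= N)%N ->
  \sum_(x < N.+1) hyp_pmf R a1 a2 b1 b2 x = 1.
Proof.
move=> ab aN.
have bN : (b1.+1 <= N.+1)%N by rewrite ltnS (leq_trans _ aN)// ab leq_addr.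
transitivity (\sum_(x < b1.+1) hyp_pmf R a1 a2 b1 b2 x).
  rewrite [RHS](big_ord_widen_cond N.+1 xpredT (hyp_pmf R a1 a2 b1 b2))//=.
  rewrite [LHS](bigID (fun x : 'I__ => (x < b1.+1)%N))/=.
  rewrite [X in _ + X]big1 ?addr0// => x; rewrite ltnS => xb.
  by rewrite /hyp_pmf /hyp_valid (negbTE xb) andbF.
under eq_bigr => x _ do rewrite hyp_pmf_bin ?leq_ord//.
rewrite -mulr_suml -natr_sum binomial.Vandermonde divff// pnatr_eq0 -lt0n bin_gt0.
by rewrite ab leq_addr.
Qed.

(** The local limit theorem fed into lattice_local_limit. Points with convergent
    standardised position are eventually valid, because the mean stays away from the
    bounds of the support by a multiple of n. *)
Lemma hypergeometric_clt (R : realType) (a1 a2 b1 b2 N : nat -> nat)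
    (al1 al2 be1 be2 : R) (G : nat -> nat -> R) (f : R -> R) :
  let n r := (a1 r + a2 r)%N in
  let std k r : R := (k%:R - (a1 r)%:R * (b1 r)%:R / (n r)%:R) / Num.sqrt (n r)%:R in
  (\forall r \near \oo, (a1 r + a2 r = b1 r + b2 r)%N) ->
  (\forall r \near \oo, (n r <= N r)%N) ->
  0 < al1 -> 0 < al2 -> 0 < be1 -> 0 < be2 -> al1 + al2 = 1 -> be1 + be2 = 1 ->
  n r @[r --> \oo] --> \oo ->
  ((a1 r)%:R / (n r)%:R) @[r --> \oo] --> al1 ->
  ((b1 r)%:R / (n r)%:R) @[r --> \oo] --> be1 ->
  (forall r x, hyp_valid (a1 r) (a2 r) (b1 r) x -> 0 <= G r x <= 1) ->
  (forall (k : nat -> nat) y,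
     (\forall r \near \oo, hyp_valid (a1 r) (a2 r) (b1 r) (k r)) ->
     std (k r) r @[r --> \oo] --> y -> G r (k r) @[r --> \oo] --> f y) ->
  \sum_(x < (N r).+1) hyp_pmf R (a1 r) (a2 r) (b1 r) (b2 r) x * G r x @[r --> \oo] -->
  \int[lebesgue_measure]_y (normal_pdf 0 (Num.sqrt (al1 * al2 * (be1 * be2))) y * f y).
Proof.
move=> n std ab nN al10 al20 be10 be20 alE beE nn ca1 cb1 G01 Gf.
have n0 := @near_natr_gt0 R n nn.
have ca2 : ((a2 r)%:R / (n r)%:R) @[r --> \oo] --> al2.
  by apply: (cvg_compl_ratio alE nn _ ca1); apply: nearW.
(* The scale has to be positive for every r, also where n r = 0. *)
pose s r : R := if n r == 0%N then 1 else Num.sqrt (n r)%:R.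
pose c r : R := (a1 r)%:R * (b1 r)%:R / (n r)%:R.
have sE : \forall r \near \oo, s r = Num.sqrt (n r)%:R.
  by apply: filterS n0 => r; rewrite ltr0n lt0n /s => /negbTE ->.
have stdE (k : nat -> nat) (y : R) : ((k r)%:R - c r) / s r @[r --> \oo] --> y ->
    std (k r) r @[r --> \oo] --> y.
  by move=> H; apply: (cvg_near_eq H); apply: filterS sE => r ->.
have kn (k : nat -> nat) (y : R) : std (k r) r @[r --> \oo] --> y ->
    (k r)%:R / (n r)%:R @[r --> \oo] --> al1 * be1.
  exact: cvg_cell_ratio.
(* The limit al1 * be1 of k / n lies strictly between the limits of the bounds that
   nonnegativity of the four entries puts on k / n. *)
have valid (k : nat -> nat) (y : R) : std (k r) r @[r --> \oo] --> y ->
    \forall r \near \oo, hyp_valid (a1 r) (a2 r) (b1 r) (k r).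
  move=> H; have kl := kn _ _ H.
  have lt_near (u v : nat -> R) (p q : R) : p < q -> u r @[r --> \oo] --> p -> v r @[r --> \oo] --> q ->
      \forall r \near \oo, u r < v r.
    move=> pq up vq; have d0 : 0 < q - p by rewrite subr_gt0.
    have H0 := cvgr_near_gt0 d0 (cvgsB vq up).
    by apply: filterS H0 => r; rewrite subr_gt0.
  have h1 := lt_near _ _ _ _ (_ : al1 * be1 < al1) kl ca1.
  have h2 := lt_near _ _ _ _ (_ : al1 * be1 < be1) kl cb1.
  have h3 := lt_near _ _ _ _ (_ : be1 - al1 * be1 < al2) (cvgsB cb1 kl) ca2.
  have {}h1 := h1 ltac:(rewrite gtr_pMr//; lra).
  have {}h2 := h2 ltac:(rewrite gtr_pMl//; lra).
  have {}h3 := h3 ltac:(nra).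
  near=> r; have n1 : 0 < (n r)%:R :> R by near: r.
  have e1 : (k r)%:R / (n r)%:R < (a1 r)%:R / (n r)%:R :> R by near: r; exact: h1.
  have e2 : (k r)%:R / (n r)%:R < (b1 r)%:R / (n r)%:R :> R by near: r; exact: h2.
  have e3 : (b1 r)%:R / (n r)%:R - (k r)%:R / (n r)%:R < (a2 r)%:R / (n r)%:R :> R by near: r; exact: h3.
  move: e1 e2 e3; rewrite -mulrBl !ltr_pM2r ?invr_gt0// !ltr_nat ltrBlDr -natrD ltr_nat => e1 e2 e3.
  by rewrite /hyp_valid; lia.
apply: (@lattice_local_limit R s c N (fun r => hyp_pmf R (a1 r) (a2 r) (b1 r) (b2 r))).
- move=> r; rewrite /s; case: ifPn => [_|nz]; first exact: ltr01.
  by rewrite sqrtr_gt0 ltr0n lt0n.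
- apply: (cvg_near_eq (@cvg_invsqrt R n nn)).
  by apply: filterS sE => r ->.
- by move=> r k; exact: hyp_pmf_ge0.
- move=> r k; have p0 := hyp_pmf_ge0 R (a1 r) (a2 r) (b1 r) (b2 r) k.
  have [v|v] := boolP (hyp_valid (a1 r) (a2 r) (b1 r) k); last first.
    by rewrite /hyp_pmf (negbTE v) mul0r lexx.
  by have /andP[g0 g1] := G01 _ _ v; rewrite mulr_ge0//= ler_piMr.
- by apply: filterS2 ab nN => r; exact: sum_hyp_pmf.
- move=> y.
  have H : y * (Num.sqrt (n r)%:R)^-1 + (a1 r)%:R / (n r)%:R * ((b1 r)%:R / (n r)%:R)
      @[r --> \oo] --> y * 0 + al1 * be1.
    apply: cvgsD; last exact: cvgsM.
    by apply: cvgsMl; exact: cvg_invsqrt.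
  have g0 : 0 < y * 0 + al1 * be1 by rewrite mulr0 add0r mulr_gt0.
  have g1 := cvgr_near_gt0 g0 H; near=> r.
  have n1 : 0 < (n r)%:R :> R by near: r.
  have s0 : 0 < Num.sqrt (n r)%:R :> R by rewrite sqrtr_gt0.
  have sq : Num.sqrt (n r)%:R ^+ 2 = (n r)%:R :> R by rewrite sqr_sqrtr// ltW.
  have -> : s r = Num.sqrt (n r)%:R by near: r.
  have : 0 < y * (Num.sqrt (n r)%:R)^-1 + (a1 r)%:R / (n r)%:R * ((b1 r)%:R / (n r)%:R) by near: r.
  rewrite -(pmulr_rgt0 _ n1) => /ltW; rewrite /c.
  set t := Num.sqrt _ in s0 sq *; rewrite -sq; congr (0 <= _).
  by field; rewrite gt_eqF.
- exact: integrable_normal_pdf.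
- by rewrite /Rintegral integral_normal_pdf.
- move=> k y H; have H' := stdE _ _ H; have V := valid _ _ H'.
  split.
    apply: filterS2 V nN => r /and3P[h _ _]; apply: leq_trans; exact: leq_trans h (leq_addr _ _).
  have V4 : \forall r \near \oo, [/\ (k r + (a1 r - k r) = a1 r)%N,
      ((b1 r - k r) + (a2 r - (b1 r - k r)) = a2 r)%N, (k r + (b1 r - k r) = b1 r)%N &
      ((a1 r - k r) + (a2 r - (b1 r - k r)) = b2 r)%N].
    apply: filterS2 V ab => r; rewrite /hyp_valid => /and3P[? ? ?] ?; split; lia.
  have := @hypergeometric_llt R k (fun r => a1 r - k r)%N (fun r => b1 r - k r)%N
    (fun r => a2 r - (b1 r - k r))%N al1 al2 be1 be2 y al10 al20 be10 be20 alE beE.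
  move=> /(_ _ _ _ _) L.
  have L1 : (k r + (a1 r - k r) + ((b1 r - k r) + (a2 r - (b1 r - k r))))%N @[r --> \oo] --> \oo.
    apply: cvg_trans nn; apply: near_eq_cvg; apply: filterS V4 => r [e1 e2 _ _].
    by rewrite e1 e2.
  have {L} := L L1.
  have L2 : (k r + (a1 r - k r))%:R / (k r + (a1 r - k r) + ((b1 r - k r) + (a2 r - (b1 r - k r))))%:R
      @[r --> \oo] --> al1.
    by apply: (cvg_near_eq ca1); apply: filterS V4 => r [e1 e2 _ _]; rewrite e1 e2.
  have L3 : (k r + (b1 r - k r))%:R / (k r + (a1 r - k r) + ((b1 r - k r) + (a2 r - (b1 r - k r))))%:R
      @[r --> \oo] --> be1.
    by apply: (cvg_near_eq cb1); apply: filterS V4 => r [e1 e2 e3 _]; rewrite e1 e2 e3.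
  move=> /(_ L2 L3) L.
  have {}L := L ltac:(apply: (cvg_near_eq H'); apply: filterS V4 => r [e1 e2 e3 _];
    rewrite /std /n e1 e2 e3//).
  apply: (cvg_near_eq L); near=> r.
  have -> : s r = Num.sqrt (n r)%:R by near: r.
  have v : hyp_valid (a1 r) (a2 r) (b1 r) (k r) by near: r.
  have [e1 e2 e3 e4] : [/\ (k r + (a1 r - k r) = a1 r)%N,
      ((b1 r - k r) + (a2 r - (b1 r - k r)) = a2 r)%N, (k r + (b1 r - k r) = b1 r)%N &
      ((a1 r - k r) + (a2 r - (b1 r - k r)) = b2 r)%N] by near: r.
  by rewrite e1 e2 e3 e4 /hyp_pmf v.
- by move=> k y H; have H' := stdE _ _ H; apply: Gf => //; apply: valid H'.
Unshelve. all: by end_near. Qed.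

(** * Scaling and convolution of centred normal laws *)

Section normal_laws.
Variable R : realType.
Implicit Types (s c : R) (B : set R).
Notation leb := (@lebesgue_measure R).

Lemma normal_probE m s B : measurable B ->
  normal_prob m s B = (\int[leb]_x (normal_pdf m s x * \1_B x)%:E)%E.
Proof.
move=> mB; rewrite /normal_prob integral_mkcond epatch_indic.
by apply: eq_integral => x _; rewrite EFinM.
Qed.

(** The normal density is a version of the Radon-Nikodym derivative. *)
Lemma integral_normal_prob m s (f : R -> R) : measurable_fun setT f ->
  (exists M, forall x, `|f x| <= M) ->
  (\int[normal_prob m s]_x (f x)%:E = \int[leb]_x (normal_pdf m s x * f x)%:E)%E.
Proof.
move=> mf [M fM].
have dom := normal_prob_dominates m s.
have ifn : (normal_prob m s).-integrable setT (EFin \o f).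
  apply: (@le_integrable _ _ R (normal_prob m s) setT measurableT _ (cst M%:E)).
  - exact/measurable_EFinP.
  - by move=> x _ /=; rewrite lee_fin (le_trans (fM x))// ler_norm.
  - exact: finite_measure_integrable_cst.
rewrite -(Radon_Nikodym_change_of_variables dom measurableT ifn)/=.
apply: ae_eq_integral => //.
- apply: emeasurable_funM; first exact/measurable_EFinP.
  apply: (measurable_int leb); apply: Radon_Nikodym_integrable; exact: dom.
- apply/measurable_EFinP; apply: measurable_funM => //; exact: measurable_normal_pdf.
- rewrite [X in ae_eq _ _ _ X](_ : _ = fun x => ((f x)%:E * (normal_pdf m s x)%:E)%E); last first.
    by apply/funext => x; rewrite mulrC EFinM.
  apply: ae_eqe_mul2l.
  rewrite Radon_NikodymE/=.
  case: cid => /= h [h1 h2 h3].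
  apply: integral_ae_eq => //.
  + by apply/measurable_EFinP; exact: measurable_normal_pdf.
  + by move=> E _ mE; rewrite -h3.
Qed.

Lemma normal_pdf_affine s c x : s != 0 -> c != 0 ->
  normal_pdf 0 s x = `|c| * normal_pdf 0 (c * s) (c * x).
Proof.
move=> s0 c0; rewrite !normal_pdfE ?mulf_neq0//.
rewrite /normal_peak /normal_fun !subr0 mulrA; congr (_ * expR _); last first.
  by rewrite -(mulr_natl (s ^+ 2)) -(mulr_natl ((c * s) ^+ 2)); field; rewrite c0 s0.
have -> : (c * s) ^+ 2 * pi *+ 2 = c ^+ 2 * (s ^+ 2 * pi *+ 2) by rewrite mulrnAr mulrA exprMn.
rewrite sqrtrM ?sqr_ge0// sqrtr_sqr invfM mulrA divff ?mul1r//.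
by rewrite normr_eq0.
Qed.

(** The case c = 0 produces the point mass at 0; this is why the conclusion is about
    normal1, which includes it. *)
Lemma normal_prob_scale s c B : s != 0 -> measurable B ->
  normal_prob 0 s [set x | B (c * x)] = normal1 0 (c * s) B.
Proof.
move=> s0 mB; rewrite /normal1 mulf_eq0 (negbTE s0) orbF; case: ifPn => [/eqP ->|c0].
  have [B0|nB0] := pselect (B 0).
    rewrite (_ : [set _ | _] = setT); first by rewrite probability_setT diracE mem_set.
    by apply/seteqP; split => x//= _; rewrite mul0r.
  rewrite (_ : [set _ | _] = set0); first by rewrite measure0 diracE memNset.
  by apply/seteqP; split => x//=; rewrite mul0r.
have mF : measurable_fun setT (fun x : R => c * x) by apply: measurable_funM.
have mB' : measurable [set x | B (c * x)] by rewrite -[X in measurable X]setTI; exact: mF.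
rewrite !normal_probE//.
pose G (z : R) := (`|c| * (normal_pdf 0 (c * s) z * \1_B z))%:E.
have G0 z : (0 <= G z)%E by rewrite lee_fin !mulr_ge0// normal_pdf_ge0.
have mG : measurable_fun setT G.
  apply/measurable_EFinP; apply: measurable_funM => //; apply: measurable_funM.
    exact: measurable_normal_pdf.
  exact: measurable_indic.
have := ge0_integral_affine 0 c0 mG G0.
rewrite /G; under [X in _ = (_ * X)%E]eq_integral do rewrite EFinM.
rewrite ge0_integralZl//=; last 2 first.
- apply/measurable_EFinP; apply: measurable_funM.
    exact: measurable_normal_pdf.
  exact: measurable_indic.
- by move=> x _; rewrite lee_fin mulr_ge0// normal_pdf_ge0.
rewrite muleA -EFinM mulVf ?normr_eq0// mul1e => <-.
by apply: eq_integral => x _; rewrite addr0 (normal_pdf_affine _ s0 c0) mulrA.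
Qed.

(** Completing the square in x. *)
Lemma normal_pdf_conv s1 s2 s x z : s1 != 0 -> s2 != 0 -> s ^+ 2 = s1 ^+ 2 + s2 ^+ 2 ->
  normal_pdf 0 s1 x * normal_pdf 0 s2 (z - x) =
  normal_pdf 0 s z * normal_pdf (s1 ^+ 2 / s ^+ 2 * z) (s1 * s2 / s) x.
Proof.
move=> s10 s20 sE.
have p1 : 0 < s1 ^+ 2 by rewrite exprn_even_gt0.
have p2 : 0 < s2 ^+ 2 by rewrite exprn_even_gt0.
have sp : 0 < s ^+ 2 by rewrite sE addr_gt0.
have s0 : s != 0 by apply: contraTneq sp => ->; rewrite expr0n ltxx.
have t0 : s1 * s2 / s != 0 by rewrite !mulf_neq0 ?invr_eq0.
rewrite !normal_pdfE// /normal_peak /normal_fun !subr0.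
rewrite mulrACA -expRD [RHS]mulrACA -expRD; congr (_ * expR _); last first.
  rewrite -(mulr_natl (s1 ^+ 2)) -(mulr_natl (s2 ^+ 2)) -(mulr_natl (s ^+ 2)).
  rewrite -(mulr_natl ((s1 * s2 / s) ^+ 2)) !exprMn exprVn sE; field.
  by rewrite s10 s20 -sE expf_neq0.
have W (u : R) : 0 <= u ^+ 2 * pi *+ 2.
  by apply: mulrn_wge0; apply: mulr_ge0; [exact: sqr_ge0|exact: pi_ge0].
rewrite -!invfM -!sqrtrM ?W//.
congr (Num.sqrt _)^-1; rewrite -(mulr_natl (s1 ^+ 2 * pi)) -(mulr_natl (s2 ^+ 2 * pi)).
rewrite -(mulr_natl (s ^+ 2 * pi)) -(mulr_natl ((s1 * s2 / s) ^+ 2 * pi)) !exprMn exprVn; field.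
by rewrite s0.
Qed.

Lemma measurable_add_preim (B : set R) x : measurable B -> measurable [set y : R | B (x + y)].
Proof.
move=> mB; have mF : measurable_fun setT (fun y : R => x + y) by apply: measurable_funD.
by rewrite -[X in measurable X]setTI; exact: mF.
Qed.

(** The inner probability is an integral over z = x + y; exchanging the two integrals
    leaves, by normal_pdf_conv, a normal density in x of integral 1. *)
Lemma normal_prob_conv s1 s2 s B : s1 != 0 -> s2 != 0 -> s ^+ 2 = s1 ^+ 2 + s2 ^+ 2 ->
  measurable B ->
  (\int[normal_prob 0 s1]_x normal_prob 0 s2 [set y | B (x + y)%R] = normal_prob 0 s B)%E.
Proof.
move=> s10 s20 sE mB.
have mx x := measurable_add_preim x mB.
pose F (w : R * R) := normal_pdf 0 s1 w.1 * (normal_pdf 0 s2 (w.2 - w.1) * \1_B w.2).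
have mpdf a b : measurable_fun setT (@normal_pdf R a b) by exact: measurable_normal_pdf.
have mF : measurable_fun setT F.
  apply: measurable_funM; first by apply: measurableT_comp => //; exact: measurable_fst.
  apply: measurable_funM.
    apply: measurableT_comp => //; apply: measurable_funB.
      exact: measurable_snd.
    exact: measurable_fst.
  by apply: measurableT_comp.
have F0 w : 0 <= F w by rewrite !mulr_ge0 ?normal_pdf_ge0.
have inner x : normal_prob 0 s2 [set y | B (x + y)] =
    (\int[leb]_z (normal_pdf 0 s2 (z - x) * \1_B z)%:E)%E.
  rewrite normal_probE//.
  pose G (z : R) := (normal_pdf 0 s2 (z - x) * \1_B z)%:E.
  have mG : measurable_fun setT G.
    apply/measurable_EFinP; apply: measurable_funM; last exact: measurable_indic.
    by apply: measurableT_comp => //; apply: measurable_funB.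
  have G0 z : (0 <= G z)%E by rewrite lee_fin mulr_ge0// normal_pdf_ge0.
  have := ge0_integral_affine x (oner_neq0 R) mG G0.
  rewrite normr1 invr1 mul1e => <-; apply: eq_integral => y _.
  by rewrite /G mul1r addrK addrC.
pose H (x : R) : R := fine (normal_prob 0 s2 [set y | B (x + y)]).
have HE x : (H x)%:E = (\int[leb]_z (normal_pdf 0 s2 (z - x) * \1_B z)%:E)%E.
  by rewrite -inner /H fineK ?fin_num_measure//; exact: mx.
have H01 x : 0 <= H x <= 1.
  by rewrite -!lee_fin HE -inner measure_ge0/= probability_le1//; exact: mx.
have mH : measurable_fun setT H.
  apply/measurable_EFinP.
  rewrite (_ : EFin \o H = fubini_F leb (fun w : R * R => (normal_pdf 0 s2 (w.2 - w.1) * \1_B w.2)%:E)).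
    apply: measurable_fun_fubini_tonelli_F.
      apply/measurable_EFinP; apply: measurable_funM.
        apply: measurableT_comp => //; apply: measurable_funB.
          exact: measurable_snd.
        exact: measurable_fst.
      by apply: measurableT_comp.
    by move=> w; rewrite lee_fin mulr_ge0// normal_pdf_ge0.
  by apply/funext => x /=; rewrite HE.
transitivity (\int[normal_prob 0 s1]_x (H x)%:E)%E.
  by apply: eq_integral => x _; rewrite HE inner.
rewrite integral_normal_prob//; last first.
  by exists 1 => x; have /andP[? ?] := H01 x; rewrite ger0_norm.
transitivity (\int[leb]_x \int[leb]_z (F (x, z))%:E)%E.
  apply: eq_integral => x _; rewrite EFinM HE -ge0_integralZl//=.
  - apply/measurable_EFinP; apply: measurable_funM; last exact: measurable_indic.
    by apply: measurableT_comp => //; apply: measurable_funB.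
  - by move=> z _; rewrite lee_fin mulr_ge0// normal_pdf_ge0.
  - by rewrite lee_fin normal_pdf_ge0.
rewrite (@fubini_tonelli _ _ _ _ R leb leb (EFin \o F))/=; last 2 first.
- exact/measurable_EFinP.
- by move=> w; rewrite lee_fin.
rewrite normal_probE//; apply: eq_integral => z _.
under eq_integral => x _ do
  rewrite /F /= mulrA (normal_pdf_conv _ _ s10 s20 sE) mulrAC EFinM.
rewrite ge0_integralZl//=.
- by rewrite integral_normal_pdf mule1.
- by apply/measurable_EFinP; exact: mpdf.
- by move=> x _; rewrite lee_fin normal_pdf_ge0.
- by rewrite lee_fin mulr_ge0// normal_pdf_ge0.
Qed.

End normal_laws.

(** * Sums of independent normal variables *)

Definition normal_law (R : realType) d (T : measurableType d) (P : probability T R)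
    (U : T -> R) (s : R) :=
  forall B, measurable B -> P (U @^-1` B) = normal1 0 s B.

(** Standard deviations are only determined up to sign by their squares. *)
Lemma normal1_sqr (R : realType) (s t : R) (B : set R) : measurable B ->
  s ^+ 2 = t ^+ 2 -> normal1 0 s B = normal1 0 t B.
Proof.
move=> mB st; have E0 : (s == 0) = (t == 0) by rewrite -(sqrf_eq0 s) st sqrf_eq0.
rewrite /normal1 E0; case: ifPn => // t0.
rewrite !normal_probE//; apply: eq_integral => x _; congr (_ * _)%:E.
by rewrite !normal_pdfE ?E0// /normal_peak /normal_fun st.
Qed.

Lemma measurable_add_preimage (R : realType) (B : set R) : measurable B ->
  measurable [set w : R * R | B (w.1 + w.2)].
Proof.
move=> mB; rewrite -[X in measurable X]setTI.
have mF : measurable_fun setT (fun w : R * R => w.1 + w.2).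
  by apply: measurable_funD; [exact: measurable_fst|exact: measurable_snd].
exact: mF.
Qed.

Lemma measurable_normal_shift (R : realType) (s : R) (B : set R) : measurable B ->
  measurable_fun setT (fun x : R => normal_prob 0 s [set y | B (x + y)%R]).
Proof.
move=> mB.
have := @measurable_fun_xsection _ _ _ _ R (normal_prob 0 s) _ (measurable_add_preimage mB).
apply: eq_measurable_fun => x _ /=; congr (normal_prob _ _ _).
by apply/seteqP; split => y /=; rewrite /xsection/= inE.
Qed.

Lemma integral_normal_law (R : realType) d (T : measurableType d) (P : probability T R)
    (U : T -> R) (s : R) (h : R -> \bar R) : measurable_fun setT U -> normal_law P U s ->
  measurable_fun setT h -> (forall x, 0 <= h x)%E ->
  (\int[P]_w h (U w) = if s == 0%R then h 0%R else \int[normal_prob 0 s]_x h x)%E.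
Proof.
move=> mU lU mh h0.
have := @ge0_integral_pushforward _ _ T (measurableTypeR R) R U mU P setT h measurableT mh
  (fun x _ => h0 x).
rewrite preimage_setT /= => <-.
case: ifPn => s0.
  pose z : measurableTypeR R := (0 : R)%R.
  transitivity (\int[\d_z]_x h x)%E.
    apply: eq_measure_integral => A mA _.
    by have := lU _ mA; rewrite /normal1 s0.
  by rewrite integral_dirac// diracT mul1e.
apply: eq_measure_integral => A mA _.
by have := lU _ mA; rewrite /normal1 (negbTE s0).
Qed.

(** Independence is realised by the product space. A degenerate summand is the constant 0
    almost surely and is treated apart, as it has no density. *)
Lemma normal_law_add (R : realType) d1 (T1 : measurableType d1) (P1 : probability T1 R)
    d2 (T2 : measurableType d2) (P2 : probability T2 R) (U : T1 -> R) (V : T2 -> R) (s1 s2 s : R) :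
  measurable_fun setT U -> measurable_fun setT V ->
  normal_law P1 U s1 -> normal_law P2 V s2 -> s ^+ 2 = s1 ^+ 2 + s2 ^+ 2 ->
  normal_law (P1 \x P2)%E (fun w : T1 * T2 => U w.1 + V w.2) s.
Proof.
move=> mU mV lU lV sE B mB.
have mx x := measurable_add_preim x mB.
transitivity (\int[P1]_x normal1 0 s2 [set y | B (U x + y)%R])%E.
  rewrite /= /product_measure1; apply: eq_integral => x _ /=.
  rewrite -lV//; congr (P2 _); apply/seteqP; split => y /=; by rewrite /xsection/= inE.
have [s20|s20] := eqVneq s2 0.
  rewrite (normal1_sqr (t := s1)) ?sE ?s20 ?expr0n ?addr0// -lU//.
  rewrite -[X in _ = P1 X]setIT -integral_indic//; last first.
    by rewrite -[X in measurable X]setTI; exact: mU.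
  apply: eq_integral => x _; rewrite /normal1 eqxx diracE indicE; congr ((nat_of_bool _)%:R%:E).
  by apply/idP/idP; rewrite !inE/= addr0.
rewrite (@integral_normal_law R _ T1 P1 U s1
    (fun x => normal1 0 s2 [set y | B (x + y)%R]))//; last first.
- by move=> x; rewrite /normal1 (negbTE s20).
- by rewrite /normal1 (negbTE s20); exact: measurable_normal_shift.
have [s10|s10] := eqVneq s1 0.
  rewrite (normal1_sqr (t := s2)) ?sE ?s10 ?expr0n ?add0r//.
  by congr (normal1 _ _ _); apply/seteqP; split => y/=; rewrite add0r.
rewrite /normal1 (negbTE s20).
rewrite (normal_prob_conv s10 s20 sE mB) ifF//.
apply/negbTE; have : 0 < s ^+ 2 by rewrite sE addr_gt0// exprn_even_gt0.
by apply: contraTneq => ->; rewrite expr0n ltxx.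
Qed.

(** * Random matrices and sequentially continuous functions *)

Lemma measurable_countable_preimage d (T : measurableType d) (K : countType) (Z : T -> K) :
  (forall q, measurable (Z @^-1` [set q])) -> forall Y : set K, measurable (Z @^-1` Y).
Proof.
move=> mZ Y.
rewrite (_ : Z @^-1` Y = \bigcup_(q : K) (if q \in Y then Z @^-1` [set q] else set0)).
  apply: countable_bigcupT_measurable; first exact: countableP.
  by move=> q; case: ifP.
apply/seteqP; split => [w Yw|w [q _]].
  by exists (Z w) => //=; rewrite mem_set.
by case: ifPn => // /set_mem Yq /= ->.
Qed.

Section random_matrices.
Context (R : realType) (m n : nat).
Implicit Types x : 'M[R]_(m, n).

Definition mx_cvg (u : nat -> 'M[R]_(m, n)) x :=
  forall i j, u r i j @[r --> \oo] --> x i j.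

(** Sequential rather than topological continuity, because the conditional expectation of
    a test function inherits it by dominated convergence, which is about sequences. It is
    enough for measurability. *)
Definition seq_cont (f : 'M[R]_(m, n) -> R) :=
  forall u x, mx_cvg u x -> f (u r) @[r --> \oo] --> f x.

(** Entrywise rounding down to the grid of mesh 1 / (k + 1). Integer coordinates make the
    rounded matrix an element of a countable type, all of whose subsets have measurable
    preimages. *)
Definition mx_floor (k : nat) x : 'M[int]_(m, n) :=
  map_mx (fun y => Num.floor (k.+1%:R * y)) x.

Definition mx_unfloor (k : nat) (q : 'M[int]_(m, n)) : 'M[R]_(m, n) :=
  map_mx (fun z : int => z%:~R / k.+1%:R) q.

Lemma mx_floor_dist k x i j : 0 <= x i j - mx_unfloor k (mx_floor k x) i j < k.+1%:R^-1.
Proof.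
rewrite !mxE; have /andP[h1 h2] := floor_itv (k.+1%:R * x i j).
have k0 : 0 < k.+1%:R :> R by [].
rewrite subr_ge0 ler_pdivrMr// (mulrC (x i j)) h1/= ltrBlDr.
rewrite -[X in _ < X + _]mul1r -mulrDl ltr_pdivlMr// mulrC addrC.
by move: h2; rewrite intrD.
Qed.

Context d (T : measurableType d) (X : T -> 'M[R]_(m, n)).
Hypothesis mX : forall i j, measurable_fun setT (fun w => X w i j).

Lemma measurable_mx_floor k (Y : set 'M[int]_(m, n)) :
  measurable [set w | Y (mx_floor k (X w))].
Proof.
apply: (@measurable_countable_preimage _ _ _ (fun w => mx_floor k (X w))) => q.
rewrite (_ : _ @^-1` _ = \bigcap_(ij in [set: 'I_m * 'I_n])
    (fun w => X w ij.1 ij.2) @^-1` [set y | Num.floor (k.+1%:R * y) = q ij.1 ij.2]).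
  apply: fin_bigcap_measurable => // -[i j] _ /=.
  rewrite -[X in measurable X]setTI; apply: mX => //.
  rewrite (_ : [set y | _] = `[(q i j)%:~R / k.+1%:R, (q i j + 1)%:~R / k.+1%:R[%classic).
    exact: measurable_itv.
  apply/seteqP; split => y /=; rewrite in_itv/= ler_pdivrMr// ltr_pdivlMr// (mulrC y).
    by move/eqP; rewrite floor_eq.
  by rewrite -floor_eq => /eqP.
apply/seteqP; split => w /=.
  by move=> <- [i j] _ /=; rewrite mxE.
by move=> H; apply/matrixP => i j; rewrite mxE; exact: (H (i, j) I).
Qed.

(** f composed with X is the pointwise limit of f at the rounded values of X, which form a
    countable set. *)
Lemma seq_cont_measurable f : seq_cont f -> measurable_fun setT (f \o X).
Proof.
move=> cf; pose h k w := f (mx_unfloor k (mx_floor k (X w))).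
apply: (@measurable_fun_cvg _ _ _ _ h) => [k|w _] /=.
  move=> _ B mB; rewrite setTI.
  exact: (measurable_mx_floor k [set q | B (f (mx_unfloor k q))]).
apply: cf => i j.
apply: (@cvg_of_dist_le R _ (fun=> X w i j) (fun k => k.+1%:R^-1)).
- apply: nearW => k; have /andP[h1 h2] := mx_floor_dist k (X w) i j.
  by rewrite distrC ger0_norm// ltW.
- exact: cvg_harmonic.
- exact: cvg_cst.
Qed.

(** An open set is the union, over all meshes, of the grid cells that it contains. *)
Lemma measurable_open_preimage (U : set 'M[R]_(m, n)) : open U -> measurable (X @^-1` U).
Proof.
move=> oU; (* C k q: the whole cell of the grid point q lies in U. *)
pose C k (q : 'M[int]_(m, n)) := forall x, mx_floor k x = q -> U x.
rewrite (_ : X @^-1` U = \bigcup_k [set w | C k (mx_floor k (X w))]).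
  by apply: bigcupT_measurable => k; exact: measurable_mx_floor.
apply/seteqP; split => [w Uw|w [k _ Cw]]; last exact: Cw.
have /nbhs_ballP[e /= e0 eU] : nbhs (X w) U by apply: open_nbhs_nbhs.
have [k _ ke] : \forall k \near \oo, (k.+1%:R^-1 : R) < e.
  exact: (cvgr_lt 0 (@cvg_harmonic R)).
exists k => // x xw; apply: eU; split => // i j.
have /andP[a1 a2] := mx_floor_dist k x i j; have /andP[b1 b2] := mx_floor_dist k (X w) i j.
have ke' : k.+1%:R^-1 < e := ke k (leqnn k).
move: a1 a2 b1 b2 ke'; rewrite xw; move: (mx_unfloor _ _ _ _) (_^-1) => z y *.
by rewrite /ball/= ltr_norml; apply/andP; split; lra.
Qed.

End random_matrices.

Lemma continuous_seq_cont (R : realType) m n (f : 'M[R]_(m, n) -> R) :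
  continuous f -> seq_cont f.
Proof.
move=> cf u x ux; apply: (cvg_comp _ _ _ (cf x)).
move=> A [P xP PA].
have H : \forall r \near \oo, forall i j, P i j (u r i j).
  have H1 (ij : 'I_m * 'I_n) : \forall r \near \oo, P ij.1 ij.2 (u r ij.1 ij.2).
    exact: (ux ij.1 ij.2 _ (xP ij.1 ij.2)).
  by apply: filterS (filter_forall _ H1) => r H3 i j; exact: (H3 (i, j)).
by apply: filterS H => r /= H; apply: PA.
Qed.

(** * Contingency tables and their first column *)

Definition tot m (a : 'cV[nat]_m) : nat := (\sum_(i < m) a i ord0)%N.

Lemma has_marginsP I J (a : 'cV[nat]_I) (b : 'cV[nat]_J) (k : 'M[nat]_(I, J)) :
  reflect ((forall i, (\sum_j k i j)%N = a i ord0) /\ (forall j, (\sum_i k i j)%N = b j ord0))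
    (has_margins a b k).
Proof.
apply: (iffP andP) => -[ka kb]; split.
- by move=> i; apply/eqP; exact: (forallP ka).
- by move=> j; apply/eqP; exact: (forallP kb).
- by apply/forallP => i; apply/eqP.
- by apply/forallP => j; apply/eqP.
Qed.

Lemma margins_tot I J (a : 'cV[nat]_I) (b : 'cV[nat]_J) (k : 'M[nat]_(I, J)) :
  has_margins a b k -> tot a = tot b.
Proof.
case/has_marginsP => ka kb; rewrite /tot; under eq_bigr do rewrite -ka.
by rewrite exchange_big; apply: eq_bigr => j _.
Qed.

Lemma leq_tot m (a : 'cV[nat]_m) i : (a i ord0 <= tot a)%N.
Proof. by rewrite /tot (bigD1 i)//= leq_addr. Qed.

Lemma has_margins_tr I J (a : 'cV[nat]_I) (b : 'cV[nat]_J) (k : 'M[nat]_(I, J)) :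
  has_margins b a k^T = has_margins a b k.
Proof.
apply/has_marginsP/has_marginsP => -[h1 h2]; split => i.
- by rewrite -h2; apply: eq_bigr => j _; rewrite mxE.
- by rewrite -h1; apply: eq_bigr => j _; rewrite mxE.
- by rewrite -h2; apply: eq_bigr => j _; rewrite mxE.
- by rewrite -h1; apply: eq_bigr => j _; rewrite mxE.
Qed.

Section tables.
Variable R : realType.

Lemma table_pmf_ge0 I J (a : 'cV[nat]_I) (b : 'cV[nat]_J) (k : 'M[nat]_(I, J)) :
  0 <= table_pmf a b k :> R.
Proof. by rewrite /table_pmf; case: ifP => // _; rewrite divr_ge0. Qed.

Lemma table_pmf_tr I J (a : 'cV[nat]_I) (b : 'cV[nat]_J) (k : 'M[nat]_(I, J)) :
  table_pmf b a k^T = table_pmf a b k :> R.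
Proof.
rewrite /table_pmf has_margins_tr; case: ifP => // h.
rewrite mulnC -!/(tot _) (margins_tot h) exchange_big/=; congr (_ / (_ * _)%N%:R).
by apply: eq_bigr => i _; apply: eq_bigr => j _; rewrite mxE.
Qed.

Definition ord_table N I J (k : 'M['I_N.+1]_(I, J)) : 'M[nat]_(I, J) := map_mx val k.

(** The expectation of g under the law of the table. The sum is over tables with entries at
    most N, a finite type; for N at least the total these include all the tables with the
    given margins. *)
Definition table_mean N I J (a : 'cV[nat]_I) (b : 'cV[nat]_J) (g : 'M[nat]_(I, J) -> R) : R :=
  \sum_(k : 'M['I_N.+1]_(I, J)) table_pmf a b (ord_table k) * g (ord_table k).

Lemma table_mean_tr N I J (a : 'cV[nat]_I) (b : 'cV[nat]_J) (g : 'M[nat]_(J, I) -> R) :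
  table_mean N b a g = table_mean N a b (fun k => g k^T).
Proof.
rewrite /table_mean (reindex (@trmx 'I_N.+1 I J)) /=; last by exists (@trmx _ J I) => k _; rewrite trmxK.
apply: eq_bigr => k _; have -> : ord_table k^T = (ord_table k)^T by rewrite /ord_table map_trmx.
by rewrite table_pmf_tr.
Qed.

Definition mx_subn I (a c : 'cV[nat]_I) : 'cV[nat]_I := map2_mx subn a c.

(** The columns after the first one are lumped together, which leaves a table with the same
    rows and two columns. *)
Definition merged_margin J (b : 'cV[nat]_(1 + J)) : 'cV[nat]_(1 + 1) :=
  col_mx (usubmx b) (const_mx (tot (dsubmx b))).

Lemma tot_split J (b : 'cV[nat]_(1 + J)) : tot b = (usubmx b ord0 ord0 + tot (dsubmx b))%N.
Proof.
rewrite /tot big_split_ord/= big_ord1; congr (_ + _)%N; first by rewrite mxE.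
by apply: eq_bigr => i _; rewrite mxE.
Qed.

Lemma tot_merged J (b : 'cV[nat]_(1 + J)) : tot (merged_margin b) = tot b.
Proof.
rewrite tot_split [RHS]tot_split /merged_margin col_mxKu col_mxKd; congr addn.
by rewrite [LHS]/tot big_ord1 mxE.
Qed.

Lemma has_margins_row_mx I J (a : 'cV[nat]_I) (b : 'cV[nat]_(1 + J)) (c : 'cV[nat]_I)
    (k : 'M[nat]_(I, J)) :
  reflect [/\ forall i, (c i ord0 + \sum_j k i j)%N = a i ord0, tot c = usubmx b ord0 ord0 &
    forall j, (\sum_i k i j)%N = dsubmx b j ord0] (has_margins a b (row_mx c k)).
Proof.
apply: (iffP (has_marginsP _ _ _)) => [[h1 h2]|[h1 h2 h3]]; split.
- move=> i; rewrite -h1 big_split_ord/= big_ord1 row_mxEl; congr addn.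
  by apply: eq_bigr => j _; rewrite row_mxEr.
- rewrite mxE -h2; apply: eq_bigr => i _; by rewrite row_mxEl.
- move=> j; rewrite mxE -h2; apply: eq_bigr => i _; by rewrite row_mxEr.
- move=> i; rewrite -h1 big_split_ord/= big_ord1 row_mxEl; congr addn.
  by apply: eq_bigr => j _; rewrite row_mxEr.
- move=> j; case: (split_ordP j) => j' ->.
    rewrite ord1; have -> : b (lshift J ord0) ord0 = usubmx b ord0 ord0 by rewrite mxE.
    by rewrite -h2; apply: eq_bigr => i _; rewrite row_mxEl.
  have -> : b (rshift 1 j') ord0 = dsubmx b j' ord0 by rewrite mxE.
  by rewrite -h3; apply: eq_bigr => i _; rewrite row_mxEr.
Qed.

Lemma tot_mx_subn I (a c : 'cV[nat]_I) : (forall i, c i ord0 <= a i ord0)%N ->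
  tot (mx_subn a c) = (tot a - tot c)%N.
Proof.
move=> ca; rewrite /tot -sumnB//; apply: eq_bigr => i _; by rewrite mxE.
Qed.

Lemma has_margins_split I J (a : 'cV[nat]_I) (b : 'cV[nat]_(1 + J)) (c : 'cV[nat]_I)
    (k : 'M[nat]_(I, J)) :
  tot a = tot b ->
  has_margins a b (row_mx c k) =
  has_margins a (merged_margin b) (row_mx c (mx_subn a c)) && has_margins (mx_subn a c) (dsubmx b) k.
Proof.
move=> ab; apply/has_margins_row_mx/andP.
  move=> [h1 h2 h3].
  have ca i : (c i ord0 <= a i ord0)%N by rewrite -h1 leq_addr.
  split.
    apply/has_margins_row_mx; split.
    - by move=> i; rewrite big_ord1 mxE subnKC.
    - by rewrite h2 /merged_margin col_mxKu.
    - move=> j; rewrite /merged_margin col_mxKd mxE ord1.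
      rewrite -[LHS]/(tot (mx_subn a c)) tot_mx_subn// ab h2 tot_split addKn//.
  apply/has_marginsP; split => //.
  by move=> i; rewrite mxE -h1 addKn.
move=> [/has_margins_row_mx[h1 h2 h3] /has_marginsP[h4 h5]].
have ca i : (c i ord0 <= a i ord0)%N by rewrite -[leqRHS]h1 leq_addr.
split => //.
- by move=> i; rewrite h4 mxE subnKC.
- by rewrite h2 /merged_margin col_mxKu.
Qed.

(** Given its first column c, the rest of the table has again the law of a table, with row
    sums a - c: in the product on the right the factorials of a - c and of the total of the
    lumped column cancel. *)
Lemma table_pmf_split I J (a : 'cV[nat]_I) (b : 'cV[nat]_(1 + J)) (c : 'cV[nat]_I)
    (k : 'M[nat]_(I, J)) :
  tot a = tot b ->
  table_pmf a b (row_mx c k) =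
  table_pmf a (merged_margin b) (row_mx c (mx_subn a c)) * table_pmf (mx_subn a c) (dsubmx b) k :> R.
Proof.
move=> ab; rewrite /table_pmf has_margins_split//.
have [h1|] := boolP (has_margins a (merged_margin b) _); last by rewrite mul0r.
have [h2|] := boolP (has_margins (mx_subn a c) _ _); last by rewrite mulr0.
rewrite /=.
have t2 : (\sum_i mx_subn a c i ord0)%N = tot (dsubmx b) by rewrite -(margins_tot h2).
rewrite t2 !big_split_ord/= !big_ord1.
have f0 m : m`!%:R != 0 :> R by rewrite pnatr_eq0 -lt0n fact_gt0.
have p0 m (F : 'I_m -> nat) : (\prod_(i < m) (F i)`!)%N%:R != 0 :> R.
  by rewrite pnatr_eq0 -lt0n prodn_gt0// => i; exact: fact_gt0.
have E1 : merged_margin b (lshift 1 ord0) ord0 = b (lshift J ord0) ord0.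
  by rewrite /merged_margin col_mxEu mxE.
have E2 : merged_margin b (rshift 1 ord0) ord0 = tot (dsubmx b).
  by rewrite /merged_margin col_mxEd mxE.
rewrite E1 E2.
have -> : (\prod_(i < I) \prod_(j < 1 + J) (row_mx c k i j)`! =
   \prod_(i < I) (c i ord0)`! * \prod_(i < I) \prod_(j < J) (k i j)`!)%N.
  rewrite -big_split/=; apply: eq_bigr => i _.
  rewrite big_split_ord/= big_ord1 row_mxEl; congr muln.
  by apply: eq_bigr => j _; rewrite row_mxEr.
have -> : (\prod_(i < I) \prod_(j < 1 + 1) (row_mx c (mx_subn a c) i j)`! =
   \prod_(i < I) (c i ord0)`! * \prod_(i < I) (mx_subn a c i ord0)`!)%N.
  rewrite -big_split/=; apply: eq_bigr => i _.
  by rewrite big_split_ord/= !big_ord1 row_mxEl row_mxEr.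
have -> : (\prod_(i < J) (b (rshift 1 i) ord0)`! = \prod_(i < J) (dsubmx b i ord0)`!)%N.
  by apply: eq_bigr => i _; rewrite mxE.
have k0 : (\prod_(i < I) \prod_(j < J) (k i j)`!)%N%:R != 0 :> R.
  by rewrite pnatr_eq0 -lt0n prodn_gt0// => i; rewrite prodn_gt0// => j; exact: fact_gt0.
rewrite !natrM; field.
by rewrite !f0 !p0 k0.
Qed.

Lemma ord_table_row_mx N I J1 J2 (c : 'M['I_N.+1]_(I, J1)) (k : 'M['I_N.+1]_(I, J2)) :
  ord_table (row_mx c k) = row_mx (ord_table c) (ord_table k).
Proof. by rewrite /ord_table map_row_mx. Qed.

Lemma big_row_mx N I J1 J2 (F : 'M['I_N.+1]_(I, J1 + J2) -> R) :
  \sum_k F k = \sum_(c : 'M['I_N.+1]_(I, J1)) \sum_(k : 'M['I_N.+1]_(I, J2)) F (row_mx c k).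
Proof.
rewrite pair_bigA/= (reindex (fun p : 'M['I_N.+1]_(I, J1) * 'M['I_N.+1]_(I, J2) => row_mx p.1 p.2))//=.
exists (fun k => (lsubmx k, rsubmx k)) => [[c k] _|k _] /=; last exact: hsubmxK.
by rewrite row_mxKl row_mxKr.
Qed.

(** The law of iterated expectations. The lumped column is determined by the first one, so
    that the sum over it has a single nonzero term. *)
Lemma table_mean_split N I J (a : 'cV[nat]_I) (b : 'cV[nat]_(1 + J)) (g : 'M[nat]_(I, 1 + J) -> R) :
  tot a = tot b -> (tot a <= N)%N ->
  table_mean N a b g = table_mean N a (merged_margin b) (fun c : 'M[nat]_(I, 1 + 1) =>
    table_mean N (mx_subn a (lsubmx c)) (dsubmx b) (fun k => g (row_mx (lsubmx c) k))).
Proof.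
move=> ab aN; rewrite /table_mean !big_row_mx; apply: eq_bigr => c _.
(* The only second column that completes the first column c to a merged table. *)
pose e0 : 'M['I_N.+1]_(I, 1) := map_mx inord (mx_subn a (ord_table c)).
have te0 : ord_table e0 = mx_subn a (ord_table c).
  apply/matrixP => i j; rewrite !mxE /= inordK// ltnS (leq_trans (leq_subr _ _))//.
  by rewrite ord1 (leq_trans (leq_tot a i)).
rewrite [RHS](bigD1 e0)//= [X in _ + X]big1 ?addr0; last first.
  move=> e ee0; rewrite /table_pmf ifF ?mul0r//.
  apply/negP; rewrite ord_table_row_mx => /has_margins_row_mx[h _ _].
  move/negP: ee0; apply; apply/eqP/matrixP => i j; apply: val_inj.
  have tabE (x : 'M['I_N.+1]_(I, 1)) : val (x i j) = ord_table x i j by rewrite mxE.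
  by rewrite !tabE te0 ord1 [RHS]mxE -(h i) big_ord1 addKn.
rewrite !ord_table_row_mx te0 row_mxKl mulr_sumr; apply: eq_bigr => k _.
by rewrite ord_table_row_mx table_pmf_split// mulrA.
Qed.

Lemma table_mean_bounds N I J (a : 'cV[nat]_I) (b : 'cV[nat]_J) g :
  table_mean N a b (fun=> 1) = 1 ->
  (forall k, has_margins a b k -> 0 <= g k <= 1) -> 0 <= table_mean N a b g <= 1.
Proof.
move=> p1 g01.
have H (k : 'M['I_N.+1]_(I, J)) :
    0 <= table_pmf a b (ord_table k) * g (ord_table k) <= table_pmf a b (ord_table k) * 1.
  have p0 := table_pmf_ge0 a b (@ord_table N _ _ k).
  have [v|v] := boolP (has_margins a b (ord_table k)); last first.
    by rewrite /table_pmf (negbTE v) !mul0r lexx.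
  by have /andP[g0 g1] := g01 _ v; rewrite mulr_ge0//= ler_wpM2l.
apply/andP; split; first by apply: sumr_ge0 => k _; have /andP[] := H k.
by rewrite -[leRHS]p1; apply: ler_sum => k _; have /andP[] := H k.
Qed.

Lemma eq_table_mean N I J (a : 'cV[nat]_I) (b : 'cV[nat]_J) g1 g2 :
  (forall k, has_margins a b k -> g1 k = g2 k) -> table_mean N a b g1 = table_mean N a b g2.
Proof.
move=> g12; apply: eq_bigr => k _.
have [v|v] := boolP (has_margins a b (ord_table k)); first by rewrite g12.
by rewrite /table_pmf (negbTE v) !mul0r.
Qed.

End tables.

(** * The limiting covariance *)

Section covariance_form.
Variable R : realType.

(** The variance of the linear functional with coefficients t under the limiting
    covariance. *)
Definition cov_form I J (al : 'cV[R]_I) (be : 'cV[R]_J) (t : 'M[R]_(I, J)) : R :=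
  \sum_i \sum_j \sum_k \sum_l t i j *
    (al i 0 * ((i == k)%:R - al k 0) * (be j 0 * ((j == l)%:R - be l 0))) * t k l.

Lemma sum_delta n (F : 'I_n -> R) (j : 'I_n) : \sum_l (j == l)%:R * F l = F j.
Proof.
rewrite (bigD1 j)//= eqxx mul1r big1 ?addr0// => l lj.
by rewrite eq_sym (negbTE lj) mul0r.
Qed.

(** The column factor of the covariance turns two rows of t into their covariance under the
    weights be. *)
Lemma cov_formE I J (al : 'cV[R]_I) (be : 'cV[R]_J) (t : 'M[R]_(I, J)) :
  cov_form al be t = \sum_i \sum_k al i 0 * ((i == k)%:R - al k 0) *
    (\sum_j be j 0 * (t i j * t k j) - (\sum_j be j 0 * t i j) * (\sum_j be j 0 * t k j)).
Proof.
apply: eq_bigr => i _; rewrite exchange_big/=; apply: eq_bigr => k _.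
rewrite mulr_suml -sumrB mulr_sumr; apply: eq_bigr => j _.
rewrite [X in _ = _ * (_ - X)]mulr_sumr.
rewrite -[X in _ = _ * (X - _)](sum_delta (fun l => be l 0 * (t i l * t k l)) j).
rewrite -sumrB mulr_sumr; apply: eq_bigr => l _.
by have [->|_] /= := eqVneq j l; ring.
Qed.

Lemma cov_form_tr I J (al : 'cV[R]_I) (be : 'cV[R]_J) (t : 'M[R]_(J, I)) :
  cov_form be al t = cov_form al be t^T.
Proof.
rewrite /cov_form exchange_big; apply: eq_bigr => i _; apply: eq_bigr => j _.
rewrite exchange_big; apply: eq_bigr => k _; apply: eq_bigr => l _.
by rewrite !mxE; ring.
Qed.

(** The law of total variance: the first term is the variance of the conditional mean given
    the first column, the second one the mean of the conditional variance. By cov_formE the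
    identity reduces to one between covariances under the weights be. *)
Lemma cov_form_split I J (al : 'cV[R]_I) (be : 'cV[R]_(1 + J)) (t : 'M[R]_(I, 1 + J)) (b0 : R) :
  usubmx be 0 0 = b0 -> b0 < 1 ->
  cov_form al be t =
  cov_form al (col_mx (usubmx be) (const_mx (1 - b0)) : 'cV_(1 + 1))
    (row_mx (lsubmx t - (1 - b0)^-1 *: (rsubmx t *m dsubmx be)) 0) +
  cov_form al ((1 - b0)^-1 *: dsubmx be) (Num.sqrt (1 - b0) *: rsubmx t).
Proof.
move=> b0E b01; have c0 : 0 < 1 - b0 by rewrite subr_gt0.
rewrite !cov_formE -big_split/=; apply: eq_bigr => i _; rewrite -big_split/=; apply: eq_bigr => k _.
rewrite -mulrDr; congr (_ * _).
have b0E' : be (lshift J ord0) 0 = b0 by rewrite -b0E mxE.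
pose S2 := \sum_j dsubmx be j 0 * (rsubmx t i j * rsubmx t k j).
pose S (i : 'I_I) := \sum_j dsubmx be j 0 * rsubmx t i j.
have e1 (x : 'I_I) : (rsubmx t *m dsubmx be) x 0 = S x.
  by rewrite mxE; apply: eq_bigr => j _; rewrite mulrC.
rewrite !big_split_ord/= !big_ord1 !row_mxEl !row_mxEr !col_mxEu !col_mxEd b0E b0E'.
have z (x : 'I_I) : (0 : 'M[R]_(I, 1)) x ord0 = 0 by rewrite mxE.
rewrite !z !mulr0 !addr0.
have e2 (x : 'I_I) : (lsubmx t - (1 - b0)^-1 *: (rsubmx t *m dsubmx be)) x ord0 =
    t x (lshift J ord0) - (1 - b0)^-1 * S x.
  by rewrite !mxE -e1 mxE.
rewrite !e2.
have e3 (x : 'I_I) : \sum_(j < J) be (rshift 1 j) 0 * t x (rshift 1 j) = S x.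
  by apply: eq_bigr => j _; rewrite !mxE.
have e4 : \sum_(j < J) be (rshift 1 j) 0 * (t i (rshift 1 j) * t k (rshift 1 j)) = S2.
  by apply: eq_bigr => j _; rewrite !mxE.
rewrite !e3 e4.
have sq : Num.sqrt (1 - b0) ^+ 2 = 1 - b0 by rewrite sqr_sqrtr// ltW.
have e5 : \sum_j ((1 - b0)^-1 *: dsubmx be) j 0 *
    ((Num.sqrt (1 - b0) *: rsubmx t) i j * (Num.sqrt (1 - b0) *: rsubmx t) k j) = S2.
  apply: eq_bigr => j _; rewrite !mxE.
  transitivity (Num.sqrt (1 - b0) ^+ 2 * (1 - b0)^-1 *
    (be (rshift 1 j) 0 * (t i (rshift 1 j) * t k (rshift 1 j)))); first by ring.
  by rewrite sq divff ?mul1r// gt_eqF.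
have e6 (x : 'I_I) : \sum_j ((1 - b0)^-1 *: dsubmx be) j 0 * (Num.sqrt (1 - b0) *: rsubmx t) x j =
    (1 - b0)^-1 * Num.sqrt (1 - b0) * S x.
  rewrite /S mulr_sumr; apply: eq_bigr => j _; rewrite !mxE.
  by rewrite mulrACA.
rewrite e5 !e6.
have -> : (1 - b0)^-1 * Num.sqrt (1 - b0) * S i * ((1 - b0)^-1 * Num.sqrt (1 - b0) * S k) =
    Num.sqrt (1 - b0) ^+ 2 * ((1 - b0)^-1 ^+ 2 * (S i * S k)) by ring.
by rewrite sq; field; rewrite gt_eqF.
Qed.

End covariance_form.

(** * The limit theorem in a form stable under conditioning *)

Section limit_theorem.
Variable R : realType.

Definition std_table I J (a : 'cV[nat]_I) (b : 'cV[nat]_J) (k : 'M[nat]_(I, J)) : 'M[R]_(I, J) :=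
  (Num.sqrt (tot a)%:R)^-1 *: (natmx k - (tot a)%:R^-1 *: (natmx a *m (natmx b)^T)).

Lemma std_tableE I J (a : 'cV[nat]_I) (b : 'cV[nat]_J) (k : 'M[nat]_(I, J)) i j :
  std_table a b k i j =
  ((k i j)%:R - (a i ord0)%:R * (b j ord0)%:R / (tot a)%:R) / Num.sqrt (tot a)%:R.
Proof.
rewrite /std_table !mxE big_ord1 !mxE mulrC; congr ((_ - _) * _).
by rewrite mulrC.
Qed.

Lemma std_table_tr I J (a : 'cV[nat]_I) (b : 'cV[nat]_J) (k : 'M[nat]_(I, J)) i j :
  tot a = tot b -> std_table b a k^T j i = std_table a b k i j.
Proof. by move=> ab; rewrite !std_tableE ab mxE (mulrC (b j ord0)%:R). Qed.

(** The bounds N hold for every r, but equality of the two totals only eventually: a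
    sequence of margins left over by given first columns satisfies it only where these
    columns are admissible. *)
Definition regime I J (a : nat -> 'cV[nat]_I) (b : nat -> 'cV[nat]_J) (N : nat -> nat)
    (al : 'cV[R]_I) (be : 'cV[R]_J) :=
  [/\ \forall r \near \oo, tot (a r) = tot (b r),
      forall r, (tot (a r) <= N r)%N /\ (tot (b r) <= N r)%N,
      tot (a r) @[r --> \oo] --> \oo,
      forall i, (a r i ord0)%:R / (tot (a r))%:R @[r --> \oo] --> al i 0 &
      forall j, (b r j ord0)%:R / (tot (a r))%:R @[r --> \oo] --> be j 0].

(** g converges continuously to f, that is along every sequence of tables whose
    standardised values converge. Conditioning on the first column replaces a test function
    by a conditional expectation that depends on r, and only this kind of convergence is
    inherited by it. *)
Definition test_functions I J (a : nat -> 'cV[nat]_I) (b : nat -> 'cV[nat]_J)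
    (g : nat -> 'M[nat]_(I, J) -> R) (f : 'M[R]_(I, J) -> R) :=
  [/\ forall r k, has_margins (a r) (b r) k -> 0 <= g r k <= 1,
      forall x, 0 <= f x <= 1, seq_cont f &
      forall (k : nat -> 'M[nat]_(I, J)) x,
        (\forall r \near \oo, has_margins (a r) (b r) (k r)) ->
        mx_cvg (fun r => std_table (a r) (b r) (k r)) x ->
        g r (k r) @[r --> \oo] --> f x].

(** The limit is a random matrix and not merely a law, so that the limits for the first
    column and for the remaining ones can be combined on a product space. *)
Definition limit_at I J (al : 'cV[R]_I) (be : 'cV[R]_J) : Prop :=
  exists (d : measure_display) (T : measurableType d) (P : probability T R)
    (X : T -> 'M[R]_(I, J)),
  [/\ forall i j, measurable_fun setT (fun w => X w i j),
      forall t : 'M[R]_(I, J), exists2 s, s ^+ 2 = cov_form al be t &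
        normal_law P (fun w => \sum_i \sum_j t i j * X w i j) s &
      forall a b N g f, regime a b N al be -> test_functions a b g f ->
        table_mean (N r) (a r) (b r) (g r) @[r --> \oo] --> \int[P]_w f (X w)].

Definition table_clt I J : Prop :=
  (forall N (a : 'cV[nat]_I) (b : 'cV[nat]_J), tot a = tot b -> (tot a <= N)%N ->
    table_mean N a b (fun=> 1 : R) = 1) /\
  (forall (al : 'cV[R]_I) (be : 'cV[R]_J), open_simplex al -> open_simplex be -> limit_at al be).

(** Rows and columns play the same role; hence it suffices to know how to add columns. *)
Lemma table_clt_tr I J : table_clt I J -> table_clt J I.
Proof.
move=> [p1 clt]; split.
  by move=> N a b ab aN; rewrite table_mean_tr; apply: p1; rewrite -?ab.
move=> be al hbe hal; have [d [T [P [X [mX nX cX]]]]] := clt al be hal hbe.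
exists d, T, P, (fun w => (X w)^T); split.
- move=> j i; rewrite (_ : (fun w => _) = fun w => X w i j)//.
  by apply/funext => w; rewrite mxE.
- move=> t; have [s sq ls] := nX t^T; exists s; first by rewrite sq -cov_form_tr.
  rewrite (_ : (fun w => _) = fun w => \sum_i \sum_j t^T i j * X w i j)//.
  apply/funext => w; rewrite exchange_big; apply: eq_bigr => i _; apply: eq_bigr => j _.
  by rewrite !mxE.
- move=> b a N g f [r1 r2 r3 r4 r5] [t1 t2 t3 t4].
  suff H : table_mean (N r) (a r) (b r) (fun k => g r k^T) @[r --> \oo] --> \int[P]_w f (X w)^T.
    by apply: (cvg_near_eq H); apply: nearW => r; exact/esym/table_mean_tr.
  apply: (cX a b N (fun r k => g r k^T) (fun x => f x^T)).
    split.
    + by apply: filterS r1 => r ->.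
    + by move=> r; have [? ?] := r2 r.
    + by apply: cvg_trans r3; apply: near_eq_cvg; apply: filterS r1 => r ->.
    + by move=> i; apply: (cvg_near_eq (r5 i)); apply: filterS r1 => r ->.
    + by move=> j; apply: (cvg_near_eq (r4 j)); apply: filterS r1 => r ->.
  split.
  + by move=> r k mk; apply: t1; rewrite has_margins_tr.
  + by move=> x; exact: t2.
  + move=> u x ux; apply: t3 => i j; rewrite mxE; apply: (cvg_near_eq (ux j i)).
    by apply: nearW => r; rewrite mxE.
  + move=> k x mk kx; apply: (t4 (fun r => (k r)^T)).
      by apply: filterS mk => r; rewrite has_margins_tr.
    move=> j i; rewrite mxE; apply: (cvg_near_eq (kx i j)).
    by apply: filterS r1 => r ba; rewrite std_table_tr.
Qed.

Lemma merged_table I J (a : 'cV[nat]_I) (b : 'cV[nat]_(1 + J)) (c : 'M[nat]_(I, 1 + 1)) :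
  has_margins a (merged_margin b) c -> c = row_mx (lsubmx c) (mx_subn a (lsubmx c)).
Proof.
rewrite -{1}(hsubmxK c) => /has_margins_row_mx[h _ _].
rewrite -[LHS]hsubmxK; congr row_mx; apply/matrixP => i j.
by rewrite ord1 [RHS]mxE -h big_ord1 addKn.
Qed.

Lemma open_simplex_merged J (be : 'cV[R]_(1 + J)) : open_simplex be ->
  open_simplex (col_mx (usubmx be) (const_mx (1 - usubmx be 0 0)) : 'cV_(1 + 1)).
Proof.
move=> [h1 h2]; have hb : usubmx be 0 0 = be (lshift J 0) 0 by rewrite mxE.
have := h1 (lshift J 0); rewrite -hb => /andP[b0 b1]; split.
  move=> i; case: (split_ordP i) => j ->; rewrite ?col_mxEu ?col_mxEd ord1.
    by rewrite b0 b1.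
  by rewrite mxE subr_gt0 b1/= gtrBl b0.
by rewrite big_split_ord/= !big_ord1 col_mxEu col_mxEd [const_mx _ _ _]mxE addrC subrK.
Qed.

Lemma open_simplex_rest J (be : 'cV[R]_(1 + J)) : (1 < J)%N -> open_simplex be ->
  open_simplex ((1 - usubmx be 0 0)^-1 *: dsubmx be).
Proof.
move=> J1 [h1 h2]; have hb : usubmx be 0 0 = be (lshift J 0) 0 by rewrite mxE.
have := h1 (lshift J 0); rewrite -hb => /andP[b0 b1].
have c0 : 0 < 1 - usubmx be 0 0 by rewrite subr_gt0.
have E (j : 'I_J) : ((1 - usubmx be 0 0)^-1 *: dsubmx be) j 0 = be (rshift 1 j) 0 / (1 - usubmx be 0 0).
  by rewrite mxE [dsubmx be j 0]mxE mulrC.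
have S : \sum_(j < J) be (rshift 1 j) 0 = 1 - usubmx be 0 0.
  by rewrite -h2 big_split_ord/= big_ord1 hb addrAC subrr add0r.
split => [j|]; last first.
  by under eq_bigr do rewrite E; rewrite -mulr_suml S divff// gt_eqF.
rewrite E; have /andP[j0 _] := h1 (rshift 1 j).
rewrite divr_gt0//= ltr_pdivrMr// mul1r -S.
(* Strictly below 1, because some other column has positive weight. *)
have [j' jj'] : exists j' : 'I_J, j' != j.
  have J0 : (0 < J)%N by exact: ltnW.
  have [->|jn] := eqVneq j (Ordinal J0); last by exists (Ordinal J0); rewrite eq_sym.
  by exists (Ordinal J1).
rewrite (bigD1 j)//= ltrDl (bigD1 j')//= ltr_wpDr//.
  by apply: sumr_ge0 => l _; have /andP[/ltW] := h1 (rshift 1 l).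
by have /andP[] := h1 (rshift 1 j').
Qed.

End limit_theorem.

(** * Conditioning on the first column in the limit *)

Lemma merged_rest I J (a : 'cV[nat]_I) (b : 'cV[nat]_(1 + J)) (c : 'M[nat]_(I, 1 + 1)) :
  has_margins a (merged_margin b) c ->
  tot (mx_subn a (lsubmx c)) = tot (dsubmx b) /\ (tot (dsubmx b) <= tot a)%N.
Proof.
move=> mc; have E := merged_table mc.
have ab : tot a = tot b by rewrite (margins_tot mc) tot_merged.
split; last by rewrite ab tot_split leq_addl.
rewrite E in mc; case/has_margins_row_mx : mc => _ _ /(_ ord0).
by rewrite /merged_margin col_mxKd mxE.
Qed.

Section step.
Variables (R : realType) (I J : nat).

(** The limit of the whole table from the limit x for the merged table and x' for the rest.
    The rest contains the proportion 1 - b0 of the total, which gives the square root, and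
    its mean is lowered where the first column is large: this is the linear term. *)
Definition glue_cols (be : 'cV[R]_(1 + J)) (x : 'M[R]_(I, 1 + 1)) (x' : 'M[R]_(I, J)) :
    'M[R]_(I, 1 + J) :=
  let b0 := usubmx be 0 0 in
  row_mx (lsubmx x) (Num.sqrt (1 - b0) *: x' - (1 - b0)^-1 *: (lsubmx x *m (dsubmx be)^T)).

Lemma glue_colsl be x x' i : glue_cols be x x' i (lshift J 0) = x i (lshift 1 0).
Proof. by rewrite /glue_cols row_mxEl mxE. Qed.

Lemma glue_colsr be x x' i j : glue_cols be x x' i (rshift 1 j) =
  Num.sqrt (1 - usubmx be 0 0) * x' i j - (1 - usubmx be 0 0)^-1 * (x i (lshift 1 0) * dsubmx be j 0).
Proof.
rewrite /glue_cols row_mxEr; rewrite !(@mxE _ I J) big_ord1 [lsubmx x i 0]mxE.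
by rewrite [(dsubmx be)^T _ _]mxE.
Qed.

(** The coefficients on the right are those of cov_form_split. *)
Lemma glue_cols_dot be x x' (t : 'M[R]_(I, 1 + J)) :
  \sum_i \sum_j t i j * glue_cols be x x' i j =
  (let u : 'M[R]_(I, 1 + 1) := row_mx (lsubmx t - (1 - usubmx be 0 0)^-1 *: (rsubmx t *m dsubmx be)) 0 in
   \sum_i \sum_j u i j * x i j) +
  (let v := Num.sqrt (1 - usubmx be 0 0) *: rsubmx t in \sum_i \sum_j v i j * x' i j).
Proof.
move=> /=; rewrite -big_split/=; apply: eq_bigr => i _.
rewrite !big_split_ord/= !big_ord1 glue_colsl row_mxEl row_mxEr.
have -> : (0 : 'M[R]_(I, 1)) i ord0 = 0 by rewrite mxE.
rewrite mul0r addr0.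
have -> : (lsubmx t - (1 - usubmx be 0 0)^-1 *: (rsubmx t *m dsubmx be)) i ord0 =
    t i (lshift J ord0) - (1 - usubmx be 0 0)^-1 * \sum_j t i (rshift 1 j) * dsubmx be j 0.
  rewrite [LHS]mxE [lsubmx t i ord0]mxE; congr (_ + _).
  rewrite [LHS]mxE; congr (- _); rewrite [LHS]mxE; congr (_ * _); rewrite [LHS]mxE.
  by apply: eq_bigr => j _; rewrite [rsubmx t i j]mxE.
rewrite mulrBl -addrA; congr (_ + _).
rewrite mulr_sumr mulr_suml -sumrN -big_split/=; apply: eq_bigr => j _.
have -> : (Num.sqrt (1 - usubmx be 0 0) *: rsubmx t) i j =
    Num.sqrt (1 - usubmx be 0 0) * t i (rshift 1 j).
  by rewrite [LHS]mxE [rsubmx t i j]mxE.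
by rewrite glue_colsr; ring.
Qed.

Lemma glue_cols_cvg be (u : nat -> 'M[R]_(I, 1 + 1)) (v : nat -> 'M[R]_(I, J)) x x' :
  mx_cvg u x -> mx_cvg v x' -> mx_cvg (fun r => glue_cols be (u r) (v r)) (glue_cols be x x').
Proof.
move=> ux vx i j; case: (split_ordP j) => j' ->.
  rewrite ord1 glue_colsl; apply: (cvg_near_eq (ux i (lshift 1 0))).
  by apply: nearW => r; rewrite glue_colsl.
rewrite glue_colsr.
have H := cvgsB (cvgsMl (c := Num.sqrt (1 - usubmx be 0 0)) (vx i j'))
  (cvgsMl (c := (1 - usubmx be 0 0)^-1) (cvgsMr (c := dsubmx be j' 0) (ux i (lshift 1 0)))).
by apply: (cvg_near_eq H); apply: nearW => r; rewrite glue_colsr.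
Qed.

Lemma sum_pmf_step :
  (forall N (a : 'cV[nat]_I) (b : 'cV[nat]_(1 + 1)), tot a = tot b -> (tot a <= N)%N ->
    table_mean N a b (fun=> 1 : R) = 1) ->
  (forall N (a : 'cV[nat]_I) (b : 'cV[nat]_J), tot a = tot b -> (tot a <= N)%N ->
    table_mean N a b (fun=> 1 : R) = 1) ->
  forall N (a : 'cV[nat]_I) (b : 'cV[nat]_(1 + J)), tot a = tot b -> (tot a <= N)%N ->
    table_mean N a b (fun=> 1 : R) = 1.
Proof.
move=> p2 pJ N a b ab aN; rewrite table_mean_split//.
rewrite (@eq_table_mean _ _ _ _ _ _ _ (fun=> 1)); last first.
  move=> c mc; have [e1 e2] := merged_rest mc.
  by apply: pJ; rewrite // e1 (leq_trans e2).
by apply: p2; rewrite // tot_merged.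
Qed.

Lemma regime_merged (a : nat -> 'cV[nat]_I) (b : nat -> 'cV[nat]_(1 + J)) N al (be : 'cV[R]_(1 + J)) :
  regime a b N al be ->
  regime a (fun r => merged_margin (b r)) N al
    (col_mx (usubmx be) (const_mx (1 - usubmx be 0 0)) : 'cV_(1 + 1)).
Proof.
move=> [r1 r2 r3 r4 r5]; have hb : usubmx be 0 0 = be (lshift J 0) 0 by rewrite mxE.
split => //.
- by apply: filterS r1 => r ->; rewrite tot_merged.
- by move=> r; rewrite tot_merged.
move=> j; case: (split_ordP j) => j' ->; rewrite ord1.
  rewrite col_mxEu hb; apply: (cvg_near_eq (r5 (lshift J 0))); apply: nearW => r.
  by rewrite /merged_margin col_mxEu mxE.
rewrite col_mxEd [const_mx _ _ _]mxE hb.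
apply: (cvg_compl_ratio _ r3 _ (r5 (lshift J 0))); first by rewrite addrC subrK.
apply: filterS r1 => r ->; rewrite /merged_margin col_mxEd [const_mx _ _ _]mxE.
by rewrite tot_split [usubmx _ _ _]mxE.
Qed.

Section conditional.
Variables (a : nat -> 'cV[nat]_I) (b : nat -> 'cV[nat]_(1 + J)) (N : nat -> nat).
Variables (al : 'cV[R]_I) (be : 'cV[R]_(1 + J)) (c : nat -> 'M[nat]_(I, 1 + 1)) (x : 'M[R]_(I, 1 + 1)).
Hypothesis reg : regime a b N al be.
Hypothesis b1 : usubmx be 0 0 < 1.
Hypothesis mc : \forall r \near \oo, has_margins (a r) (merged_margin (b r)) (c r).
Hypothesis cx : mx_cvg (fun r => std_table R (a r) (merged_margin (b r)) (c r)) x.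

Let a' r := mx_subn (a r) (lsubmx (c r)).
Let b' r := dsubmx (b r).
Let c0 : R := 1 - usubmx be 0 0.

Let c00 : 0 < c0. Proof. by rewrite subr_gt0. Qed.

Lemma cvg_rest_ratio : (tot (a' r))%:R / (tot (a r))%:R @[r --> \oo] --> c0.
Proof.
have [_ _ _ _ /(_ (rshift 1 0))] := regime_merged reg.
rewrite col_mxEd [const_mx _ _ _]mxE => H; apply: (cvg_near_eq H).
apply: filterS mc => r mr; have [e1 e2] := merged_rest mr.
by rewrite /a' e1 /merged_margin col_mxEd mxE.
Qed.

Lemma cvg_first_column i : (c r i (lshift 1 0))%:R / (tot (a r))%:R @[r --> \oo] -->
  al i 0 * usubmx be 0 0.
Proof.
have [r1 r2 r3 r4 r5] := reg.
apply: (@cvg_cell_ratio R _ (fun r => c r i (lshift 1 0)) _ (fun r => b r (lshift J 0) ord0)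
  _ _ (x i (lshift 1 0)) r3 (r4 i)).
  by have := r5 (lshift J 0); rewrite [usubmx be 0 0]mxE.
apply: (cvg_near_eq (@cx i (lshift 1 0))); apply: nearW => r.
by rewrite std_tableE /merged_margin col_mxEu mxE.
Qed.

(** The first column takes from each row the proportion b0, up to a fluctuation of order
    sqrt n; so the limiting proportions of the rows remain al. *)
Lemma regime_rest : regime a' b' N al (c0^-1 *: dsubmx be).
Proof.
have [r1 r2 r3 r4 r5] := reg; have n0 := @near_natr_gt0 R _ r3.
have rest := cvg_rest_ratio.
have r3' : tot (a' r) @[r --> \oo] --> \oo by apply: (cvg_nat_ratio r3 c00 rest).
have n0' := @near_natr_gt0 R _ r3'.
have c0n : c0 != 0 by rewrite gt_eqF.
have resti := cvgsV rest c0n.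
split => //.
- by apply: filterS mc => r mr; have [] := merged_rest mr.
- move=> r; have [h1 h2] := r2 r; split.
    by apply: leq_trans h1; apply: leq_sum => i _; rewrite mxE leq_subr.
  by apply: leq_trans h2; rewrite tot_split leq_addl.
- move=> i; have -> : al i 0 = (al i 0 - al i 0 * usubmx be 0 0) * c0^-1.
    by rewrite -[X in X - _]mulr1 -mulrBr mulfK.
  apply: (cvg_near_eq (cvgsM (cvgsB (r4 i) (@cvg_first_column i)) resti)); near=> r.
  have n1 : 0 < (tot (a r))%:R :> R by near: r.
  have n2 : 0 < (tot (a' r))%:R :> R by near: r.
  have mr : has_margins (a r) (merged_margin (b r)) (c r) by near: r.
  have ca : (c r i (lshift 1 ord0) <= a r i ord0)%N.
    by have /has_marginsP[<- _] := mr; rewrite big_split_ord/= !big_ord1 leq_addr.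
  have -> : (a' r i ord0)%:R = (a r i ord0)%:R - (c r i (lshift 1 0))%:R :> R.
    by rewrite /a' mxE [lsubmx _ _ _]mxE natrB.
  by field; rewrite !gt_eqF.
- move=> j; rewrite mxE [dsubmx be j 0]mxE mulrC.
  apply: (cvg_near_eq (cvgsM (r5 (rshift 1 j)) resti)); near=> r.
  have n1 : 0 < (tot (a r))%:R :> R by near: r.
  have n2 : 0 < (tot (a' r))%:R :> R by near: r.
  rewrite /b' [dsubmx (b r) _ _]mxE.
  by field; rewrite !gt_eqF.
Unshelve. all: by end_near. Qed.

Lemma cvg_glued (k : nat -> 'M[nat]_(I, J)) x' :
  (\forall r \near \oo, has_margins (a' r) (b' r) (k r)) ->
  mx_cvg (fun r => std_table R (a' r) (b' r) (k r)) x' ->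
  (\forall r \near \oo, has_margins (a r) (b r) (row_mx (lsubmx (c r)) (k r))) /\
  mx_cvg (fun r => std_table R (a r) (b r) (row_mx (lsubmx (c r)) (k r))) (glue_cols be x x').
Proof.
move=> mk kx; have [r1 r2 r3 r4 r5] := reg; have n0 := @near_natr_gt0 R _ r3.
have rest := cvg_rest_ratio.
have [_ _ r3' _ r5'] := regime_rest; have n0' := @near_natr_gt0 R _ r3'.
split.
  near=> r; rewrite has_margins_split; last by near: r.
  apply/andP; split; last by near: r.
  have mr : has_margins (a r) (merged_margin (b r)) (c r) by near: r.
  by rewrite -(merged_table mr).
move=> i j; case: (split_ordP j) => j' ->.
  rewrite ord1 glue_colsl; apply: (cvg_near_eq (@cx i (lshift 1 0))); apply: nearW => r.
  rewrite !std_tableE row_mxEl /merged_margin col_mxEu.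
  by rewrite [lsubmx _ _ _]mxE [usubmx _ _ _]mxE.
rewrite glue_colsr.
(* For each r the standardised entry of the whole table is an exact combination of the
   standardised entries of the remaining table and of the first column; only the two
   coefficients have to be passed to the limit. *)
have sq : Num.sqrt ((tot (a' r))%:R / (tot (a r))%:R) @[r --> \oo] --> Num.sqrt c0.
  exact: (cvg_comp _ _ rest (@sqrt_continuous R c0)).
have H2 : (b' r j' ord0)%:R / (tot (a' r))%:R @[r --> \oo] --> c0^-1 * dsubmx be j' 0.
  by have := r5' j'; rewrite mxE.
have -> : c0^-1 * (x i (lshift 1 0) * dsubmx be j' 0) = x i (lshift 1 0) * (c0^-1 * dsubmx be j' 0).
  by rewrite mulrCA.
apply: (cvg_near_eq (cvgsB (cvgsM sq (kx i j')) (cvgsM (@cx i (lshift 1 0)) H2))); near=> r.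
have n1 : 0 < (tot (a r))%:R :> R by near: r.
have n2 : 0 < (tot (a' r))%:R :> R by near: r.
have mr : has_margins (a r) (merged_margin (b r)) (c r) by near: r.
have ca : (c r i (lshift 1 ord0) <= a r i ord0)%N.
  by have /has_marginsP[<- _] := mr; rewrite big_split_ord/= !big_ord1 leq_addr.
have aE : (a' r i ord0)%:R = (a r i ord0)%:R - (c r i (lshift 1 0))%:R :> R.
  by rewrite /a' mxE [lsubmx _ _ _]mxE natrB.
have ab : tot (a r) = tot (b r) by near: r.
have nE : (b r (lshift J 0) ord0)%:R = (tot (a r))%:R - (tot (a' r))%:R :> R.
  have [e1 _] := merged_rest mr.
  by rewrite /a' e1 ab tot_split natrD addrK [usubmx _ _ _]mxE.
rewrite !std_tableE row_mxEr /merged_margin col_mxEu [usubmx (b r) _ _]mxE nE aE.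
rewrite /b' [dsubmx (b r) _ _]mxE sqrtrM ?ltW// sqrtrV ?ltW//.
have s0 : 0 < Num.sqrt (tot (a r))%:R :> R by rewrite sqrtr_gt0.
have s0' : 0 < Num.sqrt (tot (a' r))%:R :> R by rewrite sqrtr_gt0.
by field; rewrite !gt_eqF.
Unshelve. all: by end_near. Qed.

End conditional.

End step.

(** * Adding a column *)

Section unit_valued.
Context (R : realType) d (T : measurableType d) (P : probability T R) (F : T -> R).
Hypotheses (mF : measurable_fun setT F) (F01 : forall w, 0 <= F w <= 1).

Let ile1 : (\int[P]_w (F w)%:E <= 1)%E.
Proof.
rewrite -(probability_setT P) -[leRHS]mul1e -integral_cst//.
apply: ge0_le_integral => //.
- by move=> w _; rewrite lee_fin; have /andP[] := F01 w.
- exact/measurable_EFinP.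
- by move=> w _; rewrite lee_fin; have /andP[] := F01 w.
Qed.

Let ige0 : (0 <= \int[P]_w (F w)%:E)%E.
Proof. by apply: integral_ge0 => w _; rewrite lee_fin; have /andP[] := F01 w. Qed.

Lemma unit_RintegralE : (\int[P]_w F w)%:E = (\int[P]_w (F w)%:E)%E.
Proof.
by rewrite /Rintegral fineK// ge0_fin_numE// (le_lt_trans ile1)// ltry.
Qed.

Lemma unit_Rintegral : 0 <= \int[P]_w F w <= 1.
Proof. by rewrite -!lee_fin unit_RintegralE ile1 ige0. Qed.

End unit_valued.

Lemma unit_Rintegral_prod (R : realType) d1 (T1 : measurableType d1) (P1 : probability T1 R)
    d2 (T2 : measurableType d2) (P2 : probability T2 R) (F : T1 * T2 -> R) :
  measurable_fun setT F -> (forall w, 0 <= F w <= 1) ->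
  \int[(P1 \x P2)%E]_w F w = \int[P1]_x \int[P2]_y F (x, y).
Proof.
move=> mF F01; rewrite [LHS]/Rintegral [RHS]/Rintegral; congr fine.
rewrite fubini_tonelli1; first last.
- by move=> w; rewrite lee_fin; have /andP[] := F01 w.
- exact/measurable_EFinP.
apply: eq_integral => x _; rewrite unit_RintegralE//.
exact: (measurableT_comp mF (measurable_pair1 x)).
Qed.

Lemma measurable_dot (R : realType) m n d (T : measurableType d) (X : T -> 'M[R]_(m, n))
    (t : 'M[R]_(m, n)) :
  (forall i j, measurable_fun setT (fun w => X w i j)) ->
  measurable_fun setT (fun w => \sum_i \sum_j t i j * X w i j).
Proof.
move=> mX; apply: measurable_sum => i; apply: measurable_sum => j.
exact: measurable_funM.
Qed.

(** The expectation given the first column is the expectation for a table with one column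
    less, whose margins vary with r within a regime. By the hypothesis for I by J tables it
    converges to the mean of f (glue_cols be x X2) as soon as the standardised first column
    converges to x. So it is a family of test functions for the merged tables, to which the
    hypothesis for two columns applies. The limit is the expectation of f at
    glue_cols be X1 X2 with X1 and X2 independent, and its linear functionals are sums of
    independent normal variables with the variances of cov_form_split. *)
Lemma table_clt_step (R : realType) I J : (1 < J)%N ->
  table_clt R I (1 + 1) -> table_clt R I J -> table_clt R I (1 + J).
Proof.
move=> J1 [p2 clt2] [pJ cltJ]; split; first exact: sum_pmf_step.
move=> al be hal hbe.
have hb : usubmx be 0 0 = be (lshift J 0) 0 by rewrite mxE.
have b01 : usubmx be 0 0 < 1 by have /andP[_] := hbe.1 (lshift J 0); rewrite hb.
have c0 : 0 < 1 - usubmx be 0 0 by rewrite subr_gt0.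
have [d1 [T1 [P1 [X1 [mX1 nX1 cX1]]]]] := clt2 al _ hal (open_simplex_merged hbe).
have [d2 [T2 [P2 [X2 [mX2 nX2 cX2]]]]] := cltJ al _ hal (open_simplex_rest J1 hbe).
pose X (w : T1 * T2) := glue_cols be (X1 w.1) (X2 w.2).
have mX i j : measurable_fun setT (fun w => X w i j).
  case: (split_ordP j) => j' ->.
    rewrite (_ : (fun w => _) = (fun w1 => X1 w1 i (lshift 1 0)) \o fst); last first.
      by apply/funext => w; rewrite ord1 /X glue_colsl.
    by apply: measurableT_comp; [exact: mX1|exact: measurable_fst].
  rewrite (_ : (fun w => _) = (fun w : T1 * T2 => Num.sqrt (1 - usubmx be 0 0) * X2 w.2 i j' -
     (1 - usubmx be 0 0)^-1 * (X1 w.1 i (lshift 1 0) * dsubmx be j' 0))); last first.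
    by apply/funext => w; rewrite /X glue_colsr.
  apply: measurable_funB.
    apply: measurable_funM => //.
    by apply: (measurableT_comp (mX2 i j')); exact: measurable_snd.
  apply: measurable_funM => //; apply: measurable_funM => //.
  by apply: (measurableT_comp (mX1 i (lshift 1 0))); exact: measurable_fst.
exists _, (T1 * T2)%type, (P1 \x P2)%E, X; split => //.
  move=> t.
  have [s1 e1 l1] := nX1 (row_mx (lsubmx t - (1 - usubmx be 0 0)^-1 *: (rsubmx t *m dsubmx be)) 0).
  have [s2 e2 l2] := nX2 (Num.sqrt (1 - usubmx be 0 0) *: rsubmx t).
  have sE : Num.sqrt (s1 ^+ 2 + s2 ^+ 2) ^+ 2 = s1 ^+ 2 + s2 ^+ 2.
    by rewrite sqr_sqrtr// addr_ge0 ?sqr_ge0.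
  exists (Num.sqrt (s1 ^+ 2 + s2 ^+ 2)).
    by rewrite sE e1 e2 (cov_form_split al t (erefl _) b01).
  have := normal_law_add (measurable_dot _ mX1) (measurable_dot _ mX2) l1 l2 sE.
  rewrite (_ : (fun w => _) = (fun w => \sum_i \sum_j t i j * X w i j))//.
  by apply/funext => w; rewrite /X glue_cols_dot.
move=> a b N g f reg [g01 f01 sf gf].
have [r1 r2 r3 r4 r5] := reg.
pose h x := \int[P2]_w f (glue_cols be x (X2 w)).
have sglue x : seq_cont (fun x' => f (glue_cols be x x')).
  by move=> u x' ux; apply: sf; apply: glue_cols_cvg => // i j; exact: cvg_cst.
have mf x : measurable_fun setT (fun w => f (glue_cols be x (X2 w))).
  exact: (seq_cont_measurable mX2 (sglue x)).
pose H r (c : 'M[nat]_(I, 1 + 1)) := table_mean (N r) (mx_subn (a r) (lsubmx c)) (dsubmx (b r))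
  (fun k => g r (row_mx (lsubmx c) k)).
have E : \int[(P1 \x P2)%E]_w f (X w) = \int[P1]_w h (X1 w).
  by rewrite unit_Rintegral_prod//; exact: (seq_cont_measurable mX sf).
rewrite E.
have L : table_mean (N r) (a r) (merged_margin (b r)) (H r) @[r --> \oo] --> \int[P1]_w h (X1 w).
  apply: (cX1 a (fun r => merged_margin (b r)) N H h); first exact: regime_merged.
  split.
  - move=> r c mc; have [e1 e2] := merged_rest mc.
    have [aN _] := r2 r.
    apply: table_mean_bounds; first by apply: pJ; rewrite // e1 (leq_trans e2).
    move=> k mk; apply: g01; rewrite has_margins_split; last first.
      by rewrite (margins_tot mc) tot_merged.
    by rewrite mk andbT -(merged_table mc).
  - by move=> x; apply: unit_Rintegral.
  - move=> u x ux; apply: (@dominated_cvgR _ _ _ P2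
      (fun r w => f (glue_cols be (u r) (X2 w))) _ (cst 1)).
    + by move=> r.
    + by move=> w; apply: sf; apply: glue_cols_cvg => // i j; exact: cvg_cst.
    + exact: finite_measure_integrable_cst.
    + by move=> r w; have /andP[? ?] := f01 (glue_cols be (u r) (X2 w)); rewrite ger0_norm.
  - move=> c x mc cx.
    (* The bounds on g hold only at tables, and c r need not be one for small r. *)
    pose gc r k :=
      if has_margins (a r) (merged_margin (b r)) (c r) then g r (row_mx (lsubmx (c r)) k) else 0.
    have tf : test_functions (fun r => mx_subn (a r) (lsubmx (c r))) (fun r => dsubmx (b r)) gc
        (fun x' => f (glue_cols be x x')).
      split => //.
      + move=> r k mk; rewrite /gc; case: ifPn => [mr|_]; last by rewrite lexx ler01.
        apply: g01; rewrite has_margins_split; last by rewrite (margins_tot mr) tot_merged.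
        by rewrite mk andbT -(merged_table mr).
      + move=> k x' mk kx; have [m' c'] := cvg_glued reg b01 mc cx mk kx.
        by apply: (cvg_near_eq (gf _ _ m' c')); apply: filterS mc => r mr; rewrite /gc mr.
    have L := cX2 _ _ _ _ _ (regime_rest reg b01 mc cx) tf.
    by apply: (cvg_near_eq L); apply: filterS mc => r mr; rewrite /H /gc mr.
apply: (cvg_near_eq L); near=> r; rewrite [RHS]table_mean_split//.
- by near: r.
- by have [] := r2 r.
Unshelve. all: by end_near. Qed.

(** * Tables with two rows and two columns *)

Local Notation i0 := (ord0 : 'I_2).
Local Notation i1 := (lift ord0 ord0 : 'I_2).

Lemma ord2P (Q : 'I_2 -> Prop) : Q i0 -> Q i1 -> forall i, Q i.
Proof.
move=> q0 q1 [[|[|//]] h].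
- by rewrite (_ : Ordinal h = i0)//; apply: val_inj.
- by rewrite (_ : Ordinal h = i1)//; apply: val_inj.
Qed.

Lemma big_ord2 (R : Type) (idx : R) (op : Monoid.law idx) (F : 'I_2 -> R) :
  \big[op/idx]_(i < 2) F i = op (F i0) (F i1).
Proof. by rewrite !big_ord_recl big_ord0 Monoid.mulm1. Qed.

Section two_by_two.
Variable R : realType.

Definition table22 (a b : 'cV[nat]_2) (x : nat) : 'M[nat]_(2, 2) :=
  \matrix_(i, j) if i == i0 then (if j == i0 then x else (a i0 ord0 - x)%N)
    else (if j == i0 then (b i0 ord0 - x)%N else (a i1 ord0 - (b i0 ord0 - x))%N).

Lemma table22_00 a b x : table22 a b x i0 i0 = x. Proof. by rewrite mxE. Qed.
Lemma table22_01 a b x : table22 a b x i0 i1 = (a i0 ord0 - x)%N. Proof. by rewrite mxE. Qed.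
Lemma table22_10 a b x : table22 a b x i1 i0 = (b i0 ord0 - x)%N. Proof. by rewrite mxE. Qed.
Lemma table22_11 a b x : table22 a b x i1 i1 = (a i1 ord0 - (b i0 ord0 - x))%N.
Proof. by rewrite mxE. Qed.
Definition table22E := (table22_00, table22_01, table22_10, table22_11).

Lemma tot2 (a : 'cV[nat]_2) : tot a = (a i0 ord0 + a i1 ord0)%N.
Proof. by rewrite /tot big_ord2. Qed.

Lemma margins22 (a b : 'cV[nat]_2) x : tot a = tot b ->
  has_margins a b (table22 a b x) = hyp_valid (a i0 ord0) (a i1 ord0) (b i0 ord0) x.
Proof.
rewrite !tot2 /hyp_valid => ab; apply/has_marginsP/and3P.
  move=> [h1 h2]; have := h1 i0; have := h1 i1; have := h2 i0; have := h2 i1.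
  by rewrite !big_ord2 !table22E /= => *; split; lia.
move=> [v1 v2 v3]; split; apply: ord2P; rewrite big_ord2 !table22E /=; lia.
Qed.

Lemma table22_unique (a b : 'cV[nat]_2) (k : 'M[nat]_(2, 2)) : has_margins a b k ->
  k = table22 a b (k i0 i0).
Proof.
move=> /has_marginsP[h1 h2]; apply/matrixP.
have := h1 i0; have := h1 i1; have := h2 i0; have := h2 i1.
by rewrite !big_ord2 /= => *; apply: ord2P; apply: ord2P; rewrite !table22E //; lia.
Qed.

Lemma table_pmf22 (a b : 'cV[nat]_2) x : tot a = tot b ->
  table_pmf a b (table22 a b x) =
  hyp_pmf R (a i0 ord0) (a i1 ord0) (b i0 ord0) (b i1 ord0) x.
Proof.
move=> ab; rewrite /table_pmf margins22// /hyp_pmf; case: ifP => // _.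
by rewrite !big_ord2 !table22E mulnA.
Qed.

(** A table with two rows and two columns is determined by its corner. *)
Lemma table_mean22 N (a b : 'cV[nat]_2) (g : 'M[nat]_(2, 2) -> R) :
  tot a = tot b -> (tot a <= N)%N ->
  table_mean N a b g = \sum_(x < N.+1)
    hyp_pmf R (a i0 ord0) (a i1 ord0) (b i0 ord0) (b i1 ord0) x * g (table22 a b x).
Proof.
move=> ab aN; pose e (x : 'I_N.+1) : 'M['I_N.+1]_(2, 2) := map_mx inord (table22 a b x).
have te x : ord_table (e x) = table22 a b x.
  apply/matrixP => i j; rewrite [LHS]mxE [e x i j]mxE /= inordK// ltnS.
  have aN' := aN; have bN := aN; rewrite ab in bN; rewrite !tot2 in aN' bN.
  have xN : (x <= N)%N by rewrite -ltnS.
  by move: i j; apply: ord2P; apply: ord2P; rewrite table22E; lia.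
rewrite /table_mean (bigID (fun k => has_margins a b (ord_table k)))/=.
rewrite [X in _ + X]big1 ?addr0; last first.
  by move=> k /negbTE mk; rewrite /table_pmf mk mul0r.
rewrite (reindex_onto e (fun k => k i0 i0)) /=; last first.
  move=> k mk; apply/matrixP => i j; apply: val_inj.
  have tabE (y : 'M['I_N.+1]_(2, 2)) : val (y i j) = ord_table y i j by rewrite mxE.
  by rewrite !tabE te [in RHS](table22_unique mk) !mxE.
rewrite big_mkcond; apply: eq_bigr => x _; rewrite te table_pmf22//.
have -> : e x i0 i0 == x.
  by apply/eqP/val_inj; rewrite -[LHS]/(val (e x i0 i0)) mxE /= table22E inord_val.
rewrite andbT margins22//; case: ifPn => // /negbTE v.
by rewrite /hyp_pmf v mul0r.
Qed.

Definition sgn2 (i : 'I_2) : R := if i == i0 then 1 else -1.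

(** The deviations of the four cells of a table are equal up to sign, so that in the limit
    the whole matrix is a multiple of one fixed sign pattern. *)
Definition line22 (y : R) : 'M[R]_(2, 2) := \matrix_(i, j) (sgn2 i * sgn2 j * y).

Lemma sum_pmf22 N (a b : 'cV[nat]_2) : tot a = tot b -> (tot a <= N)%N ->
  table_mean N a b (fun=> 1 : R) = 1.
Proof.
move=> ab aN; rewrite table_mean22//; under eq_bigr do rewrite mulr1.
by apply: sum_hyp_pmf; rewrite -!tot2.
Qed.

(** The covariance has rank one, as the limit lives on a line. *)
Lemma cov_form22 (al be : 'cV[R]_2) (t : 'M[R]_(2, 2)) :
  al i0 0 + al i1 0 = 1 -> be i0 0 + be i1 0 = 1 ->
  cov_form al be t = (\sum_i \sum_j t i j * (sgn2 i * sgn2 j)) ^+ 2 *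
    (al i0 0 * al i1 0 * (be i0 0 * be i1 0)).
Proof.
move=> sa sb.
have a1 : al i1 0 = 1 - al i0 0 by rewrite -sa addrAC subrr add0r.
have b1 : be i1 0 = 1 - be i0 0 by rewrite -sb addrAC subrr add0r.
by rewrite cov_formE !big_ord2 /sgn2 /= a1 b1; ring.
Qed.

Lemma table_clt22 : table_clt R 2 2.
Proof.
split; first by move=> N a b; exact: sum_pmf22.
move=> al be [ha sa] [hb sb].
move: sa sb; rewrite !big_ord2 /= => sa sb.
have /andP[a0 _] := ha i0; have /andP[a1 _] := ha i1.
have /andP[b0 _] := hb i0; have /andP[b1 _] := hb i1.
pose V := al i0 0 * al i1 0 * (be i0 0 * be i1 0).
have V0 : 0 < V by rewrite !mulr_gt0.
have s0 : Num.sqrt V != 0 by rewrite gt_eqF// sqrtr_gt0.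
have mX i j : measurable_fun setT (fun y => line22 y i j).
  rewrite (_ : (fun y => _) = (fun y : R => sgn2 i * sgn2 j * y)); last first.
    by apply/funext => y; rewrite mxE.
  exact: measurable_funM.
exists _, (measurableTypeR R), (normal_prob 0 (Num.sqrt V)), line22; split => //.
  (* On the line carried by line22, the functional with coefficients t is a multiple of
     the coordinate. *)
  move=> t; pose cc := \sum_i \sum_j t i j * (sgn2 i * sgn2 j).
  exists (cc * Num.sqrt V).
    by rewrite exprMn sqr_sqrtr ?ltW// cov_form22.
  move=> B mB; rewrite -normal_prob_scale//; congr (normal_prob _ _ _).
  apply/funext => y /=; congr (B _); rewrite /cc mulr_suml; apply: eq_bigr => i _.
  by rewrite mulr_suml; apply: eq_bigr => j _; rewrite mxE mulrA.
move=> a b N g f [r1 r2 r3 r4 r5] [g01 f01 sf gf].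
have n0 := @near_natr_gt0 R _ r3.
have mf : measurable_fun setT (fun y => f (line22 y)) := seq_cont_measurable mX sf.
have -> : \int[normal_prob 0 (Num.sqrt V)]_w f (line22 w) =
    \int[lebesgue_measure]_y (normal_pdf 0 (Num.sqrt V) y * f (line22 y)).
  rewrite /Rintegral integral_normal_prob//.
  by exists 1 => y; have /andP[? ?] := f01 (line22 y); rewrite ger0_norm.
pose G r x := if has_margins (a r) (b r) (table22 (a r) (b r) x) then g r (table22 (a r) (b r) x) else 0.
have totE r : tot (a r) = (a r i0 ord0 + a r i1 ord0)%N by exact: tot2.
have L : \sum_(x < (N r).+1) hyp_pmf R (a r i0 ord0) (a r i1 ord0) (b r i0 ord0) (b r i1 ord0) x * G r x
    @[r --> \oo] --> \int[lebesgue_measure]_y (normal_pdf 0 (Num.sqrt V) y * f (line22 y)).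
  apply: (@hypergeometric_clt R (fun r => a r i0 ord0) (fun r => a r i1 ord0)
    (fun r => b r i0 ord0) (fun r => b r i1 ord0) N _ _ _ _ G (fun y => f (line22 y))) => //.
  - by apply: filterS r1 => r; rewrite !tot2.
  - by apply: nearW => r; have [+ _] := r2 r; rewrite tot2.
  - by apply: cvg_trans r3; apply: near_eq_cvg; apply: nearW => r; rewrite tot2.
  - by apply: (cvg_near_eq (r4 i0)); apply: nearW => r; rewrite tot2.
  - by apply: (cvg_near_eq (r5 i0)); apply: nearW => r; rewrite tot2.
  - move=> r x _; rewrite /G; case: ifPn => [m|_]; [exact: g01|by rewrite lexx ler01].
  - move=> k y v ky.
    have mk : \forall r \near \oo, has_margins (a r) (b r) (table22 (a r) (b r) (k r)).
      by apply: filterS2 r1 v => r ab; rewrite margins22.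
    suff H : mx_cvg (fun r => std_table R (a r) (b r) (table22 (a r) (b r) (k r))) (line22 y).
      by apply: (cvg_near_eq (gf _ _ mk H)); apply: filterS mk => r; rewrite /G => ->.
    have cell (eps : R) i j : (\forall r \near \oo,
        (table22 (a r) (b r) (k r) i j)%:R - (a r i ord0)%:R * (b r j ord0)%:R / (tot (a r))%:R =
        eps * ((k r)%:R - (a r i0 ord0)%:R * (b r i0 ord0)%:R / (tot (a r))%:R)) ->
        std_table R (a r) (b r) (table22 (a r) (b r) (k r)) i j @[r --> \oo] --> eps * y.
      move=> H; apply: (cvg_near_eq (cvgsMl (c := eps) ky)); apply: filterS H => r.
      by rewrite std_tableE -totE => ->; rewrite mulrA.
    have nums : \forall r \near \oo, [/\ 0 < (tot (a r))%:R :> R,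
       (tot (a r))%:R = (a r i0 ord0)%:R + (a r i1 ord0)%:R :> R,
       (tot (a r))%:R = (b r i0 ord0)%:R + (b r i1 ord0)%:R :> R &
       [/\ (a r i0 ord0 - k r)%:R = (a r i0 ord0)%:R - (k r)%:R :> R,
         (b r i0 ord0 - k r)%:R = (b r i0 ord0)%:R - (k r)%:R :> R &
         (a r i1 ord0 - (b r i0 ord0 - k r))%:R =
           (a r i1 ord0)%:R - ((b r i0 ord0)%:R - (k r)%:R) :> R]].
      near=> r.
      have /and3P[v1 v2 v3] : hyp_valid (a r i0 ord0) (a r i1 ord0) (b r i0 ord0) (k r).
        by near: r.
      have ab : tot (a r) = tot (b r) by near: r.
      split; [by near: r|by rewrite tot2 natrD|by rewrite ab tot2 natrD|].
      by rewrite !natrB.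
    apply: ord2P; apply: ord2P; rewrite /line22 mxE /sgn2 /=; apply: cell;
      apply: filterS nums => r [n1 ea eb [e1 e2 e3]]; rewrite ?table22E ?e1 ?e2 ?e3.
    + by rewrite !mul1r.
    + by have -> : (b r i1 ord0)%:R = (tot (a r))%:R - (b r i0 ord0)%:R :> R;
        [rewrite eb addrAC subrr add0r|field; rewrite gt_eqF].
    + by have -> : (a r i1 ord0)%:R = (tot (a r))%:R - (a r i0 ord0)%:R :> R;
        [rewrite ea addrAC subrr add0r|field; rewrite gt_eqF].
    + have -> : (b r i1 ord0)%:R = (tot (a r))%:R - (b r i0 ord0)%:R :> R.
        by rewrite eb addrAC subrr add0r.
      have -> : (a r i1 ord0)%:R = (tot (a r))%:R - (a r i0 ord0)%:R :> R.
        by rewrite ea addrAC subrr add0r.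
      by field; rewrite gt_eqF.
apply: (cvg_near_eq L); apply: filterS r1 => r ab; have [aN _] := r2 r.
rewrite [RHS]table_mean22//; apply: eq_bigr => x _; rewrite /G margins22//; case: ifPn => // /negbTE v.
by rewrite /hyp_pmf v !mul0r.
Unshelve. all: by end_near. Qed.

End two_by_two.

(** * From two by two to all sizes *)

(** Columns are added to two by two tables; transposition then gives tables with two
    columns and any number of rows, to which columns are added again. *)
Lemma table_clt_all (R : realType) I J : (1 < I)%N -> (1 < J)%N -> table_clt R I J.
Proof.
have grow m : table_clt R m 2 -> forall n, table_clt R m n.+2.
  move=> c2; elim=> [//|n ih].
  exact: (@table_clt_step R m n.+2 isT c2 ih).
case: I => [|[|I']] // _; case: J => [|[|J']] // _.
by apply: (grow); apply: table_clt_tr; apply: (grow); exact: table_clt22.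
Qed.

Lemma simplex_gt1 (R : realType) m (al : 'cV[R]_m) : open_simplex al -> (1 < m)%N.
Proof.
case: m al => [|[|m]]// al [h1 h2]; move: h2.
  by rewrite big_ord0 => /eqP; rewrite eq_sym oner_eq0.
by rewrite big_ord1 => E; have := h1 ord0; rewrite E ltxx andbF.
Qed.

(** * From the limit theorem on mass functions to random tables *)

Lemma affine_integral (R : realType) d (T : measurableType d) (P : probability T R)
    (F : T -> R) (A B : R) : measurable_fun setT F -> (forall w, 0 <= F w <= 1) ->
  (\int[P]_w (A * F w - B)%:E = (A * \int[P]_w F w - B)%:E)%E.
Proof.
move=> mF F01.
have iF : P.-integrable setT (EFin \o F).
  apply: (@integrable_of_le _ _ R P F (cst 1)) => //.
  exact: finite_measure_integrable_cst.
have iB : P.-integrable setT (EFin \o cst B) by exact: finite_measure_integrable_cst.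
have iAF : P.-integrable setT (EFin \o (fun w => A * F w)).
  rewrite (_ : _ \o _ = fun w => (A%:E * (EFin \o F) w)%E); first exact: integrableZl.
  by apply/funext => w.
under eq_integral do rewrite EFinB.
rewrite (integralB measurableT iAF iB) EFinB; congr (_ - _)%E.
  by rewrite EFinM unit_RintegralE// -integralZl.
transitivity (\int[P]_w cst B%:E w)%E => //.
by rewrite integral_cst//= probability_setT mule1.
Qed.

Section table_expectation.
Context (R : realType) I J (a : 'cV[nat]_I) (b : 'cV[nat]_J) (N : nat).
Context d (T : measurableType d) (P : probability T R) (W : T -> 'M[nat]_(I, J)).
Hypothesis lawW : has_pmf P W (table_pmf a b).

Lemma measurable_table (G : 'M[nat]_(I, J) -> R) : measurable_fun setT (G \o W).
Proof.
move=> _ B mB; rewrite setTI comp_preimage.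
by apply: measurable_countable_preimage => k; have [] := lawW k.
Qed.

Hypothesis p1 : table_mean N a b (fun=> 1 : R) = 1.

(** Summing over a part of the values of W only can lose mass. *)
Let table_mean_le (G : 'M[nat]_(I, J) -> R) : (forall k, 0 <= G k <= 1) ->
  table_mean N a b G <= \int[P]_w G (W w).
Proof.
move=> G01.
have mW k : measurable (W @^-1` [set k]) by have [] := lawW k.
have mi (k : 'M['I_N.+1]_(I, J)) :
    measurable_fun setT (fun w => G (ord_table k) * \1_(W @^-1` [set ord_table k]) w).
  by apply: measurable_funM => //; exact: measurable_indic.
rewrite -lee_fin unit_RintegralE//; last exact: measurable_table.
have -> : (table_mean N a b G)%:E =
    (\int[P]_w (\sum_(k : 'M['I_N.+1]_(I, J)) G (ord_table k) * \1_(W @^-1` [set ord_table k]) w)%:E)%E.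
  under [RHS]eq_integral do rewrite -sumEFin.
  rewrite ge0_integral_sum//; last 2 first.
  - by move=> k; exact/measurable_EFinP.
  - by move=> k w _; rewrite lee_fin mulr_ge0 ?indicE//; have /andP[] := G01 (ord_table k).
  rewrite /table_mean -sumEFin; apply: eq_bigr => k _.
  under eq_integral do rewrite EFinM.
  rewrite ge0_integralZl//=; first last.
  - by rewrite lee_fin; have /andP[] := G01 (ord_table k).
  - by apply/measurable_EFinP; exact: measurable_indic.
  rewrite integral_indic// setIT EFinM muleC; congr (_ * _)%E.
  by have [_ E] := lawW (ord_table k); rewrite /= E.
apply: ge0_le_integral => //.
- move=> w _; rewrite lee_fin; apply: sumr_ge0 => k _.
  by rewrite mulr_ge0 ?indicE//; have /andP[] := G01 (ord_table k).
- by apply/measurable_EFinP; apply: measurable_sum.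
- by apply/measurable_EFinP; exact: measurable_table.
move=> w _; rewrite lee_fin.
have G0 := G01 (W w).
have [k0|none] := pselect (exists k : 'M['I_N.+1]_(I, J), ord_table k = W w); last first.
  rewrite big1; first by have /andP[] := G0.
  move=> k _; rewrite indicE memNset ?mulr0//= => E; by apply: none; exists k.
case: k0 => k0 Wk0.
rewrite (bigD1 k0)//= indicE mem_set ?mulr1; last by rewrite /= Wk0.
rewrite big1 ?addr0 ?Wk0// => k kk0; rewrite indicE memNset ?mulr0//= => E.
move/eqP: kk0; apply; apply/matrixP => i j; apply: val_inj.
have := congr1 (fun M : 'M[nat]_(I, J) => M i j) (etrans (esym E) (esym Wk0)).
by rewrite !mxE.
Qed.

(** One inequality is table_mean_le for G, the other one is table_mean_le for 1 - G, since
    the total mass of the table law is 1. *)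
Lemma table_expectation (G : 'M[nat]_(I, J) -> R) : (forall k, 0 <= G k <= 1) ->
  \int[P]_w G (W w) = table_mean N a b G.
Proof.
move=> G01; apply/eqP; rewrite eq_le table_mean_le// andbT.
have G01' k : 0 <= 1 - G k <= 1.
  by have /andP[g0 g1] := G01 k; rewrite subr_ge0 g1 gerBl.
have := table_mean_le G01'.
have -> : table_mean N a b (fun k => 1 - G k) = 1 - table_mean N a b G.
  rewrite -[X in _ = X - _]p1 /table_mean -sumrB; apply: eq_bigr => k _.
  by rewrite mulrBr.
have mG := measurable_table G.
have ic : P.-integrable setT (EFin \o cst (1 : R)) by exact: finite_measure_integrable_cst.
have iG : P.-integrable setT (EFin \o (G \o W)).
  by apply: (@integrable_of_le _ _ R P _ (cst 1)) => // w; exact: G01.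
have -> : \int[P]_w (1 - G (W w)) = 1 - \int[P]_w G (W w).
  rewrite (@RintegralB _ _ R P setT (cst 1) (G \o W))// Rintegral_cst//=.
  by rewrite probability_setT mulr1.
lra.
Qed.

End table_expectation.

Lemma measurable_borel_mx (R : realType) m n d (T : measurableType d) (X : T -> 'M[R]_(m, n)) :
  (forall i j, measurable_fun setT (fun w => X w i j)) ->
  measurable_fun setT (X : T -> borelType 'M[R]_(m, n)).
Proof.
move=> mX; apply: (@measurability _ _ T (borelType 'M[R]_(m, n)) setT X (@open 'M[R]_(m, n)) erefl).
by move=> _ [U oU <-]; rewrite setTI; exact: measurable_open_preimage.
Qed.

Theorem lemma4 (R : realType) (I J : nat)
    (a : nat -> 'cV[nat]_I) (b : nat -> 'cV[nat]_J) (n : nat -> nat)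
    (na : forall r, n r = (\sum_(i < I) a r i ord0)%N)
    (nb : forall r, n r = (\sum_(j < J) b r j ord0)%N)
    (d : nat -> measure_display) (T : forall r, measurableType (d r))
    (P : forall r, probability (T r) R) (W : forall r, T r -> 'M[nat]_(I, J))
    (lawW : forall r, has_pmf (P r) (W r) (table_pmf (a r) (b r)))
    (alpha : 'cV[R]_I) (beta : 'cV[R]_J)
    (alphaT : open_simplex alpha) (betaT : open_simplex beta)
    (n_oo : n r @[r --> \oo] --> \oo)
    (a_alpha : (n r)%:R^-1 *: (natmx (a r) : 'cV[R]_I) @[r --> \oo] --> alpha)
    (b_beta : (n r)%:R^-1 *: (natmx (b r) : 'cV[R]_J) @[r --> \oo] --> beta) :
  exists mu : probability (borelType 'M[R]_(I, J)) R,
    is_normal mu 0 (fun i j k l =>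
      alpha i 0 * ((i == k)%:R - alpha k 0) *
      (beta j 0 * ((j == l)%:R - beta l 0))) /\
    cvg_in_distribution P
      (fun r w => (Num.sqrt (n r)%:R)^-1 *:
        (natmx (W r w) - (n r)%:R^-1 *: (natmx (a r) *m (natmx (b r))^T))) mu.
Proof.
have [p1 clt] := table_clt_all R (simplex_gt1 alphaT) (simplex_gt1 betaT).
have [d0 [T0 [P0 [X [mX nX cX]]]]] := clt alpha beta alphaT betaT.
have mX' := measurable_borel_mx mX.
pose Xm : {mfun T0 >-> borelType 'M[R]_(I, J)} := HB.pack (X : T0 -> borelType 'M[R]_(I, J))
  (isMeasurableFun.Build _ _ _ _ _ mX').
exists (distribution P0 Xm); split.
  split=> [i j k l|t].
    rewrite (eq_sym k) (eq_sym l).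
    by have [->|_] := eqVneq i k; have [->|_] := eqVneq j l => /=; ring.
  have [s sq ls] := nX t; exists s; first exact: sq.
  move=> B mB; rewrite [X in normal1 X](_ : _ = 0); first exact: ls.
  by rewrite big1// => i _; rewrite big1// => j _; rewrite mxE mulr0.
have ta r : tot (a r) = n r by rewrite na.
have tb r : tot (b r) = n r by rewrite nb.
move=> f cf [M fM].
(* The limit statement is about test functions with values in [0, 1]: f is rescaled. *)
have [M' M0 fM'] : exists2 M', 0 < M' & forall x, - M' <= f x <= M'.
  exists (`|M| + 1) => [|x]; first by rewrite ltr_pwDr.
  by rewrite -ler_norml (le_trans (fM x))// (le_trans (ler_norm M))// lerDl.
pose F x := (f x + M') / (2 * M').
have F01 x : 0 <= F x <= 1.
  have /andP[l1 l2] := fM' x.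
  have M2 : 0 < 2 * M' by rewrite mulr_gt0.
  by rewrite /F ler_pdivrMr// ler_pdivlMr// mul0r mul1r; apply/andP; split; lra.
have fE x : f x = 2 * M' * F x - M' by rewrite /F; field; rewrite gt_eqF.
have sF : seq_cont F.
  by move=> u x ux; apply: cvgsMr; apply: cvgsD; [exact: (continuous_seq_cont cf)|exact: cvgs_cst].
have mF : measurable_fun setT (F \o X) := seq_cont_measurable mX sF.
have mfB : measurable_fun setT (f : borelType 'M[R]_(I, J) -> R).
  apply: (measurability _ (RGenOInfty.measurableE R)) => _ [_ [y ->] <-].
  rewrite setTI; apply: sub_sigma_algebra.
  by apply: open_comp; [move=> x _; exact: cf|exact: rray_open].
have -> : (\int[distribution P0 Xm]_x (f x)%:E)%E = (2 * M' * \int[P0]_w F (X w) - M')%:E.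
  under eq_integral do rewrite fE.
  have mFB : measurable_fun setT (F : borelType 'M[R]_(I, J) -> R).
    by apply: measurable_funM => //; apply: measurable_funD.
  rewrite (@affine_integral R _ (borelType 'M[R]_(I, J)))//; congr (_ * _ - _)%:E.
  rewrite /Rintegral ge0_integral_distribution//; first exact/measurable_EFinP.
  by move=> x; rewrite lee_fin; have /andP[] := F01 x.
have lhs r : (\int[P r]_w (f ((Num.sqrt (n r)%:R)^-1 *:
        (natmx (W r w) - (n r)%:R^-1 *: (natmx (a r) *m (natmx (b r))^T))))%:E)%E =
   (2 * M' * table_mean (n r) (a r) (b r) (fun k => F (std_table R (a r) (b r) k)) - M')%:E.
  rewrite -(@table_expectation _ _ _ (a r) (b r) (n r) _ _ (P r) (W r))//; last first.
    by apply: p1; rewrite ?ta ?tb.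
  rewrite -affine_integral//; last exact: (@measurable_table _ _ _ _ _ _ _ _ _ (lawW r)
    (fun k => F (std_table R (a r) (b r) k))).
  by apply: eq_integral => w _; rewrite /std_table ta -fE.
have L : table_mean (n r) (a r) (b r) (fun k => F (std_table R (a r) (b r) k)) @[r --> \oo] -->
    \int[P0]_w F (X w).
  apply: (cX a b n (fun r k => F (std_table R (a r) (b r) k)) F).
    split.
    - by apply: nearW => r; rewrite ta tb.
    - by move=> r; rewrite ta tb.
    - by rewrite [X in X @ _](_ : _ = n)//; apply/funext => r; rewrite ta.
    - move=> i; have := cvg_comp _ _ a_alpha (@coord_continuous R I 1 i 0 alpha).
      move=> H; apply: (cvg_near_eq H); apply: nearW => r /=.
      by rewrite !mxE ta mulrC.
    - move=> j; have := cvg_comp _ _ b_beta (@coord_continuous R J 1 j 0 beta).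
      move=> H; apply: (cvg_near_eq H); apply: nearW => r /=.
      by rewrite !mxE ta mulrC.
  by split => // [k x _ kx]; apply: sF.
have {}L := cvgsB (cvgsMl (c := 2 * M') L) (@cvgs_cst R M').
under eq_cvg do rewrite lhs.
by apply: cvg_EFin; [exact: nearW|exact: L].
Qed.
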